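(* Let $G=\mathrm{Con}(\mathbf{R}^2)$. Any continuous $G$-equivariant map $f\colon\mathcal{D}_{\mathcal{C}^2}(\mathbf{R}^2)\to\mathbf{R}^2$ generates a $G$-equivariant center $c_f$ on $\mathcal{D}_{\mathcal{C}^2}(\mathbf{R}^2)$ given by $$c_f(D):=r_{D^{\frac12}}\big(f(D),1\big).$$ Furthermore, if $f$ is the Steiner point, center of mass, or circumcenter, then $c_f(D)=f(D)$ whenever $D$ is convex.
   Context: $\mathrm{Con}(\mathbf{R}^2)$ is the group of conformal transformations $x\mapsto s\rho(x)+b$ of $\mathbf{R}^2$ ($s>0$, $\rho\in O(2)$, $b\in\mathbf{R}^2$). Let $B^2$ be the closed unit disk in $\mathbf{R}^2$. Spaces of domains. A Jordan domain in $\mathbf{R}^2$ is the image of a continuous injective map $B^2\to\mathbf{R}^2$ (a parametrization); $\mathcal{D}(\mathbf{R}^2)$ is the set of Jordan domains, with the topology in which two domains are close if they admit $\mathcal{C}^0$-close parametrizations (the quotient of the space of continuous injective maps $B^2\to\mathbf{R}^2$ by $\mathrm{Homeo}(B^2)$). $\mathcal{D}_{\mathcal{C}^2}(\mathbf{R}^2)$ is the set of images of $\mathcal{C}^2$ embeddings $B^2\to\mathbf{R}^2$ with the $\mathcal{C}^2$-topology: two domains are close if they admit $\mathcal{C}^2$ embeddings as parametrizations that are $\mathcal{C}^2$-close. A center on $\mathcal{D}_{\mathcal{C}^2}(\mathbf{R}^2)$ is a continuous map $c\colon\mathcal{D}_{\mathcal{C}^2}(\mathbf{R}^2)\to\mathbf{R}^2$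 with $c(D)\in\mathrm{int}(D)$ for all $D$. A map $f\colon\mathcal{D}_{\mathcal{C}^2}(\mathbf{R}^2)\to\mathbf{R}^2$ is $G$-equivariant if $f(g(D))=g(f(D))$ for all $g\in G$ and all $D$. The family $r$. Here $r$ is a fixed assignment $D\mapsto r_D$ such that for each $D\in\mathcal{D}(\mathbf{R}^2)$, $r_D\colon\mathbf{R}^2\times[0,1]\to\mathbf{R}^2$ is a strong deformation retraction of $\mathbf{R}^2$ onto $D$ (continuous, $r_D(x,0)=x$ and $r_D(x,1)\in D$ for all $x$, $r_D(x,t)=x$ for all $x\in D$ and all $t$), the mapping $\mathcal{D}(\mathbf{R}^2)\ni D\mapsto r_D\in\mathcal{C}^0(\mathbf{R}^2\times[0,1],\mathbf{R}^2)$ is continuous, and $\rho(r_D(x,t))=r_{\rho(D)}(\rho(x),t)$ for all $\rho\in G$, $D\in\mathcal{D}(\mathbf{R}^2)$, $x\in\mathbf{R}^2$, $t\in[0,1]$. Such an assignment exists. The domain $D^{\frac12}$. For $D\in\mathcal{D}_{\mathcal{C}^2}(\mathbf{R}^2)$, $\mathrm{reach}(D)$ is the supremum of numbers $s$ such that through every point of $\partial D$ there passes a circle of radius $s$ contained in $D$; it is positive. $D^{\frac12}\subset D$ is the domain obtained by moving $\partial D$ along its inward normals by the distance $\mathrm{reach}(D)/2$; equivalently $D^{\frac12}=\{x\in D: d_{\partial D}(x)\geq\mathrm{reach}(D)/2\}$, where $d_{\partial D}$ is the distance from $\partial D$, and $D=D^{\frac12}+\frac{\mathrm{reach}(D)}{2}B^2$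 (Minkowski sum). One has $D^{\frac12}\in\mathcal{D}_{\mathcal{C}^2}(\mathbf{R}^2)$. Classical points. The center of mass of $D$ is taken with respect to area. The circumcenter is the center of the circumscribing circle of $D$ (the smallest circle enclosing $D$). The Steiner point is the center of mass of $\partial D$ with density given by its curvature, i.e. $\int_{\partial D}x\,\kappa\,ds\big/\int_{\partial D}\kappa\,ds$, where $\kappa$ is the curvature of $\partial D$ with respect to the inward normal (nonnegative when $D$ is convex). *)

(* Defs.v *)
From HB Require Import structures.
From mathcomp Require Import all_boot all_order all_algebra.
From mathcomp Require Import all_classical all_reals all_analysis.

Set Implicit Arguments.
Unset Strict Implicit.
Unset Printing Implicit Defensive.

Import Order.TTheory GRing.Theory Num.Theory.
Import numFieldNormedType.Exports.

Local Open Scope classical_set_scope.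
Local Open Scope ring_scope.

(* The library norm on [R * R] is the sup norm: it induces the usual topology
   and differential calculus, but metric notions must use [enorm]. *)
Notation plane R := (R * R)%type.

Definition dot (R : realType) (x y : plane R) : R := x.1 * y.1 + x.2 * y.2.
Definition enorm (R : realType) (x : plane R) : R := Num.sqrt (dot x x).

Definition disk (R : realType) (c : plane R) (s : R) : set (plane R) :=
  [set x | enorm (x - c) <= s].
Definition circle (R : realType) (c : plane R) (s : R) : set (plane R) :=
  [set x | enorm (x - c) = s].
Definition unit_disk (R : realType) : set (plane R) := disk 0 1.

Definition boundary (R : realType) (D : set (plane R)) : set (plane R) :=
  closure D `\` interior D.

Definition mx_act (R : realType) (A : 'M[R]_2) (x : plane R) : plane R :=
  (A 0 0 * x.1 + A 0 1 * x.2, A 1 0 * x.1 + A 1 1 * x.2).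

Definition conformal (R : realType) (g : plane R -> plane R) : Prop :=
  exists (s : R) (A : 'M[R]_2) (b : plane R),
    [/\ 0 < s, A^T *m A = 1%:M & forall x, g x = s *: mx_act A x + b].

(* A map B^2 -> R^2 is represented by a total map, of which only the
   restriction to the unit disk matters. *)
Definition jordan_param (R : realType) (phi : plane R -> plane R) : Prop :=
  {within @unit_disk R, continuous phi} /\ {in @unit_disk R &, injective phi}.

Definition C0_close (R : realType) (e : R) (phi psi : plane R -> plane R) :
    Prop :=
  forall x, unit_disk x -> enorm (phi x - psi x) < e.

Record jordan_domain (R : realType) := JordanDomain {
  jordan_set :> set (plane R);
  jordan_setP : exists2 phi, jordan_param phi &
                  jordan_set = phi @` @unit_disk R }.

(* Quotient topology: [U] is open when the set of parametrizations with image
   in [U] is open for uniform convergence on the disk.  Two parametrizations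
   have the same image exactly when they differ by a homeomorphism of B^2. *)
Definition jordan_open (R : realType) : set (set (jordan_domain R)) :=
  [set U | forall (D : jordan_domain R) phi, U D -> jordan_param phi ->
     D = phi @` @unit_disk R :> set _ ->
     exists2 e : R, 0 < e & forall (D' : jordan_domain R) psi,
       jordan_param psi -> D' = psi @` @unit_disk R :> set _ ->
       C0_close e phi psi -> U D'].

Lemma jordan_openT (R : realType) : @jordan_open R setT.
Proof. by move=> D phi _ _ _; exists 1. Qed.

Lemma jordan_openI (R : realType) : setI_closed (@jordan_open R).
Proof.
move=> U V oU oV D phi [UD VD] pphi Dphi.
have [e e0 He] := oU _ _ UD pphi Dphi.
have [d d0 Hd] := oV _ _ VD pphi Dphi.
exists (Num.min e d); first by rewrite lt_min e0 d0.
move=> D' psi ppsi D'psi cl; split.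
- apply: He ppsi D'psi _ => x /cl; rewrite lt_min => /andP[]; done.
- apply: Hd ppsi D'psi _ => x /cl; rewrite lt_min => /andP[]; done.
Qed.

Lemma jordan_open_bigU (R : realType) (I : Type)
    (f : I -> set (jordan_domain R)) :
  (forall i, jordan_open (f i)) -> jordan_open (\bigcup_i f i).
Proof.
move=> of_ D phi [i _ fiD] pphi Dphi.
have [e e0 He] := of_ i _ _ fiD pphi Dphi.
by exists e => // D' psi ppsi D'psi cl; exists i => //; apply: He cl.
Qed.

HB.instance Definition _ (R : realType) := gen_eqMixin (jordan_domain R).
HB.instance Definition _ (R : realType) := gen_choiceMixin (jordan_domain R).
HB.instance Definition _ (R : realType) :=
  isOpenTopological.Build (jordan_domain R)
    (@jordan_openT R) (@jordan_openI R) (@jordan_open_bigU R).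

Definition C1_on (R : realType) (U : set (plane R)) (f : plane R -> plane R) :
    Prop :=
  forall x, U x ->
    differentiable f x /\ forall v, {for x, continuous ('D_v f)}.

Definition C2_on (R : realType) (U : set (plane R)) (f : plane R -> plane R) :
    Prop :=
  C1_on U f /\ forall v, C1_on U ('D_v f).

(* C^2 on the closed disk means C^2 on an open neighbourhood of it; the
   derivatives at points of the disk depend only on the restriction of [phi]
   to the disk. *)
Definition C2_embedding (R : realType) (phi : plane R -> plane R) : Prop :=
  [/\ exists U : set (plane R),
        [/\ open U, @unit_disk R `<=` U & C2_on U phi],
      {in @unit_disk R &, injective phi} &
      forall x, unit_disk x -> injective ('d phi x)].

Definition C2_close (R : realType) (e : R) (phi psi : plane R -> plane R) :
    Prop :=
  forall x, unit_disk x ->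
    [/\ enorm (phi x - psi x) < e,
        forall v, enorm v = 1 -> enorm ('D_v phi x - 'D_v psi x) < e &
        forall v w, enorm v = 1 -> enorm w = 1 ->
          enorm ('D_w ('D_v phi) x - 'D_w ('D_v psi) x) < e].

Record C2_domain (R : realType) := C2Domain {
  C2_set :> set (plane R);
  C2_setP : exists2 phi, C2_embedding phi & C2_set = phi @` @unit_disk R }.

Definition C2_open (R : realType) : set (set (C2_domain R)) :=
  [set U | forall (D : C2_domain R) phi, U D -> C2_embedding phi ->
     D = phi @` @unit_disk R :> set _ ->
     exists2 e : R, 0 < e & forall (D' : C2_domain R) psi,
       C2_embedding psi -> D' = psi @` @unit_disk R :> set _ ->
       C2_close e phi psi -> U D'].

Lemma C2_openT (R : realType) : @C2_open R setT.
Proof. by move=> D phi _ _ _; exists 1. Qed.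

Lemma C2_closeW (R : realType) (e d : R) (phi psi : plane R -> plane R) :
  e <= d -> C2_close e phi psi -> C2_close d phi psi.
Proof.
move=> ed cl x /cl[c0 c1 c2]; split; first exact: lt_le_trans ed.
- by move=> v v1; exact: lt_le_trans (c1 v v1) ed.
- by move=> v w v1 w1; exact: lt_le_trans (c2 v w v1 w1) ed.
Qed.

Lemma C2_openI (R : realType) : setI_closed (@C2_open R).
Proof.
move=> U V oU oV D phi [UD VD] pphi Dphi.
have [e e0 He] := oU _ _ UD pphi Dphi.
have [d d0 Hd] := oV _ _ VD pphi Dphi.
exists (Num.min e d); first by rewrite lt_min e0 d0.
move=> D' psi ppsi D'psi cl; split.
- by apply: He ppsi D'psi _; apply: C2_closeW cl; rewrite ge_min lexx.
- by apply: Hd ppsi D'psi _; apply: C2_closeW cl; rewrite ge_min lexx orbT.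
Qed.

Lemma C2_open_bigU (R : realType) (I : Type) (f : I -> set (C2_domain R)) :
  (forall i, C2_open (f i)) -> C2_open (\bigcup_i f i).
Proof.
move=> of_ D phi [i _ fiD] pphi Dphi.
have [e e0 He] := of_ i _ _ fiD pphi Dphi.
by exists e => // D' psi ppsi D'psi cl; exists i => //; apply: He cl.
Qed.

HB.instance Definition _ (R : realType) := gen_eqMixin (C2_domain R).
HB.instance Definition _ (R : realType) := gen_choiceMixin (C2_domain R).
HB.instance Definition _ (R : realType) :=
  isOpenTopological.Build (C2_domain R)
    (@C2_openT R) (@C2_openI R) (@C2_open_bigU R).

(* [D'] stands for the domain g(D). *)
Definition con_equivariant (R : realType) (f : C2_domain R -> plane R) : Prop :=
  forall g, conformal g -> forall D D' : C2_domain R,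
    D' = g @` D :> set _ -> f D' = g (f D).

Definition is_center (R : realType) (c : C2_domain R -> plane R) : Prop :=
  continuous c /\ forall D : C2_domain R, interior D (c D).

Definition strip (R : realType) : set (plane R * R) :=
  [set: plane R] `*` `[0, 1].

(* On continuous maps, uniform convergence on the compact subsets of
   R^2 x [0,1] is the compact-open topology. *)
Definition strip_compacts (R : realType) : set (set (plane R * R)) :=
  [set K | compact K /\ K `<=` @strip R].

Definition strong_deformation_retraction (R : realType) (D : set (plane R))
    (h : plane R * R -> plane R) : Prop :=
  [/\ {within @strip R, continuous h},
      forall x, h (x, 0) = x,
      forall x, D (h (x, 1)) &
      forall x t, D x -> t \in `[0, 1] -> h (x, t) = x].

(* [r] is total; its values at sets which are not Jordan domains, or at times
   outside [0,1], are unconstrained. *)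
Definition retraction_family (R : realType)
    (r : set (plane R) -> plane R * R -> plane R) : Prop :=
  [/\ forall D : jordan_domain R, strong_deformation_retraction D (r D),
      continuous (fun D : jordan_domain R =>
        (r D : {family @strip_compacts R, plane R * R -> plane R})) &
      forall g, conformal g -> forall (D : jordan_domain R) x t,
        t \in `[0, 1] -> g (r D (x, t)) = r (g @` D) (g x, t)].

Definition reach (R : realType) (D : set (plane R)) : R :=
  sup [set s | 0 < s /\ forall p, boundary D p ->
                 exists2 c, circle c s p & circle c s `<=` D].

Definition boundary_dist (R : realType) (D : set (plane R)) (x : plane R) : R :=
  inf [set enorm (x - y) | y in boundary D].

(* Equivalently, the domain bounded by the boundary of [D] moved by
   [reach D / 2] along its inward normals. *)
Definition half_domain (R : realType) (D : set (plane R)) : set (plane R) :=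
  D `&` [set x | reach D / 2 <= boundary_dist D x].

Definition induced_center (R : realType)
    (r : set (plane R) -> plane R * R -> plane R)
    (f : C2_domain R -> plane R) (D : C2_domain R) : plane R :=
  r (half_domain D) (f D, 1).

Definition center_of_mass (R : realType) (D : C2_domain R) : plane R :=
  let mu := (@lebesgue_measure R \x @lebesgue_measure R)%E in
  ((\int[mu]_(x in D) x.1) / fine (mu D), (\int[mu]_(x in D) x.2) / fine (mu D)).

Definition circumcenter (R : realType) (D : C2_domain R) : plane R :=
  xget 0 [set c | exists s, D `<=` disk c s /\
                    forall c' s', D `<=` disk c' s' -> s <= s'].

Definition boundary_curve (R : realType) (D : C2_domain R) (t : R) : plane R :=
  s2val (cid2 (C2_setP D)) (cos t, sin t).

Definition inward_normal (R : realType) (D : C2_domain R) (t : R) : plane R :=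
  xget 0 [set n | [/\ enorm n = 1, dot n (derive1 (boundary_curve D) t) = 0 &
                      \forall s \near 0^'+, C2_set D (boundary_curve D t + s *: n)]].

Definition speed (R : realType) (D : C2_domain R) (t : R) : R :=
  enorm (derive1 (boundary_curve D) t).

Definition curvature (R : realType) (D : C2_domain R) (t : R) : R :=
  dot (derive1 (derive1 (boundary_curve D)) t) (inward_normal D t) / speed D t ^+ 2.

Definition boundary_integral (R : realType) (D : C2_domain R) (h : R -> R) : R :=
  \int[@lebesgue_measure R]_(t in `[0, 2 * pi]) (h t * speed D t).

(* Arc length is speed * dt.  The quotients do not depend on the parametrization
   chosen in [boundary_curve]. *)
Definition steiner_point (R : realType) (D : C2_domain R) : plane R :=
  let k := curvature D in
  let x := boundary_curve D in
  (boundary_integral D (fun t => (x t).1 * k t) / boundary_integral D k,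
   boundary_integral D (fun t => (x t).2 * k t) / boundary_integral D k).

(* Main.v *)
Require Import Defs.
From HB Require Import structures.
From mathcomp Require Import all_boot all_order all_algebra.
From mathcomp Require Import all_classical all_reals all_analysis.
From mathcomp Require Import measurable_realfun.
From mathcomp Require Import ring lra.
Set Implicit Arguments.
Unset Strict Implicit.
Unset Printing Implicit Defensive.
Import Order.TTheory GRing.Theory Num.Theory.
Import numFieldNormedType.Exports.
Local Open Scope classical_set_scope.
Local Open Scope ring_scope.

(** The half domain [K] of a [C^2] domain [D] is where the statement happens: the
    value of the induced center at [D] is the end point of a retraction onto [K],
    hence a point of [K], and [K] lies in the interior of [D]. Three facts about
    [K] make this a continuous equivariant center.

    - [K] is a Jordan domain. The definition of the reach through circles inside
      [D] amounts to inequalities between pairs of boundary points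
      ([reach_setP]), which requires that a circle inside [D] bounds a disk
      inside [D] ([circle_fill]). They hold at the reach itself, so the inward
      normals shorter than the reach do not cross ([bdist_normal],
      [foot_lipschitz]), and [D] is mapped homeomorphically onto [K] by pushing
      a collar along the normals ([push_image], [push_inj]).
    - [K] depends continuously on [D]. All constants are controlled by two
      bounds on the parametrization ([param_bounds]) that are stable under
      [C^2] perturbations, and the reach, the normals and, in the collar, the
      nearest boundary points vary by at most a multiple of the perturbation
      ([push_close], [half_jordan_continuous]).
    - The construction only involves distances up to scale, so it commutes with
      conformal maps ([similarity_half_domain]).

    For the second part it suffices that the given point [c] lies in [K], since
    the retraction fixes [K]. For convex [D] the set [K] is convex and [D] is its
    neighbourhood of radius [h], half the reach. If [c] were outside [K], a line
    through the projection [p] of [c] on [K] would separate them.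

    - Circumcenter: a disk about [c] that contains [D] leaves a margin [h] around
      [K], and [p] is closer than [c] to all points of [K], so a smaller disk
      about [p] contains [D] ([circumcenter_half]).
    - Center of mass: reflection in the separating line preserves area and maps
      the part of [D] beyond the line into [D], so the moment of [D] with respect
      to the line has the wrong sign for [c] ([center_of_mass_half]).
    - Steiner point: the boundary point with inward normal [n] is [k - h n] with
      [k] in [K]. The curvature measure is nonnegative, has positive mass, and
      integrates [n] to zero, as curvature times [n] is the derivative of the
      unit tangent. Hence the Steiner point is also an average of points of the
      convex set [K] ([steiner_point_half]). *)

(** * Euclidean geometry of the plane *)

Section euclidean_plane.
Context {R : realType}.
Implicit Types (x y z u v p q : plane R) (s t : R).

Lemma fstD x y : (x + y).1 = x.1 + y.1. Proof. by []. Qed.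
Lemma sndD x y : (x + y).2 = x.2 + y.2. Proof. by []. Qed.
Lemma fstN x : (- x).1 = - x.1. Proof. by []. Qed.
Lemma sndN x : (- x).2 = - x.2. Proof. by []. Qed.
Lemma fstZ s x : (s *: x).1 = s * x.1. Proof. by []. Qed.
Lemma sndZ s x : (s *: x).2 = s * x.2. Proof. by []. Qed.

Definition coordE := (fstD, sndD, fstN, sndN, fstZ, sndZ).

Lemma plane_eq x y : x.1 = y.1 -> x.2 = y.2 -> x = y.
Proof. by case: x y => [? ?] [? ?] /= -> ->. Qed.

Lemma dotC x y : dot x y = dot y x.
Proof. by rewrite /dot mulrC [x.2 * _]mulrC. Qed.

Lemma dotDl x y z : dot (x + y) z = dot x z + dot y z.
Proof. by rewrite /dot !coordE; ring. Qed.

Lemma dotDr x y z : dot z (x + y) = dot z x + dot z y.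
Proof. by rewrite /dot !coordE; ring. Qed.

Lemma dotNl x y : dot (- x) y = - dot x y.
Proof. by rewrite /dot !coordE; ring. Qed.

Lemma dotNr x y : dot x (- y) = - dot x y.
Proof. by rewrite /dot !coordE; ring. Qed.

Lemma dotZl s x y : dot (s *: x) y = s * dot x y.
Proof. by rewrite /dot !coordE; ring. Qed.

Lemma dotZr s x y : dot x (s *: y) = s * dot x y.
Proof. by rewrite /dot !coordE; ring. Qed.

Lemma dot0l x : dot 0 x = 0. Proof. by rewrite /dot !mul0r addr0. Qed.

Definition dotE := (dotDl, dotDr, dotNl, dotNr, dotZl, dotZr).

Definition dotB := (dotDl, dotDr, dotNl, dotNr).

Lemma dot_ge0 x : 0 <= dot x x.
Proof. by rewrite /dot -!expr2 addr_ge0// sqr_ge0. Qed.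

Lemma enorm_ge0 x : 0 <= enorm x. Proof. exact: sqrtr_ge0. Qed.

Lemma enorm2 x : enorm x ^+ 2 = dot x x.
Proof. by rewrite sqr_sqrtr ?dot_ge0. Qed.

Lemma enorm0 : enorm (0 : plane R) = 0.
Proof. by rewrite /enorm dot0l sqrtr0. Qed.

Lemma enorm0_eq0 x : enorm x = 0 -> x = 0.
Proof.
move=> /(congr1 (fun a => a ^+ 2)); rewrite enorm2 expr0n /= /dot -!expr2.
move=> /eqP; rewrite paddr_eq0 ?sqr_ge0// !sqrf_eq0 => /andP[/eqP ? /eqP ?].
exact: plane_eq.
Qed.

Lemma enorm_gt0 x : x <> 0 -> 0 < enorm x.
Proof.
move=> x0; rewrite lt_neqAle enorm_ge0 andbT; apply/eqP => /esym.
by move/enorm0_eq0.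
Qed.

Lemma enormZ s x : enorm (s *: x) = `|s| * enorm x.
Proof. by rewrite /enorm dotZl dotZr mulrA -expr2 sqrtrM ?sqr_ge0// sqrtr_sqr. Qed.

Lemma enormZp s x : 0 <= s -> enorm (s *: x) = s * enorm x.
Proof. by move=> s0; rewrite enormZ ger0_norm. Qed.

Lemma enormN x : enorm (- x) = enorm x.
Proof. by rewrite /enorm dotNl dotNr opprK. Qed.

Lemma enormB x y : enorm (x - y) = enorm (y - x).
Proof. by rewrite -enormN opprB. Qed.

Lemma enorm_le x (c : R) : 0 <= c -> dot x x <= c ^+ 2 -> enorm x <= c.
Proof. by move=> c0 h; rewrite -(@ler_pXn2r _ 2) ?nnegrE ?enorm_ge0// enorm2. Qed.

Lemma cauchy_schwarz x y : dot x y ^+ 2 <= dot x x * dot y y.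
Proof.
rewrite -subr_ge0.
have -> : dot x x * dot y y - dot x y ^+ 2 = (x.1 * y.2 - x.2 * y.1) ^+ 2.
  by rewrite /dot; ring.
exact: sqr_ge0.
Qed.

Lemma dot_normr x y : `|dot x y| <= enorm x * enorm y.
Proof.
rewrite -(@ler_pXn2r _ 2) ?nnegrE ?mulr_ge0 ?enorm_ge0//.
by rewrite real_normK ?num_real// exprMn !enorm2 cauchy_schwarz.
Qed.

Lemma dot_le x y : dot x y <= enorm x * enorm y.
Proof. exact: le_trans (ler_norm _) (dot_normr x y). Qed.

Lemma dot_geN x y : - (enorm x * enorm y) <= dot x y.
Proof. by have := dot_normr x y; rewrite ler_norml => /andP[]. Qed.

Lemma enormD x y : enorm (x + y) <= enorm x + enorm y.
Proof.
apply: enorm_le; first by rewrite addr_ge0 ?enorm_ge0.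
rewrite !dotE (dotC y x) sqrrD !enorm2; have := dot_le x y; lra.
Qed.

Lemma enorm_triB x y z : enorm (x - z) <= enorm (x - y) + enorm (y - z).
Proof. by rewrite (le_trans _ (enormD _ _))// addrA subrK. Qed.

Lemma enormBl x y : enorm x - enorm y <= enorm (x - y).
Proof. by rewrite lerBlDr (le_trans _ (enormD _ _))// subrK. Qed.

Lemma enormB_le x y : enorm (x - y) <= enorm x + enorm y.
Proof. by rewrite (le_trans (enormD _ _))// enormN. Qed.

Lemma norm_enorm x : `|x| <= enorm x.
Proof.
rewrite [`|x|]prod_normE ge_max; apply/andP.
split; rewrite -(@ler_pXn2r _ 2) ?nnegrE ?enorm_ge0//;
  by rewrite real_normK ?num_real// enorm2 /dot -!expr2 ?lerDl ?lerDr sqr_ge0.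
Qed.

Lemma enorm_norm x : enorm x <= 2 * `|x|.
Proof.
rewrite enorm_le ?mulr_ge0// /dot.
have h1 : `|x.1| <= `|x| by rewrite [`|x|]prod_normE le_max lexx.
have h2 : `|x.2| <= `|x| by rewrite [`|x|]prod_normE le_max lexx orbT.
rewrite -!expr2 -[x.1 ^+ 2]real_normK ?num_real// -[x.2 ^+ 2]real_normK ?num_real//.
have := normr_ge0 x.1; have := normr_ge0 x.2; nra.
Qed.

Definition turn x : plane R := (- x.2, x.1).

Lemma dot_turn x : dot (turn x) x = 0.
Proof. by rewrite /dot /=; ring. Qed.

Lemma enorm_turn x : enorm (turn x) = enorm x.
Proof. by rewrite /enorm /dot /=; congr Num.sqrt; ring. Qed.

Lemma turnB x y : turn x - turn y = turn (x - y).
Proof. by rewrite /turn; apply: plane_eq; rewrite /=; ring. Qed.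

Lemma frame_decomp u x : enorm u = 1 ->
  x = dot x u *: u + dot x (turn u) *: turn u.
Proof.
move=> u1; have : dot u u = 1 by rewrite -enorm2 u1 expr1n.
rewrite /dot => h; apply: plane_eq; rewrite !coordE /dot /=.
- rewrite -[LHS]mulr1 -h; ring.
- rewrite -[LHS]mulr1 -h; ring.
Qed.

Definition normalize x : plane R := (enorm x)^-1 *: x.

Lemma enorm_normalize x : x <> 0 -> enorm (normalize x) = 1.
Proof.
by move=> /enorm_gt0 x0; rewrite enormZp ?invr_ge0 ?enorm_ge0// mulVf// gt_eqF.
Qed.

Lemma normalizeK x : x <> 0 -> enorm x *: normalize x = x.
Proof.
by move=> /enorm_gt0 x0; rewrite scalerA divff ?gt_eqF// scale1r.
Qed.

(** The lengths of [x] and [y] differ by at most [enorm (x - y)], whence the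
    factor 2. *)
Lemma normalize_lip x y : x <> 0 -> y <> 0 ->
  enorm (normalize x - normalize y) <= 2 * enorm (x - y) / enorm x.
Proof.
move=> x0 y0; have nx := enorm_gt0 x0; have ny := enorm_gt0 y0.
rewrite ler_pdivlMr// -[enorm x in leLHS]gtr0_norm// mulrC -enormZ scalerBr.
rewrite normalizeK//.
have -> : x - enorm x *: normalize y = (x - y) + (enorm y - enorm x) *: normalize y.
  by rewrite scalerBl normalizeK// addrA subrK.
rewrite (le_trans (enormD _ _))// enormZ enorm_normalize// mulr1 mulr2n mulrDl mul1r.
rewrite lerD2l ler_norml; have := enormBl x y; have := enormBl y x.
rewrite (enormB y x); lra.
Qed.

Lemma unit_vector_eq u v : enorm u = 1 -> enorm v = 1 -> 1 <= dot u v -> u = v.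
Proof.
move=> u1 v1 h; apply/eqP; rewrite -subr_eq0; apply/eqP/enorm0_eq0.
apply/eqP; rewrite eq_le enorm_ge0 andbT enorm_le// expr0n /= !dotE.
rewrite -!enorm2 u1 v1 expr1n (dotC v u); lra.
Qed.

Lemma disk_dotP x c s : 0 <= s -> (enorm (x - c) <= s) = (dot (x - c) (x - c) <= s ^+ 2).
Proof.
by move=> s0; rewrite -enorm2 ler_pXn2r ?nnegrE ?enorm_ge0.
Qed.

Lemma ltdisk_dotP x c s : 0 <= s -> (enorm (x - c) < s) = (dot (x - c) (x - c) < s ^+ 2).
Proof.
by move=> s0; rewrite -enorm2 ltr_pXn2r ?nnegrE ?enorm_ge0.
Qed.

(** A point is inside the circle of center [p + s *: u] through [p] exactly when
    its component along [u], seen from [p], dominates its squared distance to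
    [p]; this turns inclusions of disks into quadratic inequalities. *)
Lemma tangent_disk_dot x p u s : enorm u = 1 ->
  dot (x - (p + s *: u)) (x - (p + s *: u)) =
  s ^+ 2 + (dot (x - p) (x - p) - 2 * s * dot (x - p) u).
Proof.
move=> u1; have : dot u u = 1 by rewrite -enorm2 u1 expr1n.
rewrite opprD addrA; move: (x - p) => y uu.
by rewrite !dotE uu (dotC u y); ring.
Qed.

Lemma cvg_plane1 (T : Type) (F : set_system T) {FF : Filter F}
    (f : T -> plane R) x : f @ F --> x -> (f a).1 @[a --> F] --> x.1.
Proof. by move=> fx; exact: (cvg_comp _ _ fx cvg_fst). Qed.

Lemma cvg_plane2 (T : Type) (F : set_system T) {FF : Filter F}
    (f : T -> plane R) x : f @ F --> x -> (f a).2 @[a --> F] --> x.2.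
Proof. by move=> fx; exact: (cvg_comp _ _ fx cvg_snd). Qed.

Lemma cvg_dot (T : Type) (F : set_system T) {FF : Filter F}
    (f g : T -> plane R) x y : f @ F --> x -> g @ F --> y ->
  (dot (f a) (g a)) @[a --> F] --> dot x y.
Proof.
move=> fx gy; apply: cvgD; apply: cvgM.
- exact: cvg_plane1.
- exact: cvg_plane1.
- exact: cvg_plane2.
- exact: cvg_plane2.
Qed.

Lemma cvg_enorm (T : Type) (F : set_system T) {FF : Filter F}
    (f : T -> plane R) x : f @ F --> x -> (enorm (f a)) @[a --> F] --> enorm x.
Proof.
move=> fx; apply: (cvg_comp _ _ (cvg_dot fx fx)).
exact: sqrt_continuous.
Qed.

Lemma nbhs_enormP x (A : set (plane R)) :
  nbhs x A <-> exists2 e : R, 0 < e & forall y, enorm (y - x) < e -> A y.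
Proof.
split => [/nbhs_ballP[e /= e0 eA]|[e e0 eA]].
  exists e => // y yx; apply: eA; rewrite -ball_normE /= distrC.
  exact: le_lt_trans (norm_enorm _) yx.
apply/nbhs_ballP; exists (e / 2) => /=; first by rewrite divr_gt0.
move=> y; rewrite -ball_normE /= distrC => h; apply: eA.
by rewrite (le_lt_trans (enorm_norm _))// -ltr_pdivlMl// mulrC.
Qed.

Lemma cvg_enormP (T : Type) (F : set_system T) {FF : Filter F}
    (f : T -> plane R) x :
  f @ F --> x <-> forall e : R, 0 < e -> \forall a \near F, enorm (f a - x) < e.
Proof.
split => [fx e e0|h A /nbhs_enormP[e e0 eA]].
  by apply: (fx [set y | enorm (y - x) < e]); apply/nbhs_enormP; exists e.
by apply: filterS (h e e0) => a /eA.
Qed.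

Lemma disk_closed (c : plane R) s : closed (disk c s).
Proof.
rewrite (_ : disk c s = (fun x => enorm (x - c)) @^-1` [set t | t <= s])//.
apply: closed_comp; last exact: closed_le.
move=> x _; apply: cvg_enorm; apply: cvgB; [exact: cvg_id|exact: cvg_cst].
Qed.

Lemma bounded_closed_plane_compact (A : set (plane R)) s :
  closed A -> (forall x, A x -> enorm x <= s) -> compact A.
Proof.
move=> cA bA.
apply: (@subclosed_compact _ A (`[- s, s] `*` `[- s, s])) => //.
  by apply: compact_setX; exact: segment_compact.
move=> x /bA xs; split; rewrite /= in_itv /= -ler_norml (le_trans _ xs)//;
  rewrite (le_trans _ (norm_enorm _))// [leRHS]prod_normE le_max lexx ?orbT//.
Qed.

Lemma disk_compact (c : plane R) s : compact (disk c s).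
Proof.
apply: (@bounded_closed_plane_compact _ (s + enorm c)); first exact: disk_closed.
move=> x h; rewrite -[x](subrK c); apply: le_trans (enormD _ _) _.
by rewrite lerD2r.
Qed.

End euclidean_plane.

(** * Calculus on the closed unit disk *)

Lemma subrACA (V : zmodType) (a b c d : V) : a - b - (c - d) = a - c - (b - d).
Proof. by rewrite opprB -!addrA; congr (_ + _); rewrite opprB addrCA [RHS]addrC -!addrA; congr (_ + _); rewrite addrC. Qed.

Section directional_derivatives.
Context {R : realType}.
Implicit Types (f g : plane R -> plane R) (h : R -> plane R).
Implicit Types (x v w a b : plane R) (s t M : R).

Lemma cvg_is_derive (V W : normedModType R) (f : V -> W) (a v : V) (l : W) :
  (fun s : R => s^-1 *: ((f \o shift a) (s *: v) - f a)) @ 0^' --> l ->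
  is_derive a v f l.
Proof.
move=> fl; apply: DeriveDef; first by apply/cvg_ex; exists l.
exact: cvg_lim.
Qed.

Lemma is_derive_cvg (V W : normedModType R) (f : V -> W) (a v : V) (l : W) :
  is_derive a v f l ->
  (fun s : R => s^-1 *: ((f \o shift a) (s *: v) - f a)) @ 0^' --> l.
Proof. by move=> [/cvg_ex[m fm] <-]; rewrite /derive (cvg_lim _ fm). Qed.

Lemma is_derive_line f a v s : derivable f (a + s *: v) v ->
  is_derive s 1 (fun t => f (a + t *: v)) ('D_v f (a + s *: v)).
Proof.
move=> /derivableP /is_derive_cvg fl; apply: cvg_is_derive.
apply: cvg_trans fl; apply: near_eq_cvg; near=> t => /=.
by rewrite [t *: 1]mulr1 scalerDl addrCA.
Unshelve. all: by end_near. Qed.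

Lemma is_derive_dot h s l w : is_derive s 1 h l ->
  is_derive s 1 (fun t => dot (h t) w) (dot l w).
Proof.
move=> /is_derive_cvg hl; apply: cvg_is_derive.
apply: cvg_trans (cvg_dot hl (cvg_cst w)).
by apply: near_eq_cvg; near=> t => /=; rewrite dotZl dotDl dotNl.
Unshelve. all: by end_near. Qed.

Lemma is_derive_scaler v s : is_derive s 1 (fun t => t *: v) v.
Proof.
apply: cvg_is_derive; apply: cvg_trans (@cvg_cst _ v _ (0 : R)^' _).
apply: near_eq_cvg; near=> t => /=; rewrite -scalerBl [t *: 1]mulr1 addrK scalerA mulVf ?scale1r//.
by near: t; exact: nbhs_dnbhs_neq.
Unshelve. all: by end_near. Qed.

Lemma is_derive_continuous (V : normedModType R) (F : R -> V) s l :
  is_derive s 1 F l -> {for s, continuous F}.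
Proof.
by move=> [d _]; apply: differentiable_continuous; apply/derivable1_diffP.
Qed.

(** A vector valued function has no mean value theorem, but each of its
    components does; testing against the total displacement gives the mean
    value inequality. *)
Lemma mean_value_ineq h (k : R -> plane R) M :
  (forall s, 0 <= s <= 1 -> is_derive s 1 h (k s)) ->
  (forall s, 0 <= s <= 1 -> enorm (k s) <= M) ->
  enorm (h 1 - h 0) <= M.
Proof.
move=> dh kM; set w := h 1 - h 0.
have dw s : 0 <= s <= 1 -> is_derive s 1 (fun t => dot (h t) w) (dot (k s) w).
  by move=> /dh; exact: is_derive_dot.
have /(MVT ltr01)[|c c01] : forall y : R, y \in `]0, 1[%R ->
    is_derive y 1 (fun t => dot (h t) w) (dot (k y) w).
  by move=> y; rewrite in_itv /= => /andP[x0 x1]; apply: dw; rewrite !ltW.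
  apply: continuous_in_subspaceT => x; rewrite inE /= in_itv /= => x01.
  exact: is_derive_continuous (dw _ x01).
move: c01; rewrite in_itv /= => /andP[/ltW c0 /ltW c1].
rewrite subr0 mulr1 -dotNl -dotDl -/w -enorm2 => ww.
have M0 : 0 <= M by rewrite (le_trans (enorm_ge0 (k c)))// kM// c0.
have [/eqP ->|w0] := boolP (enorm w == 0); first by [].
have {w0}w0 : 0 < enorm w by rewrite lt_neqAle eq_sym w0 enorm_ge0.
rewrite -(@ler_pM2r _ (enorm w))// -expr2 ww (le_trans (dot_le _ _))//.
by rewrite ler_wpM2r ?(ltW w0)// kM// c0.
Qed.

Lemma unit_disk_segment a b s : unit_disk a -> unit_disk b -> 0 <= s <= 1 ->
  unit_disk (a + s *: (b - a)).
Proof.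
rewrite /unit_disk /disk /= !subr0 => a1 b1 /andP[s0 s1].
have -> : a + s *: (b - a) = (1 - s) *: a + s *: b.
  by apply: plane_eq; rewrite !coordE; ring.
rewrite (le_trans (enormD _ _))// !enormZp ?subr_ge0//; nra.
Qed.

(** The directional derivative, opaque so that the terms of an identity between
    derivatives are never unfolded to limits. *)
Lemma dd_sealed : {dd : (plane R -> plane R) -> plane R -> plane R -> plane R |
  dd = fun f v x => 'D_v f x}.
Proof. by exists (fun f v x => 'D_v f x). Qed.

Definition dd := sval dd_sealed.

Lemma ddE f v x : dd f v x = 'D_v f x.
Proof. by rewrite /dd (svalP dd_sealed). Qed.

Lemma ddEf f v : dd f v = 'D_v f.
Proof. by apply/funext => x; exact: ddE. Qed.

Lemma is_derive_dd f a v s : derivable f (a + s *: v) v ->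
  is_derive s 1 (fun t => f (a + t *: v)) (dd f v (a + s *: v)).
Proof. by rewrite ddE; exact: is_derive_line. Qed.

Lemma dd0 f x : dd f 0 x = 0. Proof. by rewrite ddE derive0. Qed.

Lemma dd_cst c v x : dd (cst c) v x = 0. Proof. by rewrite ddE derive_cst. Qed.

Lemma near_eq_dd f g v x : (\forall y \near x, f y = g y) -> dd f v x = dd g v x.
Proof. by move=> fg; rewrite !ddE; exact: near_eq_derive. Qed.

Lemma derive_addv f x v w : differentiable f x ->
  dd f (v + w) x = dd f v x + dd f w x.
Proof. by move=> df; rewrite !ddE !deriveE// linearD. Qed.

Lemma derive_scalev f x s v : differentiable f x ->
  dd f (s *: v) x = s *: dd f v x.
Proof. by move=> df; rewrite !ddE !deriveE// linearZ. Qed.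


Lemma derive_normalize f x v : v <> 0 -> differentiable f x ->
  dd f v x = enorm v *: dd f (normalize v) x.
Proof.
by move=> v0 df; apply: etrans (derive_scalev _ _ df); rewrite normalizeK.
Qed.

Definition C2_near_disk f := exists U : set (plane R),
  [/\ open U, @unit_disk R `<=` U & C2_on U f].

Section near_disk.
Variables (f : plane R -> plane R) (Cf : C2_near_disk f).

Lemma C2_near_differentiable x : unit_disk x -> differentiable f x.
Proof. by case: Cf => U [_ BU [fU _]] /BU /fU[]. Qed.

Lemma C2_near_differentiable_derive v x : unit_disk x ->
  differentiable (dd f v) x.
Proof. by rewrite ddEf; case: Cf => U [_ BU [_ fU]] /BU /(fU v)[]. Qed.

Lemma C2_near_continuous x : unit_disk x -> {for x, continuous f}.
Proof.
by move=> Bx; apply: differentiable_continuous; exact: C2_near_differentiable.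
Qed.

Lemma C2_near_continuous_derive v x : unit_disk x ->
  {for x, continuous (dd f v)}.
Proof. by rewrite ddEf; case: Cf => U [_ BU [fU _]] /BU /fU[]. Qed.

Lemma C2_near_continuous_derive2 v w x : unit_disk x ->
  {for x, continuous (dd (dd f v) w)}.
Proof. by rewrite !ddEf; case: Cf => U [_ BU [_ fU]] /BU /(fU v)[]. Qed.

Lemma C2_near_nearby x : unit_disk x -> \forall y \near x, differentiable f y.
Proof.
case: Cf => U [oU BU [fU _]] /BU Ux.
by apply: filterS (open_nbhs_nbhs (conj oU Ux)) => y /fU[].
Qed.

Lemma derive2_addv (v w u x : plane R) : unit_disk x ->
  dd (dd f (v + w)) u x = dd (dd f v) u x + dd (dd f w) u x.
Proof.
move=> Bx; have nb : \forall y \near x,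
    dd f (v + w) y = (fun y => dd f v y + dd f w y) y.
  by apply: filterS (C2_near_nearby Bx) => y; exact: derive_addv.
apply: (etrans (near_eq_dd u nb)).
by rewrite !ddE; apply: deriveD; apply: diff_derivable; exact: C2_near_differentiable_derive.
Qed.

Lemma derive2_scalev s (v u x : plane R) : unit_disk x ->
  dd (dd f (s *: v)) u x = s *: dd (dd f v) u x.
Proof.
move=> Bx; have nb : \forall y \near x,
    dd f (s *: v) y = (fun y => s *: dd f v y) y.
  by apply: filterS (C2_near_nearby Bx) => y; exact: derive_scalev.
apply: (etrans (near_eq_dd u nb)).
by rewrite !ddE; apply: deriveZ; apply: diff_derivable; exact: C2_near_differentiable_derive.
Qed.

Lemma derive2_normalize x v w : unit_disk x -> v <> 0 -> w <> 0 ->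
  dd (dd f v) w x = (enorm v * enorm w) *: dd (dd f (normalize v)) (normalize w) x.
Proof.
move=> Bx v0 w0; apply: (etrans (derive_normalize w0 _)).
  exact: C2_near_differentiable_derive.
rewrite mulrC -scalerA; congr (_ *: _).
by apply: etrans (derive2_scalev _ _ _ Bx); rewrite normalizeK.
Qed.

End near_disk.

Lemma C2_near_disk0 : C2_near_disk (cst 0).
Proof.
have D0 v : 'D_v (cst 0) = cst 0 :> (plane R -> plane R).
  by apply/funext => y; exact: derive_cst.
have C1 : C1_on setT (cst 0 : plane R -> plane R).
  move=> x _; split=> [|v]; first exact: differentiable_cst.
  by rewrite D0; exact: cst_continuous.
exists setT; split; [exact: openT|exact: subsetT|split; first exact: C1].
by move=> v; rewrite D0; exact: C1.
Qed.

(** Two maps are compared along chords of the disk through their derivatives;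
    the case [g = 0] bounds a single map. *)
Section comparison.
Variables (f g : plane R -> plane R) (M : R).
Hypotheses (Cf : C2_near_disk f) (Cg : C2_near_disk g).

Lemma enorm_derive_le v x : unit_disk x ->
  (forall u, enorm u = 1 -> enorm (dd f u x - dd g u x) <= M) ->
  enorm (dd f v x - dd g v x) <= M * enorm v.
Proof.
move=> Bx fM; have df := C2_near_differentiable Cf Bx.
have dg := C2_near_differentiable Cg Bx.
have [->|v0] := pselect (v = 0); first by rewrite !dd0 subrr enorm0 mulr0.
rewrite (derive_normalize v0 df) (derive_normalize v0 dg) -scalerBr.
rewrite enormZp; last exact: enorm_ge0.
rewrite [leRHS]mulrC ler_wpM2l ?enorm_ge0//.
by apply: fM; exact: enorm_normalize.
Qed.

Lemma enorm_derive2_le v w x : unit_disk x ->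
  (forall v w, enorm v = 1 -> enorm w = 1 ->
    enorm (dd (dd f v) w x - dd (dd g v) w x) <= M) ->
  enorm (dd (dd f v) w x - dd (dd g v) w x) <= M * enorm v * enorm w.
Proof.
move=> Bx fM.
have [->|w0] := pselect (w = 0).
  by rewrite !dd0 subrr enorm0 mulr0.
have [->|v0] := pselect (v = 0).
  have D0 (k : plane R -> plane R) : dd (dd k 0) w x = 0.
    rewrite (_ : dd k 0 = cst 0); first exact: dd_cst.
    by apply/funext => y; exact: dd0.
  by rewrite D0 D0 subrr enorm0 mulr0 mul0r.
rewrite (derive2_normalize Cf Bx v0 w0) (derive2_normalize Cg Bx v0 w0) -scalerBr.
rewrite enormZp; last by rewrite mulr_ge0 ?enorm_ge0.
rewrite -[leRHS]mulrA [leRHS]mulrC ler_wpM2l ?mulr_ge0 ?enorm_ge0//.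
by apply: fM; exact: enorm_normalize.
Qed.

Section second_derivative_bound.
Hypothesis fM : forall x v w, unit_disk x -> enorm v = 1 -> enorm w = 1 ->
  enorm (dd (dd f v) w x - dd (dd g v) w x) <= M.

Lemma derive_increment a b v : unit_disk a -> unit_disk b ->
  enorm ((dd f v b - dd g v b) - (dd f v a - dd g v a)) <=
  M * enorm v * enorm (b - a).
Proof.
move=> Ba Bb.
have /= := @mean_value_ineq
  (fun s => dd f v (a + s *: (b - a)) - dd g v (a + s *: (b - a)))
  (fun s => dd (dd f v) (b - a) (a + s *: (b - a))
          - dd (dd g v) (b - a) (a + s *: (b - a))) (M * enorm v * enorm (b - a)).
rewrite scale1r scale0r addr0 [a + _]addrC subrK; apply => s s01.
  have Bs := unit_disk_segment Ba Bb s01.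
  by apply: is_deriveB; apply: is_derive_dd; apply: diff_derivable;
    exact: C2_near_differentiable_derive.
have Bs := unit_disk_segment Ba Bb s01.
by apply: enorm_derive2_le => // ? ?; exact: fM.
Qed.

Lemma taylor_remainder a b : unit_disk a -> unit_disk b ->
  enorm ((f b - f a - dd f (b - a) a) - (g b - g a - dd g (b - a) a)) <=
  M * enorm (b - a) ^+ 2.
Proof.
move=> Ba Bb.
have M0 : 0 <= M.
  have e1 : enorm ((1, 0) : plane R) = 1.
    by rewrite /enorm /dot /= mulr1 mulr0 addr0 sqrtr1.
  exact: le_trans (enorm_ge0 _) (fM Ba e1 e1).
(* the Taylor remainder of [k] is the increment of [h k], whose derivative is
   itself an increment of the derivative of [k] *)
pose h (k : plane R -> plane R) s := k (a + s *: (b - a)) - s *: dd k (b - a) a.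
pose h' (k : plane R -> plane R) s := dd k (b - a) (a + s *: (b - a)) - dd k (b - a) a.
have dh (k : plane R -> plane R) s : C2_near_disk k -> 0 <= s <= 1 -> is_derive s 1 (h k) (h' k s).
  move=> Ck s01; apply: is_deriveB.
    apply: is_derive_dd; apply: diff_derivable.
    by apply: C2_near_differentiable => //; exact: unit_disk_segment.
  exact: is_derive_scaler.
have h01 (k : plane R -> plane R) : h k 1 - h k 0 = k b - k a - dd k (b - a) a.
  by rewrite /h !scale1r !scale0r addr0 subr0 [a + _]addrC subrK addrAC.
rewrite -!h01 subrACA.
apply: (@mean_value_ineq (fun s => h f s - h g s) (fun s => h' f s - h' g s)).
  by move=> s s01; apply: is_deriveB; exact: dh.
move=> s s01.
have Bs := unit_disk_segment Ba Bb s01.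
rewrite /h' subrACA.
apply: (le_trans (derive_increment _ Ba Bs)).
rewrite [a + _]addrC addrK enormZp; last by case/andP: s01.
rewrite -mulrA ler_wpM2l// expr2 mulrCA ler_piMl ?mulr_ge0 ?enorm_ge0//.
by case/andP: s01.
Qed.

End second_derivative_bound.

Lemma increment_le a b : unit_disk a -> unit_disk b ->
  (forall x v, unit_disk x -> enorm v = 1 -> enorm (dd f v x - dd g v x) <= M) ->
  enorm ((f b - g b) - (f a - g a)) <= M * enorm (b - a).
Proof.
move=> Ba Bb fM.
have /= := @mean_value_ineq
  (fun s => f (a + s *: (b - a)) - g (a + s *: (b - a)))
  (fun s => dd f (b - a) (a + s *: (b - a)) - dd g (b - a) (a + s *: (b - a)))
  (M * enorm (b - a)).
rewrite scale1r scale0r addr0 [a + _]addrC subrK; apply => s s01.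
  have Bs := unit_disk_segment Ba Bb s01.
  by apply: is_deriveB; apply: is_derive_dd; apply: diff_derivable;
    exact: C2_near_differentiable.
have Bs := unit_disk_segment Ba Bb s01.
by apply: enorm_derive_le => // ?; exact: fM.
Qed.

End comparison.

Lemma derive_cst0 v x : dd (cst 0 : plane R -> plane R) v x = 0.
Proof. exact: dd_cst. Qed.

Lemma derive2_cst0 v w x : dd (dd (cst 0 : plane R -> plane R) v) w x = 0.
Proof.
by rewrite (_ : dd _ v = cst 0) ?derive_cst0//; apply/funext => y; exact: derive_cst0.
Qed.

Section single_map.
Variables (f : plane R -> plane R) (M : R).
Hypothesis Cf : C2_near_disk f.

Lemma derive_bound v x : unit_disk x ->
  (forall u, enorm u = 1 -> enorm (dd f u x) <= M) ->
  enorm (dd f v x) <= M * enorm v.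
Proof.
move=> Bx fM; have := @enorm_derive_le f (cst 0) M Cf C2_near_disk0 v x Bx.
rewrite derive_cst0 subr0; apply => u u1; rewrite derive_cst0 subr0.
exact: fM.
Qed.

Hypothesis fM : forall x v w, unit_disk x -> enorm v = 1 -> enorm w = 1 ->
  enorm (dd (dd f v) w x) <= M.

Let fM0 x v w : unit_disk x -> enorm v = 1 -> enorm w = 1 ->
  enorm (dd (dd f v) w x - dd (dd (cst 0) v) w x) <= M.
Proof. by move=> Bx v1 w1; rewrite derive2_cst0 subr0; exact: fM. Qed.

Lemma derive_lip a b v : unit_disk a -> unit_disk b ->
  enorm (dd f v b - dd f v a) <= M * enorm v * enorm (b - a).
Proof.
move=> Ba Bb; have := derive_increment Cf C2_near_disk0 fM0 v Ba Bb.
by rewrite !derive_cst0 !subr0.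
Qed.

Lemma taylor_bound a b : unit_disk a -> unit_disk b ->
  enorm (f b - f a - dd f (b - a) a) <= M * enorm (b - a) ^+ 2.
Proof.
move=> Ba Bb; have := taylor_remainder Cf C2_near_disk0 fM0 Ba Bb.
by rewrite !derive_cst0 /= !subr0.
Qed.

End single_map.

End directional_derivatives.

(** * Uniform bounds for parametrizations *)

Lemma compact_bounded_above (T : topologicalType) (R : realType) (A : set T)
    (F : T -> R) : compact A -> (forall x, A x -> {for x, continuous F}) ->
  exists2 c, 0 < c & forall x, A x -> F x <= c.
Proof.
move=> cA cF; have [A0|/nonemptyPn ->] := pselect (A !=set0); last first.
  by exists 1.
have [|c _ cP] := compact_EVT_max A0 cA (f := F).
  by apply: continuous_in_subspaceT => x; rewrite inE; exact: cF.
exists (Num.max 1 (F c)); first by rewrite lt_max ltr01.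
by move=> x Ax; rewrite le_max cP ?orbT// inE.
Qed.

Lemma compact_bounded_below (T : topologicalType) (R : realType) (A : set T)
    (F : T -> R) : compact A -> (forall x, A x -> {for x, continuous F}) ->
  (forall x, A x -> 0 < F x) -> exists2 c, 0 < c & forall x, A x -> c <= F x.
Proof.
move=> cA cF F0; have [A0|/nonemptyPn ->] := pselect (A !=set0); last first.
  by exists 1.
have [|c cA' cP] := compact_EVT_min A0 cA (f := F).
  by apply: continuous_in_subspaceT => x; rewrite inE; exact: cF.
exists (F c); first by apply: F0; rewrite inE in cA'.
by move=> x Ax; rewrite cP// inE.
Qed.

Section parametrization_bounds.
Context {R : realType}.
Implicit Types (f g phi psi : plane R -> plane R).
Implicit Types (x y v w a b e : plane R) (m M d s t : R).

(** The lower bound [m] measures how far [phi] is from losing injectivity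
    (infinitesimally or globally), the upper bound [M] its [C^2] size. *)
Record param_bounds m M phi : Prop := ParamBounds {
  pb_C2 : C2_near_disk phi;
  pb_m : 0 < m;
  pb_M : 0 < M;
  pb_inj : forall a b, unit_disk a -> unit_disk b ->
    m * enorm (a - b) <= enorm (phi a - phi b);
  pb_dinj : forall a v, unit_disk a -> enorm v = 1 -> m <= enorm (dd phi v a);
  pb_d1 : forall a v, unit_disk a -> enorm v = 1 -> enorm (dd phi v a) <= M;
  pb_d2 : forall a v w, unit_disk a -> enorm v = 1 -> enorm w = 1 ->
    enorm (dd (dd phi v) w a) <= M }.

Let e1 : plane R := (1, 0).
Let e2 : plane R := (0, 1).

Lemma plane_basis v : v = v.1 *: e1 + v.2 *: e2.
Proof. by apply: plane_eq; rewrite !coordE /=; ring. Qed.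

Lemma unit_coord v : enorm v = 1 -> `|v.1| <= 1 /\ `|v.2| <= 1.
Proof.
by move=> v1; split; rewrite -v1 (le_trans _ (norm_enorm _))// [leRHS]prod_normE
  le_max lexx ?orbT.
Qed.

Lemma derive_basis f v x : differentiable f x ->
  dd f v x = v.1 *: dd f e1 x + v.2 *: dd f e2 x.
Proof.
move=> df; rewrite {1}[v]plane_basis (derive_addv _ _ df).
by rewrite !(derive_scalev _ _ df).
Qed.

Lemma derive2_basis f v w x : C2_near_disk f -> unit_disk x ->
  dd (dd f v) w x = v.1 *: dd (dd f e1) w x + v.2 *: dd (dd f e2) w x.
Proof.
move=> Cf Bx; rewrite {1}[v]plane_basis (derive2_addv Cf _ _ _ Bx).
by rewrite !(derive2_scalev Cf _ _ _ Bx).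
Qed.

Lemma enorm_comb2 s t v w c : `|s| <= 1 -> `|t| <= 1 -> enorm v <= c ->
  enorm w <= c -> enorm (s *: v + t *: w) <= 2 * c.
Proof.
move=> s1 t1 vc wc; rewrite (le_trans (enormD _ _))// !enormZ.
have := enorm_ge0 v; have := enorm_ge0 w; have := normr_ge0 s.
have := normr_ge0 t; nra.
Qed.

Lemma unit_disk_compact : compact (@unit_disk R).
Proof. exact: disk_compact. Qed.

Lemma unit_circle_compact : compact (@circle R 0 1).
Proof.
apply: (@bounded_closed_plane_compact _ _ 1).
  rewrite (_ : circle 0 1 = (@enorm R) @^-1` [set 1]); last first.
    by apply/seteqP; split => x; rewrite /circle /= subr0.
  apply: closed_comp; last exact: closed_eq.
  by move=> x _; apply: cvg_enorm; exact: cvg_id.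
by move=> x; rewrite /circle /= subr0 => ->.
Qed.

(** In every direction the derivatives are combinations of those along the two
    coordinate axes, and these are continuous on a compact set. *)
Lemma C2_near_bounded f : C2_near_disk f -> exists2 M, 0 < M &
  (forall a v, unit_disk a -> enorm v = 1 -> enorm (dd f v a) <= M) /\
  (forall a v w, unit_disk a -> enorm v = 1 -> enorm w = 1 ->
    enorm (dd (dd f v) w a) <= M).
Proof.
move=> Cf.
have bnd (g : plane R -> plane R) : (forall x, unit_disk x -> {for x, continuous g}) ->
    exists2 c, 0 < c & forall x, unit_disk x -> enorm (g x) <= c.
  move=> cg; apply: (compact_bounded_above unit_disk_compact) => x Bx.
  by apply: cvg_enorm; exact: cg.
have [c1 c10 h1] := bnd _ (fun x => @C2_near_continuous_derive _ _ Cf e1 x).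
have [c2 c20 h2] := bnd _ (fun x => @C2_near_continuous_derive _ _ Cf e2 x).
have [c11 c110 h11] := bnd _ (fun x => @C2_near_continuous_derive2 _ _ Cf e1 e1 x).
have [c12 c120 h12] := bnd _ (fun x => @C2_near_continuous_derive2 _ _ Cf e1 e2 x).
have [c21 c210 h21] := bnd _ (fun x => @C2_near_continuous_derive2 _ _ Cf e2 e1 x).
have [c22 c220 h22] := bnd _ (fun x => @C2_near_continuous_derive2 _ _ Cf e2 e2 x).
pose c := c1 + c2 + c11 + c12 + c21 + c22.
exists (2 * (2 * c)); first by rewrite /c; lra.
split => [a v Ba /unit_coord[v1 v2]|a v w Ba /unit_coord[v1 v2] /unit_coord[w1 w2]].
  rewrite (derive_basis _ (C2_near_differentiable Cf Ba)).
  have k1 := h1 a Ba; have k2 := h2 a Ba.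
  by apply: enorm_comb2 => //; rewrite /c; lra.
rewrite (derive2_basis _ _ Cf Ba).
have df u := C2_near_differentiable_derive Cf u Ba.
rewrite (derive_basis w (df e1)) (derive_basis w (df e2)).
have k11 := h11 a Ba; have k12 := h12 a Ba; have k21 := h21 a Ba; have k22 := h22 a Ba.
by apply: enorm_comb2 => //; apply: enorm_comb2 => //; rewrite /c; lra.
Qed.

(** The derivative does not vanish on the compact set of unit vectors based in
    the disk. *)
Lemma derive_lower_bound phi : C2_embedding phi -> exists2 m, 0 < m &
  forall a v, unit_disk a -> enorm v = 1 -> m <= enorm (dd phi v a).
Proof.
move=> [Cf _ dinj].
pose F (q : plane R * plane R) := enorm (dd phi (q.2) q.1).
pose F' (q : plane R * plane R) :=
  enorm (q.2.1 *: dd phi e1 q.1 + q.2.2 *: dd phi e2 q.1).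
have FF' q : unit_disk q.1 -> F q = F' q.
  by move=> Bq; rewrite /F /F' derive_basis//; exact: C2_near_differentiable.
have [||m m0 mP] := @compact_bounded_below _ _ (@unit_disk R `*` circle 0 1) F'
    (compact_setX unit_disk_compact unit_circle_compact).
- move=> q [/= Bq _]; apply: cvg_enorm; apply: cvgD; apply: cvgZ.
  + apply: cvg_plane1; exact: cvg_snd.
  + apply: (@cvg_comp _ _ _ fst (dd phi e1) _ (nbhs q.1)); first exact: cvg_fst.
    exact: (@C2_near_continuous_derive R phi Cf e1 q.1 Bq).
  + apply: cvg_plane2; exact: cvg_snd.
  + apply: (@cvg_comp _ _ _ fst (dd phi e2) _ (nbhs q.1)); first exact: cvg_fst.
    exact: (@C2_near_continuous_derive R phi Cf e2 q.1 Bq).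
- move=> q [/= Bq]; rewrite /circle /= subr0 => q1; rewrite -FF'//.
  apply: enorm_gt0 => Dq.
  have : q.2 = 0.
    apply: (dinj _ Bq); rewrite linear0 -Dq.
    by rewrite ddE; apply/esym/deriveE; exact: C2_near_differentiable.
  by move=> q0; move: q1; rewrite q0 enorm0 => /eqP; rewrite eq_sym oner_eq0.
exists m => // a v Ba v1; have := mP (a, v); rewrite -FF'//; apply.
by split => //; rewrite /circle /= subr0.
Qed.

(** Nearby points are separated by the derivative, distant ones by
    compactness. *)
Lemma embedding_bounds phi : C2_embedding phi -> exists m M, param_bounds m M phi.
Proof.
move=> phiE; have [Cf inj dinj] := phiE.
have [M M0 [d1 d2]] := C2_near_bounded Cf.
have [m m0 mP] := derive_lower_bound phiE.
(* below distance [h] the Taylor remainder is at most half of the linear term *)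
pose h := m / (2 * M).
have h0 : 0 < h by rewrite divr_gt0// mulr_gt0.
pose A := [set q : plane R * plane R | unit_disk q.1 /\ unit_disk q.2 /\
  h <= enorm (q.1 - q.2)].
have cA : compact A.
  rewrite (_ : A = (@unit_disk R `*` @unit_disk R) `&`
    ((fun q => enorm (q.1 - q.2)) @^-1` [set t | h <= t])); last first.
    by apply/seteqP; split => q /=; [move=> [? []]|move=> [[]]].
  apply: compact_closedI.
    exact: (compact_setX unit_disk_compact unit_disk_compact).
  apply: closed_comp; last exact: closed_ge.
  by move=> q _; apply: cvg_enorm; apply: cvgB; [exact: cvg_fst|exact: cvg_snd].
have [|| k k0 kP] := compact_bounded_below cA (F := fun q => enorm (phi q.1 - phi q.2)).
- move=> q [Bq1 [Bq2 _]]; apply: cvg_enorm; apply: cvgB.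
    apply: (@cvg_comp _ _ _ fst phi _ (nbhs q.1)); first exact: cvg_fst.
    exact: C2_near_continuous.
  apply: (@cvg_comp _ _ _ snd phi _ (nbhs q.2)); first exact: cvg_snd.
  exact: C2_near_continuous.
- move=> q [Bq1 [Bq2 hq]]; apply: enorm_gt0 => /eqP; rewrite subr_eq0 => /eqP.
  move=> /inj; rewrite !inE => /(_ Bq1 Bq2) E; move: hq.
  by rewrite E subrr enorm0 leNgt h0.
have low a b : unit_disk a -> unit_disk b ->
    Num.min (m / 2) (k / 2) * enorm (a - b) <= enorm (phi a - phi b).
  move=> Ba Bb; have [hab|hab] := leP h (enorm (a - b)).
    apply: le_trans (kP (a, b) _) => //.
    have ab2 : enorm (a - b) <= 2.
      move: Ba Bb; rewrite /unit_disk /disk /= !subr0 => a1 b1.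
      by apply: le_trans (enormB_le _ _) _; lra.
    have : Num.min (m / 2) (k / 2) <= k / 2 by rewrite ge_min lexx orbT.
    by have := enorm_ge0 (a - b); nra.
  have Bm : Num.min (m / 2) (k / 2) <= m / 2 by rewrite ge_min lexx.
  have T := taylor_bound Cf d2 Bb Ba.
  have L : m * enorm (a - b) <= enorm (dd phi (a - b) b).
    have [->|ab0] := pselect (a - b = 0); first by rewrite enorm0 mulr0 enorm_ge0.
    rewrite (derive_normalize ab0 (C2_near_differentiable Cf Bb)).
    rewrite enormZp ?enorm_ge0// mulrC ler_wpM2l ?enorm_ge0//.
    by apply: mP => //; exact: enorm_normalize.
  have Tr := enormBl (dd phi (a - b) b) (phi a - phi b).
  rewrite enormB in T.
  have Mh : M * enorm (a - b) <= m / 2.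
    have -> : m / 2 = M * h by rewrite /h; field; rewrite gt_eqF.
    by rewrite ler_wpM2l ?ltW.
  have ab0 := enorm_ge0 (a - b).
  have : M * enorm (a - b) ^+ 2 <= m / 2 * enorm (a - b) by rewrite expr2 mulrA ler_wpM2r.
  have : Num.min (m / 2) (k / 2) * enorm (a - b) <= m / 2 * enorm (a - b) by rewrite ler_wpM2r.
  lra.
exists (Num.min (Num.min (m / 2) (k / 2)) m), M; split => //.
- by rewrite !lt_min !divr_gt0.
- move=> a b Ba Bb; apply: le_trans (low a b Ba Bb).
  by rewrite ler_wpM2r ?enorm_ge0// ge_min lexx.
- by move=> a v Ba v1; rewrite (le_trans _ (mP a v Ba v1))// ge_min lexx orbT.
Qed.

Lemma C2_close_dd d phi psi x : C2_close d phi psi -> unit_disk x ->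
  [/\ enorm (phi x - psi x) < d,
    forall v, enorm v = 1 -> enorm (dd phi v x - dd psi v x) < d &
    forall v w, enorm v = 1 -> enorm w = 1 ->
      enorm (dd (dd phi v) w x - dd (dd psi v) w x) < d].
Proof.
move=> cl /cl[c0 c1 c2]; split => [//|v v1|v w v1 w1].
  by rewrite !ddE; exact: c1.
by rewrite !ddE !ddEf; exact: c2.
Qed.

(** This makes all later estimates uniform near a given domain. *)
Lemma param_bounds_close m M d phi psi : param_bounds m M phi ->
  C2_near_disk psi -> d <= m / 2 -> d <= M -> C2_close d phi psi ->
  param_bounds (m / 2) (2 * M) psi.
Proof.
move=> [Cf m0 M0 inj dinj d1 d2] Cg dm dM cl.
have {}cl x := @C2_close_dd d phi psi x cl.
split; first exact: Cg.
- exact: divr_gt0.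
- exact: mulr_gt0.
- move=> a b Ba Bb.
  have := @increment_le _ phi psi d Cf Cg b a Bb Ba.
  have -> : phi a - psi a - (phi b - psi b) = (phi a - phi b) - (psi a - psi b).
    exact: subrACA.
  move=> H.
  have {}H : enorm (phi a - phi b - (psi a - psi b)) <= d * enorm (a - b).
    by apply: H => x v Bx v1; have [_ c1 _] := cl x Bx; exact/ltW/c1.
  have := enormBl (phi a - phi b) (psi a - psi b).
  have := inj _ _ Ba Bb; have := enorm_ge0 (a - b).
  nra.
- move=> a v Ba v1; have [_ c1 _] := cl a Ba; have := c1 v v1.
  have := dinj a v Ba v1; have := enormBl (dd phi v a) (dd psi v a); lra.
- move=> a v Ba v1; have [_ c1 _] := cl a Ba; have := c1 v v1.
  have := d1 a v Ba v1; have := enormBl (dd psi v a) (dd phi v a).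
  rewrite (enormB (dd psi v a)); lra.
- move=> a v w Ba v1 w1; have [_ _ c2] := cl a Ba; have := c2 v w v1 w1.
  have := d2 a v w Ba v1 w1; have := enormBl (dd (dd psi v) w a) (dd (dd phi v) w a).
  rewrite (enormB (dd (dd psi v) w a)); lra.
Qed.

End parametrization_bounds.

(** * The inward normal *)

Section normal.
Context {R : realType}.
Implicit Types (phi psi : plane R -> plane R) (x y v w a b e p q u : plane R).
Implicit Types (m M d s t : R).

Definition on_circle e := enorm e = 1.

Lemma on_circle_disk e : on_circle e -> unit_disk e.
Proof. by rewrite /unit_disk /disk /= subr0 => ->. Qed.

Definition tangent phi e : plane R := normalize (dd phi (turn e) e).

(** The component of the inward radial derivative that is orthogonal to the
    boundary curve. *)
Definition inner_vector phi e : plane R :=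
  dot (dd phi e e) (tangent phi e) *: tangent phi e - dd phi e e.

Definition inner_normal phi e : plane R := normalize (inner_vector phi e).

Section bounds.
Variables (m M : R) (phi : plane R -> plane R).
Hypothesis B : param_bounds m M phi.

Let m0 := pb_m B.
Let M0 := pb_M B.

Lemma dd_add v w x : unit_disk x -> dd phi (v + w) x = dd phi v x + dd phi w x.
Proof. by move=> /(C2_near_differentiable (pb_C2 B)); exact: derive_addv. Qed.

Lemma dd_scale s v x : unit_disk x -> dd phi (s *: v) x = s *: dd phi v x.
Proof. by move=> /(C2_near_differentiable (pb_C2 B)); exact: derive_scalev. Qed.

Lemma dd_opp v x : unit_disk x -> dd phi (- v) x = - dd phi v x.
Proof. by move=> Bx; rewrite -scaleN1r dd_scale// scaleN1r. Qed.

Lemma dd_ge v x : unit_disk x -> m * enorm v <= enorm (dd phi v x).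
Proof.
move=> Bx; have [->|v0] := pselect (v = 0); first by rewrite enorm0 mulr0 enorm_ge0.
rewrite -[in leRHS](normalizeK v0) dd_scale// enormZp ?enorm_ge0// mulrC.
rewrite ler_wpM2l ?enorm_ge0//; apply: (pb_dinj B) => //; exact: enorm_normalize.
Qed.

Lemma dd_le v x : unit_disk x -> enorm (dd phi v x) <= M * enorm v.
Proof.
move=> Bx; apply: (derive_bound (pb_C2 B)) => // u u1.
exact: (pb_d1 B).
Qed.

Lemma param_taylor a b : unit_disk a -> unit_disk b ->
  enorm (phi b - phi a - dd phi (b - a) a) <= M * enorm (b - a) ^+ 2.
Proof. by apply: taylor_bound; [exact: (pb_C2 B)|exact: (pb_d2 B)]. Qed.

Lemma param_lip a b : unit_disk a -> unit_disk b ->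
  enorm (phi b - phi a) <= M * enorm (b - a).
Proof.
move=> Ba Bb; have := @increment_le _ phi (cst 0) M (pb_C2 B) (@C2_near_disk0 R) a b Ba Bb.
rewrite /= !subr0; apply => x v Bx v1; rewrite derive_cst0 subr0.
exact: (pb_d1 B).
Qed.

Lemma enorm_dd_turn e : on_circle e -> m <= enorm (dd phi (turn e) e).
Proof.
move=> e1; have := dd_ge (turn e) (on_circle_disk e1).
by rewrite enorm_turn e1 mulr1.
Qed.

Lemma dd_turn_neq0 e : on_circle e -> dd phi (turn e) e <> 0.
Proof.
by move=> /enorm_dd_turn h E; move: h; rewrite E enorm0 leNgt m0.
Qed.

Lemma enorm_tangent e : on_circle e -> enorm (tangent phi e) = 1.
Proof. by move=> e1; apply: enorm_normalize; exact: dd_turn_neq0. Qed.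

Lemma inner_vectorE e : on_circle e -> inner_vector phi e =
  dd phi ((dot (dd phi e e) (tangent phi e) / enorm (dd phi (turn e) e)) *: turn e - e) e.
Proof.
move=> e1; have Be := on_circle_disk e1.
by rewrite dd_add// dd_opp// dd_scale// -scalerA.
Qed.

Lemma enorm_inner_vector e : on_circle e -> m <= enorm (inner_vector phi e).
Proof.
move=> e1; rewrite inner_vectorE//; set s := _ / _.
apply: le_trans (dd_ge _ (on_circle_disk e1)).
rewrite ler_pMr// -(@ler_pXn2r _ 2) ?nnegrE ?enorm_ge0// expr1n enorm2.
have ee : dot e e = 1 by rewrite -enorm2 e1 expr1n.
have rr : dot (turn e) (turn e) = 1 by rewrite -enorm2 enorm_turn e1 expr1n.
by rewrite !dotE ee rr dot_turn dotC dot_turn; have := sqr_ge0 s; lra.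
Qed.

Lemma inner_vector_neq0 e : on_circle e -> inner_vector phi e <> 0.
Proof.
by move=> /enorm_inner_vector h E; move: h; rewrite E enorm0 leNgt m0.
Qed.

Lemma enorm_inner_normal e : on_circle e -> enorm (inner_normal phi e) = 1.
Proof. by move=> e1; apply: enorm_normalize; exact: inner_vector_neq0. Qed.

Lemma inner_normal_tangent e : on_circle e ->
  dot (dd phi (turn e) e) (inner_normal phi e) = 0.
Proof.
move=> e1; rewrite -(normalizeK (dd_turn_neq0 e1)) -/(tangent phi e) dotZl.
rewrite /inner_normal /normalize dotZr /inner_vector dotDr dotNr dotZr.
rewrite -[dot (tangent _ _) _]enorm2 enorm_tangent// expr1n mulr1.
by rewrite (dotC (tangent _ _)) subrr !mulr0.
Qed.

Lemma inner_normal_radial e : on_circle e ->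
  dot (dd phi e e) (inner_normal phi e) = - enorm (inner_vector phi e).
Proof.
move=> e1; have w0 := inner_vector_neq0 e1.
have tn : dot (tangent phi e) (inner_normal phi e) = 0.
  by rewrite /tangent /normalize dotZl inner_normal_tangent// mulr0.
have -> : dd phi e e = dot (dd phi e e) (tangent phi e) *: tangent phi e
    - enorm (inner_vector phi e) *: inner_normal phi e.
  by rewrite /inner_normal (normalizeK w0) /inner_vector opprB addrC subrK.
rewrite dotDl dotZl tn mulr0 add0r dotNl dotZl -enorm2 enorm_inner_normal//.
by rewrite expr1n mulr1.
Qed.

Lemma inner_normal_radial_le e : on_circle e ->
  dot (dd phi e e) (inner_normal phi e) <= - m.
Proof. by move=> e1; rewrite inner_normal_radial// lerN2 enorm_inner_vector. Qed.

Lemma inner_normal_radial_ge e : on_circle e ->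
  - M <= dot (dd phi e e) (inner_normal phi e).
Proof.
move=> e1; rewrite (le_trans _ (dot_geN _ _))// lerN2 enorm_inner_normal// mulr1.
by have := dd_le e (on_circle_disk e1); rewrite e1 mulr1.
Qed.

Definition normal_remainder phi e y :=
  dot (phi y - phi e - dd phi (y - e) e) (inner_normal phi e).

(** The tangential part of the first order term is orthogonal to the normal, so
    only the radial part remains. *)
Lemma normal_expansion e y : on_circle e -> unit_disk y ->
  dot (phi y - phi e) (inner_normal phi e) =
  dot (y - e) e * dot (dd phi e e) (inner_normal phi e) + normal_remainder phi e y.
Proof.
move=> e1 By; have Be := on_circle_disk e1.
rewrite /normal_remainder [dot (_ - dd _ _ _) _]dotDl dotNl.
rewrite {2}(frame_decomp (y - e) e1) dd_add// !dd_scale//.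
rewrite [dot (_ *: _ + _) _]dotDl !dotZl.
by rewrite inner_normal_tangent// mulr0 addr0 [RHS]addrC subrK.
Qed.

Lemma normal_remainder_le e y : on_circle e -> unit_disk y ->
  `|normal_remainder phi e y| <= M * enorm (y - e) ^+ 2.
Proof.
move=> e1 By; apply: le_trans (dot_normr _ _) _; rewrite enorm_inner_normal// mulr1.
exact: param_taylor (on_circle_disk e1) By.
Qed.

Lemma dot_sub_circle e y : on_circle e -> unit_disk y -> dot (y - e) e <= 0.
Proof.
move=> e1; rewrite /unit_disk /disk /= subr0 => y1.
rewrite dotDl dotNl -enorm2 e1 expr1n subr_le0 (le_trans (dot_le _ _))//.
by rewrite e1 mulr1.
Qed.

Lemma dot_chord e e' : on_circle e -> on_circle e' ->
  dot (e' - e) e = - (enorm (e' - e) ^+ 2 / 2).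
Proof.
move=> e1 e'1; rewrite enorm2 !dotE -!enorm2 e1 e'1 expr1n (dotC e e'); lra.
Qed.

Lemma enorm_param_ge a b : unit_disk a -> unit_disk b ->
  enorm (a - b) ^+ 2 <= enorm (phi a - phi b) ^+ 2 / m ^+ 2.
Proof.
move=> Ba Bb; rewrite ler_pdivlMr ?exprn_gt0// mulrC -exprMn.
rewrite ler_pXn2r ?nnegrE ?mulr_ge0 ?enorm_ge0 ?(ltW m0)//.
exact: (pb_inj B).
Qed.

(** The radial term of the expansion is nonnegative, as [y - e] points into the
    disk, and the remainder is quadratic. Geometrically, the complement of the
    domain contains a disk of fixed radius tangent at each boundary point. *)
Lemma exterior_ineq e y : on_circle e -> unit_disk y ->
  - (M / m ^+ 2 * enorm (phi y - phi e) ^+ 2) <=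
  dot (phi y - phi e) (inner_normal phi e).
Proof.
move=> e1 By; rewrite normal_expansion//.
have h1 := dot_sub_circle e1 By; have h2 := inner_normal_radial_le e1.
have := normal_remainder_le e1 By; rewrite ler_norml => /andP[h3 _].
have h4 := enorm_param_ge By (on_circle_disk e1).
have {}h4 : M * enorm (y - e) ^+ 2 <= M / m ^+ 2 * enorm (phi y - phi e) ^+ 2.
  by rewrite -mulrA [_^-1 * _]mulrC ler_wpM2l ?(ltW M0).
have m0' := m0; have : 0 <= dot (y - e) e * dot (dd phi e e) (inner_normal phi e) by nra.
lra.
Qed.

(** Between two boundary points the radial term is quadratic as well; this
    yields tangent disks inside the domain. *)
Lemma chord_upper e e' : on_circle e -> on_circle e' ->
  dot (phi e' - phi e) (inner_normal phi e) <=
  3 / 2 * (M / m ^+ 2) * enorm (phi e' - phi e) ^+ 2.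
Proof.
move=> e1 e'1; rewrite normal_expansion//; last exact: on_circle_disk.
rewrite dot_chord//; have h2 := inner_normal_radial_ge e1.
have := normal_remainder_le e1 (on_circle_disk e'1); rewrite ler_norml => /andP[_ h3].
have h4 := enorm_param_ge (on_circle_disk e'1) (on_circle_disk e1).
have {}h4 : M * enorm (e' - e) ^+ 2 <= M / m ^+ 2 * enorm (phi e' - phi e) ^+ 2.
  by rewrite -mulrA [_^-1 * _]mulrC ler_wpM2l ?(ltW M0).
have := sqr_ge0 (enorm (e' - e)); nra.
Qed.

(** The radius enters the domain at a rate of at least [m], so near the
    boundary it runs inside any given tangent disk. *)
Lemma radial_lower e s : on_circle e -> 0 <= s <= 1 ->
  s * m - M * s ^+ 2 <= dot (phi ((1 - s) *: e) - phi e) (inner_normal phi e).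
Proof.
move=> e1 /andP[s0 s1].
have By : unit_disk ((1 - s) *: e).
  by rewrite /unit_disk /disk /= subr0 enormZp ?subr_ge0// e1 mulr1 gerBl.
have ye : (1 - s) *: e - e = (- s) *: e by rewrite scalerBl scale1r addrAC subrr add0r scaleNr.
rewrite normal_expansion// ye dotZl -enorm2 e1 expr1n mulr1.
have := normal_remainder_le e1 By; rewrite ye enormZ e1 mulr1 normrN (ger0_norm s0).
by rewrite ler_norml => /andP[h3 _]; have := inner_normal_radial_le e1; nra.
Qed.

End bounds.

(** The normal arises by two normalizations, of the derivative along the circle
    and of the inner vector, both of which have length at least [m]. *)
Lemma inner_normal_compare m M phi psi e e' d : param_bounds m M phi ->
  param_bounds m M psi -> on_circle e -> on_circle e' ->
  enorm (dd phi e e - dd psi e' e') <= d ->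
  enorm (dd phi (turn e) e - dd psi (turn e') e') <= d ->
  enorm (inner_normal phi e - inner_normal psi e') <= (4 / m + 8 * M / m ^+ 2) * d.
Proof.
move=> B B' e1 e'1 dE dT.
have m0 := pb_m B; have M0 := pb_M B.
have t1 := enorm_tangent B e1; have t'1 := enorm_tangent B' e'1.
have tt : enorm (tangent phi e - tangent psi e') <= 2 * d / m.
  apply: le_trans (normalize_lip (dd_turn_neq0 B e1) (dd_turn_neq0 B' e'1)) _.
  apply: ler_pM; rewrite ?mulr_ge0 ?enorm_ge0 ?invr_ge0 ?enorm_ge0//.
    by rewrite ler_pM2l.
  have h := enorm_dd_turn B e1.
  by rewrite lef_pV2 ?posrE// (lt_le_trans m0).
have E'M : enorm (dd psi e' e') <= M.
  by have := dd_le B' e' (on_circle_disk e'1); rewrite e'1 mulr1.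
have ww : enorm (inner_vector phi e - inner_vector psi e') <= 2 * d + 4 * M * d / m.
  set t := tangent phi e in t1 tt *; set t' := tangent psi e' in t'1 tt *.
  have -> : inner_vector phi e - inner_vector psi e' =
     (dot (dd phi e e - dd psi e' e') t *: t + dot (dd psi e' e') (t - t') *: t +
     dot (dd psi e' e') t' *: (t - t')) - (dd phi e e - dd psi e' e').
    rewrite /inner_vector -/t -/t'.
    move: (dd phi e e) (dd psi e' e') => a b.
    by apply: plane_eq; rewrite !(coordE, dotE) /=; ring.
  apply: le_trans (enormB_le _ _) _.
  have k1 : enorm (dot (dd phi e e - dd psi e' e') t *: t) <= d.
    by rewrite enormZ t1 mulr1 (le_trans (dot_normr _ _))// t1 mulr1.
  have tt0 := enorm_ge0 (t - t').
  have E'0 := enorm_ge0 (dd psi e' e').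
  have k2 : enorm (dot (dd psi e' e') (t - t') *: t) <= M * (2 * d / m).
    rewrite enormZ t1 mulr1 (le_trans (dot_normr _ _))//; apply: ler_pM => //.
  have k3 : enorm (dot (dd psi e' e') t' *: (t - t')) <= M * (2 * d / m).
    rewrite enormZ; apply: ler_pM => //.
    by rewrite (le_trans (dot_normr _ _))// t'1 mulr1.
  have := enormD (dot (dd phi e e - dd psi e' e') t *: t + dot (dd psi e' e') (t - t') *: t)
     (dot (dd psi e' e') t' *: (t - t')).
  have := enormD (dot (dd phi e e - dd psi e' e') t *: t) (dot (dd psi e' e') (t - t') *: t).
  have -> : 4 * M * d / m = M * (2 * d / m) + M * (2 * d / m) by lra.
  lra.
have w0 := inner_vector_neq0 B e1; have w'0 := inner_vector_neq0 B' e'1.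
apply: le_trans (normalize_lip w0 w'0) _.
have -> : (4 / m + 8 * M / m ^+ 2) * d = 2 * (2 * d + 4 * M * d / m) / m.
  by field; rewrite gt_eqF.
apply: ler_pM; rewrite ?mulr_ge0 ?enorm_ge0 ?invr_ge0 ?enorm_ge0//.
  by rewrite ler_pM2l.
have h := enorm_inner_vector B e1.
by rewrite lef_pV2 ?posrE// (lt_le_trans m0).
Qed.

Lemma inner_normal_lip m M phi e e' : param_bounds m M phi ->
  on_circle e -> on_circle e' ->
  enorm (inner_normal phi e - inner_normal phi e') <=
  (4 / m + 8 * M / m ^+ 2) * (2 * M * enorm (e - e')).
Proof.
move=> B e1 e'1; have Be := on_circle_disk e1; have Be' := on_circle_disk e'1.
have K v v' : on_circle v -> on_circle v' -> enorm (v - v') = enorm (e - e') ->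
    enorm (dd phi v e - dd phi v' e') <= 2 * M * enorm (e - e').
  move=> v1 v'1 vv; have -> : dd phi v e - dd phi v' e' =
      dd phi (v - v') e + (dd phi v' e - dd phi v' e').
    by rewrite (dd_add B)// (dd_opp B)// addrA subrK.
  apply: le_trans (enormD _ _) _.
  have := dd_le B (v - v') Be; rewrite vv.
  have := derive_lip (pb_C2 B) (pb_d2 B) v' Be' Be; rewrite v'1 mulr1.
  lra.
apply: (inner_normal_compare B B e1 e'1); apply: K => //.
- by rewrite /on_circle enorm_turn.
- by rewrite /on_circle enorm_turn.
- by rewrite turnB enorm_turn.
Qed.

Lemma inner_normal_close m M d phi psi e : param_bounds m M phi ->
  param_bounds m M psi -> C2_close d phi psi -> on_circle e ->
  enorm (inner_normal phi e - inner_normal psi e) <= (4 / m + 8 * M / m ^+ 2) * d.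
Proof.
move=> B B' cl e1; have [_ c1 _] := C2_close_dd cl (on_circle_disk e1).
apply: (inner_normal_compare B B' e1 e1); apply/ltW/c1 => //.
by rewrite enorm_turn.
Qed.

End normal.

(** * Boundary and tangent disks of a [C^2] domain *)

Lemma connected_sign (T : topologicalType) (R : realType) (A : set T)
    (F : T -> R) x y : connected A -> (forall z, A z -> {for z, continuous F}) ->
  (forall z, A z -> F z != 0) -> A x -> A y -> F x < 0 -> F y < 0.
Proof.
move=> cA cF F0 Ax Ay Fx; rewrite ltNge; apply/negP => Fy.
have cFA : connected (F @` A).
  apply: connected_continuous_connected => //.
  by apply: continuous_in_subspaceT => z; rewrite inE; exact: cF.
have /connected_intervalP := cFA.
move=> /(_ (F x) (F y) (imageP _ Ax) (imageP _ Ay) 0)[].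
  by rewrite (ltW Fx) Fy.
by move=> z Az /eqP; apply/negP/F0.
Qed.

Lemma convex_comb_lt (R : realDomainType) (a b c k : R) : 0 <= k <= 1 ->
  a < c -> b < c -> (1 - k) * a + k * b < c.
Proof.
move=> /andP[k0 k1] ac bc; apply: (@le_lt_trans _ _ (Num.max a b)).
  have : a <= Num.max a b by rewrite le_max lexx.
  have : b <= Num.max a b by rewrite le_max lexx orbT.
  nra.
by rewrite gt_max ac.
Qed.

Section plane_topology.
Context {R : realType}.
Implicit Types (D : set (plane R)) (x y p q c u : plane R) (s t : R).

Lemma continuous_segment x y : continuous (fun s : R => x + s *: y).
Proof.
move=> s; apply: cvgD; first exact: cvg_cst.
by apply: cvgZl; exact: cvg_id.
Qed.

(** The set and its interior have the same trace on the segment, which is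
    therefore open and closed in it. *)
Lemma segment_inside D x y : closed D -> D x ->
  (forall s, 0 <= s <= 1 -> ~ boundary D (x + s *: (y - x))) -> D y.
Proof.
move=> cD Dx bD.
pose A := (fun s : R => x + s *: (y - x)) @` `[0, 1].
have cA : connected A.
  apply: connected_continuous_connected; first exact: segment_connected.
  by apply: continuous_subspaceT; exact: continuous_segment.
have Ax : A x by exists 0; [rewrite /= in_itv /= lexx ler01|rewrite scale0r addr0].
have Ay : A y by exists 1; [rewrite /= in_itv /= lexx ler01|rewrite scale1r addrC subrK].
have AI : A `&` D = A `&` interior D.
  apply/seteqP; split => [z [[s s01 <-] Dz]|z [Az /interior_subset Dz]]; last by [].
  split; first by exists s.
  apply: contrapT => nI; apply: (bD s); first by move: s01; rewrite /= in_itv.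
  by split; [exact: subset_closure|].
have : A `&` D = A.
  apply: cA; first by exists x.
    by exists (interior D) => //; exact: open_interior.
  by exists D.
by move=> E; have [] : (A `&` D) y by rewrite E.
Qed.

Lemma open_disk_subset D c s : closed D -> 0 < s ->
  (forall x, enorm (x - c) < s -> D x) -> disk c s `<=` D.
Proof.
move=> cD s0 oD x xs; apply: cD => A /nbhs_enormP[e e0 eA].
pose h := Num.min 1 (e / (2 * s)).
have h0 : 0 < h by rewrite lt_min ltr01 divr_gt0// mulr_gt0.
have h1 : h <= 1 by rewrite ge_min lexx.
have hs : h * s < e.
  apply: le_lt_trans (_ : e / (2 * s) * s < e).
    by rewrite ler_pM2r// ge_min lexx orbT.
  have -> : e / (2 * s) * s = e / 2 by field; rewrite gt_eqF.
  by lra.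
have xs' : enorm (x - c) <= s by [].
have xc0 := enorm_ge0 (x - c).
exists (c + (1 - h) *: (x - c)); split.
  apply: oD; rewrite addrAC subrr add0r enormZp ?subr_ge0//; nra.
apply: eA; rewrite (_ : _ - x = - (h *: (x - c))); last first.
  by apply: plane_eq; rewrite !coordE; ring.
rewrite enormN enormZp ?(ltW h0)//; nra.
Qed.

Definition circle_point t : plane R := (cos t, sin t).

Lemma circle_pointP t : on_circle (circle_point t).
Proof. by rewrite /on_circle /enorm /dot /= -!expr2 cos2Dsin2 sqrtr1. Qed.

Lemma on_circle_angle x : on_circle x -> exists t, x = circle_point t.
Proof.
move=> x1; have : dot x x = 1 by rewrite -enorm2 x1 expr1n.
rewrite /dot -!expr2 => xx.
have c1 : -1 <= x.1 <= 1 by have := sqr_ge0 x.2; nra.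
have [x20|x20] := leP 0 x.2; [exists (acos x.1)|exists (- acos x.1)];
  apply: plane_eq; rewrite /= ?cosN ?sinN ?acosK ?in_itv//= sin_acos//.
  by rewrite -xx addrAC subrr add0r sqrtr_sqr ger0_norm.
by rewrite -xx addrAC subrr add0r sqrtr_sqr ltr0_norm// opprK.
Qed.

Lemma continuous_circle_point : continuous circle_point.
Proof. by move=> t; exact: (cvg_pair (@continuous_cos R t) (@continuous_sin R t)). Qed.

Lemma circle0E : circle 0 1 = @on_circle R.
Proof. by apply/seteqP; split => x; rewrite /circle /on_circle /= subr0. Qed.

Lemma on_circle_compact : compact (@on_circle R).
Proof. by rewrite -circle0E; exact: unit_circle_compact. Qed.

End plane_topology.

Section domain.
Context {R : realType}.
Variables (m M : R) (phi : plane R -> plane R).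
Hypothesis B : param_bounds m M phi.
Implicit Types (x y v w a b e p q c u z : plane R) (s t : R).

Let m0 := pb_m B.
Let M0 := pb_M B.
Let D : set (plane R) := phi @` @unit_disk R.
Let n := inner_normal phi.

Lemma param_continuous x : unit_disk x -> {for x, continuous phi}.
Proof. exact: C2_near_continuous (pb_C2 B) _. Qed.

Lemma domain_compact : compact D.
Proof.
apply: continuous_compact; last exact: unit_disk_compact.
by apply: continuous_in_subspaceT => x; rewrite inE; exact: param_continuous.
Qed.

Lemma domain_closed : closed D.
Proof. by apply: compact_closed domain_compact; exact: norm_hausdorff. Qed.

Lemma domain_nonempty : D !=set0.
Proof. by exists (phi 0), 0 => //; rewrite /unit_disk /disk /= subr0 enorm0. Qed.

Lemma dd_surjective y u : unit_disk y -> exists v, dd phi v y = u.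
Proof.
move=> By; pose A := dd phi (1, 0) y; pose C := dd phi (0, 1) y.
have dE s t : dd phi (s, t) y = s *: A + t *: C.
  rewrite [(s, t)]plane_basis (dd_add B)// !(dd_scale B)//.
have nz v : dd phi v y = 0 -> v = 0.
  move=> h; apply: enorm0_eq0; have := dd_ge B v By; rewrite h enorm0 => k.
  by apply/eqP; rewrite eq_le enorm_ge0 andbT; move: k; rewrite pmulr_rle0.
pose d := A.1 * C.2 - A.2 * C.1.
have d0 : d != 0.
  apply/eqP => dz.
  have /nz[h1 h2] : dd phi (C.1, - A.1) y = 0.
    by rewrite dE; apply: plane_eq; rewrite !coordE /=; move: dz; rewrite /d; lra.
  have /nz[h3 h4] : dd phi (C.2, - A.2) y = 0.
    by rewrite dE; apply: plane_eq; rewrite !coordE /=; move: dz; rewrite /d; lra.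
  have /nz[] : dd phi (1, 0) y = 0.
    apply: plane_eq; rewrite -/A /=; lra.
  by move/eqP; rewrite oner_eq0.
exists ((u.1 * C.2 - u.2 * C.1) / d, (A.1 * u.2 - A.2 * u.1) / d).
by rewrite dE; apply: plane_eq; rewrite !coordE /=; move: d0; rewrite /d => d0; field.
Qed.

(** A point [z] near [phi y0] is the image of a minimizer of the distance from [z],
    since at any other point the derivative of [phi], being onto, would allow
    a move towards [z]. *)
Lemma param_interior y0 : enorm y0 < 1 -> interior D (phi y0).
Proof.
move=> y01; pose r := 1 - enorm y0.
have r0 : 0 < r by rewrite subr_gt0.
have sub y : enorm (y - y0) <= r -> unit_disk y.
  rewrite /unit_disk /disk /= subr0 => h.
  by rewrite -(subrK y0 y) (le_trans (enormD _ _))// -lerBrDr.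
have By0 : unit_disk y0 by apply: sub; rewrite subrr enorm0 ltW.
apply/nbhs_enormP; exists (m * r / 2); first by rewrite divr_gt0// mulr_gt0.
move=> z zy0.
have [|||y] := @compact_EVT_min _ R (fun y => enorm (phi y - z)) (disk y0 r).
- by exists y0; rewrite /disk /= subrr enorm0 ltW.
- exact: disk_compact.
- apply: continuous_in_subspaceT => y; rewrite inE => yr.
  apply: cvg_enorm; apply: cvgB; last exact: cvg_cst.
  by apply: param_continuous; exact: sub.
rewrite inE => yr ymin.
have By := sub y yr.
have ylt : enorm (y - y0) < r.
  rewrite lt_neqAle yr andbT; apply/eqP => yE.
  have := ymin y0; rewrite inE => /(_ _)/= H.
  have {}H : enorm (phi y - z) <= enorm (phi y0 - z).
    by apply: H; rewrite /disk /= subrr enorm0 ltW.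
  have := pb_inj B By By0; rewrite yE => h1.
  have := enorm_triB (phi y) z (phi y0).
  move: zy0 H; rewrite (enormB z (phi y0)); nra.
have [->|uz] := pselect (z = phi y); first by exists y.
exfalso; pose u := phi y - z.
have u0 : 0 < enorm u by apply: enorm_gt0 => /eqP; rewrite subr_eq0 => /eqP /esym.
have [v dv] := dd_surjective (- u) By.
have v0 : 0 < enorm v.
  apply: enorm_gt0 => v0; move: dv; rewrite v0 dd0 => /(congr1 (@enorm R)).
  by rewrite enormN enorm0 => E; move: u0; rewrite -E ltxx.
pose s1 := (r - enorm (y - y0)) / enorm v.
pose s2 := enorm u / (2 * M * enorm v ^+ 2).
pose s := Num.min 1 (Num.min s1 s2).
have s10 : 0 < s1 by rewrite divr_gt0// subr_gt0.
have s20 : 0 < s2 by rewrite divr_gt0// mulr_gt0 ?exprn_gt0// mulr_gt0.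
have s0 : 0 < s by rewrite !lt_min ltr01 s10 s20.
have sle1 : s <= 1 by rewrite ge_min lexx.
have ss1 : s * enorm v <= r - enorm (y - y0).
  by rewrite -ler_pdivlMr// /s !ge_min lexx !orbT.
have ss2 : M * s * enorm v ^+ 2 <= enorm u / 2.
  have : s <= s2 by rewrite /s !ge_min lexx !orbT.
  rewrite /s2 ler_pdivlMr ?mulr_gt0 ?exprn_gt0 ?mulr_gt0//; lra.
pose y' := y + s *: v.
have y'y : y' - y = s *: v by rewrite /y' addrAC subrr add0r.
have yr' : enorm (y' - y0) <= r.
  have := enorm_triB y' y y0; rewrite y'y enormZp ?(ltW s0)//; lra.
have By' := sub _ yr'.
have := param_taylor B By By'; rewrite y'y (dd_scale B)// dv enormZp ?(ltW s0)//.
set w := phi y' - phi y - _ => hw.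
have E : phi y' - z = (1 - s) *: u + w.
  rewrite /w /u; apply: plane_eq; rewrite !coordE; ring.
have := ymin y'; rewrite inE => /(_ yr'); rewrite E -/u leNgt => /negP; apply.
apply: le_lt_trans (enormD _ _) _; rewrite enormZp ?subr_ge0//.
have : M * (s * enorm v) ^+ 2 <= s * (enorm u / 2).
  by rewrite exprMn expr2 -mulrA mulrCA ler_pM2l// mulrA.
nra.
Qed.

(** For a point of the domain [exterior_ineq] would give
    [t <= M / m ^+ 2 * t ^+ 2]. *)
Lemma exterior_point e t : on_circle e -> 0 < t -> t < m ^+ 2 / M ->
  ~ D (phi e - t *: n e).
Proof.
move=> e1 t0 tm [y By E]; have := exterior_ineq B e1 By; rewrite E.
rewrite addrAC subrr add0r dotNl dotZl -enorm2 enormN enormZp ?(ltW t0)//.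
rewrite (enorm_inner_normal B)// expr1n !mulr1 lerN2.
rewrite leNgt => /negP; apply.
have : M / m ^+ 2 * t < 1.
  by rewrite mulrAC ltr_pdivrMr ?exprn_gt0// mul1r mulrC -ltr_pdivlMr.
by rewrite expr2 mulrA => h; rewrite -[ltRHS]mul1r ltr_pM2r.
Qed.

Lemma domain_boundary : boundary D = phi @` @on_circle R.
Proof.
rewrite /boundary -(closure_id D).1; last exact: domain_closed.
apply/seteqP; split => [x [[y By <-] nI]|_ [e e1 <-]].
  exists y => //; apply/eqP; rewrite eq_le; apply/andP; split.
    by move: By; rewrite /unit_disk /disk /= subr0.
  by rewrite leNgt; apply/negP => /param_interior.
split; first by exists e => //; exact: on_circle_disk.
move=> /nbhs_enormP[d d0 dD].
have mM : 0 < m ^+ 2 / M by rewrite divr_gt0// exprn_gt0.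
pose t := Num.min (d / 2) (m ^+ 2 / M / 2).
have t0 : 0 < t by rewrite lt_min; apply/andP; split; exact: divr_gt0.
have td : t <= d / 2 by rewrite ge_min lexx.
have tm : t <= m ^+ 2 / M / 2 by rewrite ge_min lexx orbT.
apply: (@exterior_point e t) => //; first lra.
apply: dD; rewrite addrAC subrr add0r enormN enormZp ?(ltW t0)//.
by rewrite (enorm_inner_normal B)// mulr1; lra.
Qed.

Lemma boundaryP e : on_circle e -> boundary D (phi e).
Proof. by rewrite domain_boundary => e1; exists e. Qed.

Lemma domain_mem e : on_circle e -> D (phi e).
Proof. by move=> e1; exists e => //; exact: on_circle_disk. Qed.

(** [tangent_radius s e]: no point of the boundary lies strictly inside the
    circle of radius [s] that touches the boundary from inside at [phi e]. *)
Definition tangent_radius s e := forall e', on_circle e' ->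
  2 * s * dot (phi e' - phi e) (n e) <= enorm (phi e' - phi e) ^+ 2.

Lemma tangent_radiusP s e : on_circle e -> 0 <= s ->
  tangent_radius s e <->
  forall e', on_circle e' -> s <= enorm (phi e' - (phi e + s *: n e)).
Proof.
move=> e1 s0; have E e' : (s <= enorm (phi e' - (phi e + s *: n e))) =
    (2 * s * dot (phi e' - phi e) (n e) <= enorm (phi e' - phi e) ^+ 2).
  rewrite leNgt ltdisk_dotP// tangent_disk_dot ?(enorm_inner_normal B)//.
  by rewrite -leNgt lerDl subr_ge0 enorm2.
by split => h e' e'1; have := h e' e'1; rewrite E.
Qed.

(** The open disk bounded by such a circle is connected, avoids the boundary,
    and contains points of the domain, so it lies in the domain. *)
Lemma tangent_disk_sub s e : on_circle e -> 0 < s -> tangent_radius s e ->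
  disk (phi e + s *: n e) s `<=` D.
Proof.
move=> e1 s0 /(tangent_radiusP e1 (ltW s0)) ts; set c := phi e + _.
apply: open_disk_subset => //; first exact: domain_closed.
pose h := s * m / (M ^+ 2 + 2 * s * M + s * m).
have den : 0 < M ^+ 2 + 2 * s * M + s * m.
  by rewrite addr_gt0 ?addr_gt0 ?exprn_gt0 ?mulr_gt0.
have h0 : 0 < h by rewrite divr_gt0// mulr_gt0.
have hE : h * (M ^+ 2 + 2 * s * M + s * m) = s * m.
  by rewrite /h divfK// gt_eqF.
have h1 : h <= 1.
  rewrite ler_pdivrMr// mul1r lerDr addr_ge0 ?exprn_ge0 ?mulr_ge0 ?(ltW s0) ?(ltW M0)//.
have h01 : 0 <= h <= 1 by rewrite (ltW h0).
pose y := (1 - h) *: e.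
have By : unit_disk y.
  by rewrite /unit_disk /disk /= subr0 enormZp ?subr_ge0// e1 mulr1 gerBl ltW.
have x0c : enorm (phi y - c) < s.
  rewrite ltdisk_dotP ?(ltW s0)// tangent_disk_dot ?(enorm_inner_normal B)//.
  rewrite -enorm2 gtrDl subr_lt0.
  have r1 := radial_lower B e1 h01; rewrite -/y -/(n e) in r1.
  have r2 := param_lip B (on_circle_disk e1) By.
  rewrite /y (_ : _ - e = - (h *: e)) in r2; last first.
    by apply: plane_eq; rewrite !coordE; ring.
  rewrite enormN enormZp ?(ltW h0)// e1 mulr1 -/y in r2.
  have r3 : enorm (phi y - phi e) ^+ 2 <= (M * h) ^+ 2.
    by rewrite ler_pXn2r ?nnegrE ?enorm_ge0// mulr_ge0 ?(ltW M0) ?(ltW h0).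
  apply: le_lt_trans r3 _.
  apply: lt_le_trans (_ : 2 * s * (h * m - M * h ^+ 2) <= _); last first.
    by rewrite ler_pM2l// mulr_gt0.
  have hh : 0 < h * (s * m) by rewrite mulr_gt0// mulr_gt0.
  have : h * (M ^+ 2 * h + 2 * s * M * h) < h * (2 * s * m).
    rewrite ltr_pM2l//.
    have : 0 < h * (s * m) by [].
    have : 0 < s * m by rewrite mulr_gt0.
    lra.
  rewrite exprMn !expr2; lra.
move=> x xs; apply: (@segment_inside _ _ (phi y)).
- exact: domain_closed.
- by exists y.
- move=> k /andP[k0 k1]; rewrite domain_boundary => -[e' e'1 E].
  have := ts e' e'1; rewrite E leNgt => /negP; apply.
  rewrite (_ : _ - _ = (1 - k) *: (phi y - c) + k *: (x - c)); last first.
    by apply: plane_eq; rewrite !coordE; ring.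
  apply: le_lt_trans (enormD _ _) _; rewrite !enormZp ?subr_ge0//.
  by apply: convex_comb_lt; rewrite ?k0.
Qed.

(** This is [chord_upper]: the radius is the inverse of twice its constant. *)
Lemma small_tangent_radius e : on_circle e -> tangent_radius (m ^+ 2 / (3 * M)) e.
Proof.
move=> e1 e' e'1; have := chord_upper B e1 e'1; rewrite -/(n e) => h.
have k : 0 < m ^+ 2 / (3 * M) by rewrite divr_gt0 ?exprn_gt0 ?mulr_gt0.
apply: le_trans (_ : 2 * (m ^+ 2 / (3 * M)) *
  (3 / 2 * (M / m ^+ 2) * enorm (phi e' - phi e) ^+ 2) <= _).
  by rewrite ler_pM2l// mulr_gt0.
rewrite le_eqVlt; apply/orP; left; apply/eqP.
by field; rewrite !gt_eqF.
Qed.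

(** The boundary point nearest to an exterior point [x] is the point nearest to
    [x] of a tangent disk inside the domain, so the center of that disk, the
    boundary point and [x] are aligned. *)
Lemma nearest_point x : ~ D x -> exists e, [/\ on_circle e,
  phi e - enorm (x - phi e) *: n e = x &
  forall y, D y -> enorm (x - phi e) <= enorm (x - y)].
Proof.
move=> nDx.
have [|q] := @compact_EVT_min _ R (fun q => enorm (x - q)) D domain_nonempty domain_compact.
  apply: continuous_subspaceT => q; apply: cvg_enorm; apply: cvgB.
    exact: cvg_cst.
  exact: cvg_id.
rewrite inE => -[y By <-] qmin.
have {}qmin z : D z -> enorm (x - phi y) <= enorm (x - z).
  by move=> Dz; apply: qmin; rewrite inE.
set t := enorm (x - phi y) in qmin.
have t0 : 0 < t.
  by apply: enorm_gt0 => /eqP; rewrite subr_eq0 => /eqP E; apply: nDx; rewrite E; exists y.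
have y1 : on_circle y.
  apply/eqP; rewrite eq_le; apply/andP; split.
    by move: By; rewrite /unit_disk /disk /= subr0.
  rewrite leNgt; apply/negP => /param_interior /nbhs_enormP[d d0 dD].
  pose k := Num.min 1 (d / (2 * t)).
  have k0 : 0 < k by rewrite lt_min ltr01 divr_gt0// mulr_gt0.
  have k1 : k <= 1 by rewrite ge_min lexx.
  have kt : k * t < d.
    apply: le_lt_trans (_ : d / (2 * t) * t < d).
      by rewrite ler_pM2r// ge_min lexx orbT.
    have -> : d / (2 * t) * t = d / 2 by field; rewrite gt_eqF.
    by lra.
  have := qmin (phi y + k *: (x - phi y)).
  rewrite (_ : x - (_ + _) = (1 - k) *: (x - phi y)); last first.
    by apply: plane_eq; rewrite !coordE; ring.
  rewrite enormZp ?subr_ge0// -/t leNgt gtr_pMl// gtrBl k0 => H.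
  suff : false by []; apply: H; apply: dD.
  by rewrite addrAC subrr add0r enormZp ?(ltW k0).
exists y; split => //.
pose s := m ^+ 2 / (3 * M).
have s0 : 0 < s by rewrite divr_gt0 ?exprn_gt0 ?mulr_gt0.
have inD := tangent_disk_sub y1 s0 (small_tangent_radius y1); rewrite -/s in inD.
set c := phi y + s *: n y in inD.
have xc : x - c <> 0.
  move=> /eqP; rewrite subr_eq0 => /eqP E; apply: nDx; rewrite E; apply: inD.
  by rewrite /disk /= subrr enorm0 ltW.
have ts : t + s <= enorm (x - c).
  have := qmin (c + s *: normalize (x - c)).
  rewrite (_ : x - (c + s *: normalize (x - c)) =
      (enorm (x - c) - s) *: normalize (x - c)); last first.
    by rewrite scalerBl normalizeK// opprD addrA.
  rewrite enormZ enorm_normalize// mulr1 => H.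
  have {}H : t <= `|enorm (x - c) - s|.
    apply: H; apply: inD; rewrite /disk /= addrAC subrr add0r enormZp ?(ltW s0)//.
    by rewrite enorm_normalize// mulr1.
  have sx : s <= enorm (x - c).
    by rewrite leNgt; apply/negP => /ltW xs; apply: nDx; exact: inD.
  by move: H; rewrite ger0_norm ?subr_ge0//; lra.
have n1 := enorm_inner_normal B y1; rewrite -/(n y) in n1.
have xn : dot (x - phi y) (n y) <= - t.
  have : (t + s) ^+ 2 <= enorm (x - c) ^+ 2.
    by rewrite ler_pXn2r ?nnegrE ?enorm_ge0// addr_ge0 ?(ltW t0) ?(ltW s0).
  rewrite enorm2 tangent_disk_dot// -enorm2 -/t => h.
  have : s * (2 * t) <= s * (- 2 * dot (x - phi y) (n y)) by lra.
  by rewrite ler_pM2l//; lra.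
have xp : x - phi y <> 0 by move=> E; move: t0; rewrite /t E enorm0 ltxx.
have -> : n y = - normalize (x - phi y).
  apply/esym/unit_vector_eq; [by rewrite enormN enorm_normalize|exact: n1|].
  rewrite /normalize -scalerN dotZl dotNl -/t -lerN2 -mulrN opprK -(ler_pM2l t0).
  by rewrite mulrA divff ?gt_eqF// mul1r mulrN1.
by rewrite scalerN opprK normalizeK// addrC subrK.
Qed.

Lemma continuous_inner_normal : continuous (fun t => n (circle_point t)).
Proof.
move=> t; apply/cvg_enormP => d d0.
pose K := (4 / m + 8 * M / m ^+ 2) * (2 * M) + 1.
have K0 : 0 < K.
  by rewrite /K addr_gt0// mulr_gt0 ?addr_gt0 ?divr_gt0 ?mulr_gt0 ?exprn_gt0.
have dK : 0 < d / K by rewrite divr_gt0.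
have /cvg_enormP/(_ _ dK) := @continuous_circle_point R t.
apply: filterS => t' h.
apply: le_lt_trans (inner_normal_lip B (circle_pointP _) (circle_pointP _)) _.
move: h; rewrite ltr_pdivlMr// => h.
have := enorm_ge0 (circle_point t' - circle_point t).
by move: h; rewrite /K; lra.
Qed.

(** Otherwise the circle separates the complement of the domain into a part
    inside and an unbounded part outside. Each part contains, next to some boundary point, the exterior tangent disk
    of that point; but the center of the exterior tangent disk moves
    continuously along the boundary curve, without meeting the circle. *)
Lemma circle_fill c s : circle c s `<=` D -> disk c s `<=` D.
Proof.
move=> cD x xs; apply: contrapT => nDx.
pose t0 := m ^+ 2 / (2 * M).
have t00 : 0 < t0 by rewrite divr_gt0 ?exprn_gt0 ?mulr_gt0.
have tmM : t0 < m ^+ 2 / M.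
  by rewrite /t0 ltr_pM2l ?exprn_gt0// ltf_pV2 ?posrE ?mulr_gt0//; have := M0; lra.
pose F z := enorm (z - c) - s.
have cF z : {for z, continuous F}.
  apply: cvgB; last exact: cvg_cst.
  by apply: cvg_enorm; apply: cvgB; [exact: cvg_id|exact: cvg_cst].
have F0 z : ~ D z -> F z != 0.
  by move=> nDz; rewrite subr_eq0; apply/eqP => E; apply: nDz; exact: cD.
pose g e := phi e - t0 *: n e.
have side z : ~ D z -> exists2 e, on_circle e &
    (F z < 0 -> F (g e) < 0) /\ (F (g e) < 0 -> F z < 0).
  move=> nDz; have [e [e1 ze zmin]] := nearest_point nDz; exists e => //.
  set t := enorm (z - phi e) in ze zmin.
  have t_gt0 : 0 < t.
    apply: enorm_gt0 => /eqP; rewrite subr_eq0 => /eqP E; apply: nDz; rewrite E.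
    exact: domain_mem.
  pose A := (fun k : R => phi e - k *: n e) @` `[Num.min t t0, Num.max t t0].
  have cA : connected A.
    apply: connected_continuous_connected; first exact: segment_connected.
    apply: continuous_subspaceT => k; apply: cvgB; first exact: cvg_cst.
    by apply: cvgZl; exact: cvg_id.
  have nA w : A w -> ~ D w.
    move=> [k /=]; rewrite in_itv /= ge_min le_max => /andP[k1 k2] <-.
    have k0 : 0 < k by case/orP: k1 => h; [exact: lt_le_trans t_gt0 h|exact: lt_le_trans t00 h].
    case/orP: k2 => kt.
      move=> /zmin; rewrite -ze (_ : _ - _ = (k - t) *: n e); last first.
        by apply: plane_eq; rewrite !coordE; ring.
      rewrite enormZ (enorm_inner_normal B)// mulr1 ler0_norm ?subr_le0//; lra.
    apply: exterior_point => //; exact: le_lt_trans kt tmM.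
  have Az : A z.
    by exists t => //=; rewrite in_itv /= ge_min le_max lexx.
  have Ag : A (g e).
    by exists t0 => //=; rewrite in_itv /= ge_min le_max lexx !orbT.
  split; apply: (connected_sign cA (fun z _ => cF z)) => // w /nA; exact: F0.
have nDg e : on_circle e -> ~ D (g e) by move=> e1; exact: exterior_point.
have Fx : F x < 0.
  by rewrite lt_neqAle F0//= subr_le0.
have [y [nDy Fy]] : exists y, ~ D y /\ 0 < F y.
  have [K K0 KP] := compact_bounded_above domain_compact
    (fun z _ => @cvg_enorm R _ (nbhs z) _ id z cvg_id).
  pose k := K + enorm c + `|s| + 1.
  have k0 : 0 <= k by rewrite /k !addr_ge0 ?enorm_ge0// ltW.
  have e1 : enorm ((1, 0) : plane R) = 1.
    by rewrite /enorm /dot /= mulr1 mulr0 addr0 sqrtr1.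
  have kE : enorm (k *: ((1, 0) : plane R)) = k by rewrite enormZp// e1 mulr1.
  have c0 := enorm_ge0 c; have s0 := normr_ge0 s; have s1 := ler_norm s.
  exists (k *: (1, 0)); split.
    by move=> /KP /=; rewrite kE /k; lra.
  have := enormBl (k *: (1, 0)) c; rewrite /F kE /k; lra.
have [_ /on_circle_angle[a ->] [s1 _]] := side x nDx.
have [_ /on_circle_angle[b ->] [_ s2]] := side y nDy.
have cFg t : {for t, continuous (fun t => F (g (circle_point t)))}.
  apply: (@continuous_comp _ _ _ (fun t => g (circle_point t)) F) => //.
  apply: cvgB.
    apply: (@continuous_comp _ _ _ circle_point phi).
      exact: continuous_circle_point.
    by apply: param_continuous; apply: on_circle_disk; exact: circle_pointP.
  by apply: cvgZr; exact: continuous_inner_normal.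
have : F (g (circle_point b)) < 0.
  apply: (@connected_sign _ _ setT (fun t => F (g (circle_point t))) a b) => //.
  - by apply/connected_intervalP.
  - by move=> t _; apply: F0; apply: nDg; exact: circle_pointP.
  - exact: s1.
by move=> /s2; rewrite ltNge (ltW Fy).
Qed.

(** Otherwise, for the unit vector [u] from [phi e] to [c], a small move from
    [phi e] in the direction [u - n e] stays in the disk but has a negative
    component along the normal, which [exterior_ineq] forbids. *)
Lemma inscribed_center e c s : on_circle e -> 0 < s -> circle c s (phi e) ->
  disk c s `<=` D -> c = phi e + s *: n e.
Proof.
move=> e1 s0 cs dD.
pose u := s^-1 *: (c - phi e).
have cE : c = phi e + s *: u by rewrite /u scalerA divff ?gt_eqF// scale1r addrC subrK.
have u1 : enorm u = 1.
  rewrite /u enormZp ?invr_ge0 ?(ltW s0)// enormB.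
  by move: cs; rewrite /circle /= => ->; rewrite mulVf// gt_eqF.
have n1 := enorm_inner_normal B e1; rewrite -/(n e) in n1.
rewrite cE; congr (_ + _ *: _); apply: unit_vector_eq => //.
clearbody u; rewrite leNgt; apply/negP => un.
pose k := 1 - dot u (n e).
have k0 : 0 < k by rewrite subr_gt0.
have uu : dot u u = 1 by rewrite -enorm2 u1 expr1n.
have nn : dot (n e) (n e) = 1 by rewrite -enorm2 n1 expr1n.
pose w := u - n e.
have ww : dot w w = 2 * k by rewrite /w /k !dotB uu nn (dotC (n e)); ring.
have wu : dot w u = k by rewrite /w /k !dotB uu (dotC (n e)); ring.
have wn : dot w (n e) = - k by rewrite /w /k !dotB nn; ring.
clearbody w.
pose t := Num.min s (m ^+ 2 / (4 * M)).
have t0 : 0 < t by rewrite lt_min s0 divr_gt0 ?exprn_gt0 ?mulr_gt0.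
have ts : t <= s by rewrite ge_min lexx.
have tm : t <= m ^+ 2 / (4 * M) by rewrite ge_min lexx orbT.
have [y By yE] : D (phi e + t *: w).
  apply: dD; rewrite /disk /= disk_dotP ?(ltW s0)// {1 2}cE tangent_disk_dot//.
  rewrite (_ : phi e + t *: w - phi e = t *: w); last by rewrite addrAC subrr add0r.
  rewrite !(dotZl, dotZr) ww wu gerDl subr_le0.
  have : t * (t * k) <= s * (t * k) by rewrite ler_pM2r ?mulr_gt0.
  lra.
have := exterior_ineq B e1 By; rewrite yE addrAC subrr add0r -/(n e).
rewrite enorm2 [dot (t *: w) (n e)]dotZl wn dotZl dotZr ww mulrN lerN2 => h.
have {}h : t * k <= t * k * (2 * t * (M / m ^+ 2)) by lra.
move: h; rewrite ler_pMr ?mulr_gt0// leNgt => /negP; apply.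
apply: le_lt_trans (_ : 2 * (m ^+ 2 / (4 * M)) * (M / m ^+ 2) < 1).
  by rewrite ler_pM2r ?divr_gt0 ?exprn_gt0// ler_pM2l.
have -> : 2 * (m ^+ 2 / (4 * M)) * (M / m ^+ 2) = 2^-1.
  by field; rewrite !gt_eqF.
by lra.
Qed.

Definition reach_set := [set s | 0 < s /\ forall p, boundary D p ->
  exists2 c, circle c s p & circle c s `<=` D].

(** The circles of the definition of the reach become quadratic inequalities
    between boundary points. *)
Lemma reach_setP s : reach_set s <->
  0 < s /\ forall e, on_circle e -> tangent_radius s e.
Proof.
split => [[s0 h]|[s0 h]]; split => //.
  move=> e e1; have [c cp cD] := h _ (boundaryP e1).
  have dD := circle_fill cD.
  have cE := inscribed_center e1 s0 cp dD.
  apply/(tangent_radiusP e1 (ltW s0)) => e' e'1; rewrite -cE leNgt; apply/negP => lt.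
  have := boundaryP e'1; move=> [_]; apply.
  apply/nbhs_enormP; exists (s - enorm (phi e' - c)); first by rewrite subr_gt0.
  move=> y ye; apply: dD; rewrite /disk /=.
  by have := enorm_triB y (phi e') c; lra.
move=> p; rewrite domain_boundary => -[e e1 <-].
exists (phi e + s *: n e).
  rewrite /circle /= opprD addrA subrr add0r enormN enormZp ?(ltW s0)//.
  by rewrite (enorm_inner_normal B)// mulr1.
apply: subset_trans (tangent_disk_sub e1 s0 (h e e1)) => x.
by rewrite /circle /disk /= => ->.
Qed.

End domain.

(** * Normal coordinates up to the reach *)

Definition image_disk (R : realType) (phi : plane R -> plane R) : set (plane R) :=
  phi @` @unit_disk R.

Section reach.
Context {R : realType}.
Variables (m M : R) (phi : plane R -> plane R).
Hypothesis B : param_bounds m M phi.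
Implicit Types (x y v w a b e p q c u z : plane R) (s t : R).

Let m0 := pb_m B.
Let M0 := pb_M B.
Let D : set (plane R) := image_disk phi.
Let n := inner_normal phi.
Let rho := reach D.

Let n1 e : on_circle e -> enorm (n e) = 1.
Proof. exact: (enorm_inner_normal B). Qed.

Lemma on_circle10 : @on_circle R (1, 0).
Proof. by rewrite /on_circle /enorm /dot /= mulr1 mulr0 addr0 sqrtr1. Qed.

Lemma enorm_sub_disk y e : unit_disk y -> unit_disk e -> enorm (y - e) <= 2.
Proof.
rewrite /unit_disk /disk /= !subr0 => y1 e1.
by apply: le_trans (enormB_le _ _) _; lra.
Qed.

Lemma reach_set_le s : reach_set phi s -> s <= M.
Proof.
move=> /(reach_setP B)[s0 h]; have e1 := on_circle10; set e := (1, 0) in e1.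
have [y By yE] : D (phi e + s *: n e + s *: n e).
  apply: (tangent_disk_sub B e1 s0 (h e e1)).
  by rewrite /disk /= addrAC subrr add0r enormZp ?(ltW s0)// n1// mulr1.
have := param_lip B (on_circle_disk e1) By; rewrite yE.
rewrite (_ : _ - _ = (2 * s) *: n e); last by apply: plane_eq; rewrite !coordE; ring.
rewrite enormZp ?mulr_ge0 ?(ltW s0)// n1// mulr1.
have := enorm_sub_disk By (on_circle_disk e1); have := M0; nra.
Qed.

Lemma reach_set_small : reach_set phi (m ^+ 2 / (3 * M)).
Proof.
apply/(reach_setP B); split; first by rewrite divr_gt0 ?exprn_gt0 ?mulr_gt0.
by move=> e; exact: (small_tangent_radius B).
Qed.

Lemma reach_set_has_sup : has_sup (reach_set phi).
Proof.
split; first by exists (m ^+ 2 / (3 * M)); exact: reach_set_small.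
by exists M => s; exact: reach_set_le.
Qed.

Lemma reach_ub s : reach_set phi s -> s <= rho.
Proof. by move=> h; apply: ub_le_sup => //; have [] := reach_set_has_sup. Qed.

Lemma reach_ge : m ^+ 2 / (3 * M) <= rho.
Proof. exact: reach_ub reach_set_small. Qed.

Lemma reach_gt0 : 0 < rho.
Proof. by apply: lt_le_trans reach_ge; rewrite divr_gt0 ?exprn_gt0 ?mulr_gt0. Qed.

Lemma reach_le : rho <= M.
Proof.
by apply: ge_sup; [have [] := reach_set_has_sup|move=> s; exact: reach_set_le].
Qed.

(** Each tangent disk inequality is a closed condition on the radius, so it
    passes to the supremum. *)
Lemma reach_tangent e : on_circle e -> tangent_radius phi rho e.
Proof.
move=> e1 e' e'1; set N := dot _ _.
have [N0|N0] := leP N 0.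
  apply: le_trans (_ : 0 <= _); last exact: sqr_ge0.
  by rewrite mulr_ge0_le0// mulr_ge0// ltW// reach_gt0.
rewrite mulrAC -ler_pdivlMl ?mulr_gt0//.
apply: ge_sup; first by have [] := reach_set_has_sup.
move=> s /(reach_setP B)[s0 /(_ e e1 e' e'1)]; rewrite -/N mulrAC.
by rewrite -ler_pdivlMl ?mulr_gt0.
Qed.

Lemma reach_tangent_le t e : on_circle e -> 0 <= t <= rho -> tangent_radius phi t e.
Proof.
move=> e1 /andP[t0 tr] e' e'1; have := reach_tangent e1 e'1.
set N := dot _ _; set q := _ ^+ 2 => h; have q0 : 0 <= q by exact: sqr_ge0.
by have [N0|N0] := leP N 0; nra.
Qed.

Lemma bdist_le x e : on_circle e -> boundary_dist D x <= enorm (x - phi e).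
Proof.
move=> e1; apply: ge_inf; first by exists 0 => _ [y _ <-]; exact: enorm_ge0.
by exists (phi e) => //; exact: (boundaryP B).
Qed.

Lemma bdist_ge x t : (forall e, on_circle e -> t <= enorm (x - phi e)) ->
  t <= boundary_dist D x.
Proof.
move=> h; apply: lb_le_inf.
  exists (enorm (x - phi (1, 0))), (phi (1, 0)) => //.
  exact: (boundaryP B on_circle10).
move=> _ [y + <-]; rewrite /D /image_disk (domain_boundary B) => -[e e1 <-].
exact: h.
Qed.

Lemma bdist_ge0 x : 0 <= boundary_dist D x.
Proof. by apply: bdist_ge => e _; exact: enorm_ge0. Qed.

Lemma bdist_attained x :
  exists2 e, on_circle e & boundary_dist D x = enorm (x - phi e).
Proof.
have [||e] := @compact_EVT_min _ R (fun e => enorm (x - phi e)) (@on_circle R)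
  _ (@on_circle_compact R).
- by exists (1, 0); exact: on_circle10.
- apply: continuous_in_subspaceT => e; rewrite inE => e1.
  apply: cvg_enorm; apply: cvgB; first exact: cvg_cst.
  by apply: (param_continuous B); exact: on_circle_disk.
rewrite inE => e1 emin; exists e => //.
apply/eqP; rewrite eq_le bdist_le//=; apply: bdist_ge => e' e'1.
by apply: emin; rewrite inE.
Qed.

Lemma bdist_disk x : D x -> disk x (boundary_dist D x) `<=` D.
Proof.
move=> Dx; have clD : closed D by exact: (domain_closed B).
have [d0|d0] := leP (boundary_dist D x) 0.
  move=> y; rewrite /disk /= => h.
  suff -> : y = x by [].
  apply/eqP; rewrite -subr_eq0; apply/eqP/enorm0_eq0/eqP.
  by rewrite eq_le enorm_ge0 andbT (le_trans h).
apply: open_disk_subset => // y yx; apply: (@segment_inside _ _ x) => // s /andP[s0 s1].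
rewrite /D /image_disk (domain_boundary B) => -[e e1 E].
have := bdist_le x e1; rewrite E leNgt => /negP; apply.
rewrite opprD addrA subrr add0r enormN enormZp//; apply: le_lt_trans yx.
by rewrite ler_piMl ?enorm_ge0.
Qed.

(** The disk about [x] through a nearest boundary point lies in the domain, so
    its center is on the inward normal at that point. *)
Lemma normal_coordinates x : D x ->
  exists2 e, on_circle e & x = phi e + boundary_dist D x *: n e.
Proof.
move=> Dx; have [e e1 dE] := bdist_attained x; exists e => //.
have [d0|d0] := leP (boundary_dist D x) 0.
  have {}d0 : boundary_dist D x = 0 by apply/eqP; rewrite eq_le d0 bdist_ge0.
  rewrite d0 scale0r addr0; apply/eqP; rewrite -subr_eq0; apply/eqP/enorm0_eq0.
  by rewrite -dE.
apply: (inscribed_center B e1 d0); last exact: bdist_disk.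
by rewrite /circle /= enormB.
Qed.

(** The tangent disk of radius [t] at [phi e] keeps the whole boundary at distance
    [t] from its center. *)
Lemma bdist_normal e t : on_circle e -> 0 <= t <= rho ->
  boundary_dist D (phi e + t *: n e) = t.
Proof.
move=> e1 t01; have t0 : 0 <= t by case/andP: t01.
apply/eqP; rewrite eq_le; apply/andP; split.
  apply: le_trans (bdist_le _ e1) _.
  by rewrite addrAC subrr add0r enormZp// n1// mulr1.
apply: bdist_ge => e' e'1; rewrite enormB.
by move: e' e'1; apply/(tangent_radiusP B e1 t0); exact: reach_tangent_le.
Qed.

Lemma normal_mem e t : on_circle e -> 0 <= t <= rho -> D (phi e + t *: n e).
Proof.
move=> e1 /andP[]; rewrite le_eqVlt => /predU1P[<- _|t0 tr].
  by rewrite scale0r addr0; exact: (domain_mem phi).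
have t01 : 0 <= t <= rho by rewrite (ltW t0).
apply: (tangent_disk_sub B e1 t0 (reach_tangent_le e1 t01)).
by rewrite /disk /= subrr enorm0 ltW.
Qed.

(** Adding the two tangent disk inequalities shows that the normals cannot
    converge faster than at rate [rho^-1]; so the nearest point projection is
    Lipschitz at depth less than the reach. *)
Lemma foot_lipschitz e e' t t' : on_circle e -> on_circle e' -> 0 <= t -> 0 <= t' ->
  enorm (phi e' - phi e) * (1 - (t + t') / (2 * rho)) <=
  enorm ((phi e + t *: n e) - (phi e' + t' *: n e')).
Proof.
move=> e1 e'1 t0 t'0; have r0 := reach_gt0.
have h := reach_tangent e1 e'1; have h' := reach_tangent e'1 e1.
rewrite -/(n e) in h; rewrite -/(n e') (enormB (phi e)) in h'.
set X := (_ - (_ + _)); set q := phi e' - phi e in h h' *.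
have qE : phi e - phi e' = - q by rewrite opprB.
have [->|q0] := pselect (q = 0); first by rewrite enorm0 mul0r enorm_ge0.
have {}q0 := enorm_gt0 q0.
rewrite -(ler_pM2l q0).
have XE : X = - q + (t *: n e - t' *: n e').
  by rewrite /X -qE; apply: plane_eq; rewrite !coordE; ring.
have k1 : - dot q X <= enorm q * enorm X by have := dot_geN q X; lra.
rewrite qE dotNl in h'; clearbody X; clearbody q.
apply: le_trans k1; rewrite XE dotDr dotNr dotDr dotNr opprD opprK -enorm2.
rewrite [dot q (t *: _)]dotZr [dot q (t' *: _)]dotZr.
set N := dot q (n e) in h *; set N' := dot q (n e') in h' *.
have i1 : t * N <= t * (enorm q ^+ 2 / (2 * rho)).
  by rewrite ler_wpM2l// ler_pdivlMr ?mulr_gt0// mulrC.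
have i2 : - (t' * N') <= t' * (enorm q ^+ 2 / (2 * rho)).
  by rewrite -mulrN ler_wpM2l// ler_pdivlMr ?mulr_gt0// mulrC.
have -> : enorm q * (enorm q * (1 - (t + t') / (2 * rho))) =
    enorm q ^+ 2 - (t * (enorm q ^+ 2 / (2 * rho)) + t' * (enorm q ^+ 2 / (2 * rho))).
  by field; rewrite gt_eqF.
lra.
Qed.

Lemma normal_coordinates_inj e e' t : on_circle e -> on_circle e' -> 0 <= t < rho ->
  phi e + t *: n e = phi e' + t *: n e' -> e = e'.
Proof.
move=> e1 e'1 /andP[t0 tr] E; have r0 := reach_gt0.
have := foot_lipschitz e1 e'1 t0 t0; rewrite E subrr enorm0.
rewrite pmulr_lle0; last first.
  rewrite subr_gt0 ltr_pdivrMr ?mulr_gt0//; lra.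
move=> h; have := pb_inj B (on_circle_disk e'1) (on_circle_disk e1) => k.
have : m * enorm (e' - e) <= 0 by lra.
rewrite pmulr_rle0// => k'; apply/esym/eqP; rewrite -subr_eq0; apply/eqP/enorm0_eq0.
by apply/eqP; rewrite eq_le k' enorm_ge0.
Qed.

(** * The half domain as a Jordan domain *)

(** At depth [t] in a domain of reach [r], the shift towards the interior: the
    depths from 0 to [3 r / 4] are mapped affinely onto those from [r / 2] to
    [3 r / 4], and larger depths are left alone, which keeps away from depth
    [r], where the normals may meet. *)
Definition offset (r t : R) := Num.max 0 (r / 2 - 2 / 3 * t).

(** A parameter of a nearest boundary point. It is unique at depth less than the
    reach, in particular wherever [push] moves the point. *)
Definition foot x := xget 0 [set e | on_circle e /\ x = phi e + boundary_dist D x *: n e].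

Lemma footP x : D x ->
  on_circle (foot x) /\ x = phi (foot x) + boundary_dist D x *: n (foot x).
Proof.
move=> /normal_coordinates[e e1 xE]; rewrite /foot.
by case: xgetP => [y _ //|/(_ e)]; elim.
Qed.

Definition push x := x + offset rho (boundary_dist D x) *: n (foot x).

Definition depth (t : R) := t + offset rho t.

Lemma depth_far t : 3 / 4 * rho <= t -> depth t = t.
Proof.
by move=> h; rewrite /depth /offset max_l ?addr0//; have := reach_gt0; lra.
Qed.

Lemma depth_near t : t <= 3 / 4 * rho -> depth t = rho / 2 + t / 3.
Proof.
move=> h; rewrite /depth /offset max_r; last by have := reach_gt0; lra.
by lra.
Qed.

Lemma depth_inj t t' : depth t = depth t' -> t = t'.
Proof.
have [h|h] := leP (3 / 4 * rho) t; have [h'|h'] := leP (3 / 4 * rho) t'.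
- by rewrite !depth_far.
- by rewrite (depth_far h) (depth_near (ltW h')); lra.
- by rewrite (depth_near (ltW h)) (depth_far h'); lra.
- by rewrite (depth_near (ltW h)) (depth_near (ltW h')); lra.
Qed.

Lemma pushE x : D x -> push x = phi (foot x) + depth (boundary_dist D x) *: n (foot x).
Proof.
by move=> Dx; rewrite /push {1}(footP Dx).2 -addrA -scalerDl.
Qed.

Lemma push_far x : 3 / 4 * rho <= boundary_dist D x -> push x = x.
Proof.
move=> h; rewrite /push /offset max_l ?scale0r ?addr0//.
by have := reach_gt0; lra.
Qed.

Lemma bdist_push x : D x -> boundary_dist D (push x) = depth (boundary_dist D x).
Proof.
move=> Dx; have [h|h] := leP (3 / 4 * rho) (boundary_dist D x).
  by rewrite push_far// depth_far.
rewrite pushE// bdist_normal//; first by have [] := footP Dx.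
have := bdist_ge0 x; have := reach_gt0.
rewrite (depth_near (ltW h)) => ? ?; apply/andP; split; lra.
Qed.

Lemma push_mem x : D x -> D (push x).
Proof.
move=> Dx; have [h|h] := leP (3 / 4 * rho) (boundary_dist D x).
  by rewrite push_far.
rewrite pushE//; apply: normal_mem; first by have [] := footP Dx.
have := bdist_ge0 x; have := reach_gt0.
rewrite (depth_near (ltW h)) => ? ?; apply/andP; split; lra.
Qed.

Lemma push_inj : {in D &, injective push}.
Proof.
move=> x y; rewrite !inE => Dx Dy E.
have dE : boundary_dist D x = boundary_dist D y.
  by apply: depth_inj; rewrite -(bdist_push Dx) -(bdist_push Dy) E.
have [h|h] := leP (3 / 4 * rho) (boundary_dist D x).
  have h' : 3 / 4 * rho <= boundary_dist D y by rewrite -dE.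
  by rewrite (push_far h) (push_far h') in E.
have [fx xE] := footP Dx; have [fy yE] := footP Dy.
rewrite xE yE -dE; suff -> : foot x = foot y by [].
have tr : 0 <= depth (boundary_dist D x) < rho.
  have := bdist_ge0 x; have := reach_gt0.
  rewrite (depth_near (ltW h)) => ? ?; apply/andP; split; lra.
apply: (normal_coordinates_inj fx fy tr).
by rewrite -(pushE Dx) E (pushE Dy) dE.
Qed.

Lemma push_image : push @` D = half_domain D.
Proof.
have r0 := reach_gt0.
apply/seteqP; split => [_ [x Dx <-]|y [Dy /= dy]].
  split; first exact: push_mem.
  rewrite /= bdist_push// -/rho /depth /offset; have := bdist_ge0 x.
  have [h|h] := leP (rho / 2 - 2 / 3 * boundary_dist D x) 0; lra.
rewrite -/rho in dy.
have [h|h] := leP (3 / 4 * rho) (boundary_dist D y).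
  by exists y => //; exact: push_far.
have [e e1 yE] := normal_coordinates Dy.
(* the depth sent by [depth] to that of [y] *)
pose t := 3 * (boundary_dist D y - rho / 2).
have t01 : 0 <= t <= rho by rewrite /t; apply/andP; split; lra.
have Dx := normal_mem e1 t01; have dx := bdist_normal e1 t01.
exists (phi e + t *: n e) => //; rewrite pushE// dx.
have [f1 fE] := footP Dx.
have tr : 0 <= t < rho by rewrite /t; apply/andP; split; lra.
have <- : e = foot (phi e + t *: n e).
  by apply: (normal_coordinates_inj e1 f1 tr); rewrite [LHS]fE dx.
rewrite depth_near; last by rewrite /t; lra.
by rewrite [RHS]yE; congr (_ + _ *: _); rewrite /t; lra.
Qed.

End reach.

(** * The half domain depends continuously on the domain *)

Section perturbation.
Context {R : realType}.
Implicit Types (phi psi : plane R -> plane R) (x y e : plane R).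
Implicit Types (m M d t : R).

Lemma C2_close_sym d phi psi : C2_close d phi psi -> C2_close d psi phi.
Proof.
move=> cl x /cl[c0 c1 c2]; split; first by rewrite enormB.
  by move=> v v1; rewrite enormB; exact: c1.
by move=> v w v1 w1; rewrite enormB; exact: c2.
Qed.

(** A Lipschitz constant of the inward normal with respect to the derivatives. *)
Definition normal_modulus m M : R := 4 / m + 8 * M / m ^+ 2.

Lemma normal_modulus_gt0 m M : 0 < m -> 0 < M -> 0 < normal_modulus m M.
Proof.
by move=> m0 M0; rewrite addr_gt0 ?divr_gt0 ?mulr_gt0 ?exprn_gt0.
Qed.

(** A Lipschitz constant of the reach with respect to the [C^2] distance. *)
Definition reach_modulus m M : R :=
  M * ((2 * M + 4 * M * (1 + M * normal_modulus m M)) / m ^+ 2).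

Section pair.
Variables (m M d : R) (phi psi : plane R -> plane R).
Hypotheses (B : param_bounds m M phi) (B' : param_bounds m M psi).
Hypothesis cl : C2_close d phi psi.

Let m0 := pb_m B.
Let M0 := pb_M B.
Let K := normal_modulus m M.
Let K0 : 0 < K := normal_modulus_gt0 m0 M0.
Let n := inner_normal phi.
Let n' := inner_normal psi.
Let rho := reach (image_disk phi).
Let rho' := reach (image_disk psi).

Lemma C2_close_gt0 : 0 < d.
Proof.
have [c0 _ _] := cl (on_circle_disk (@on_circle10 R)).
exact: le_lt_trans (enorm_ge0 _) c0.
Qed.

Let d0 := C2_close_gt0.

Lemma close_increment a b : unit_disk a -> unit_disk b ->
  enorm ((phi b - phi a) - (psi b - psi a)) <= d * enorm (b - a).
Proof.
move=> Ba Bb; rewrite subrACA.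
apply: (increment_le (pb_C2 B) (pb_C2 B')) => // x v Bx v1.
by have [_ c1 _] := C2_close_dd cl Bx; exact/ltW/c1.
Qed.

Lemma close_taylor a b : unit_disk a -> unit_disk b ->
  enorm ((phi b - phi a - dd phi (b - a) a) - (psi b - psi a - dd psi (b - a) a)) <=
  d * enorm (b - a) ^+ 2.
Proof.
move=> Ba Bb; apply: (taylor_remainder (pb_C2 B) (pb_C2 B')) => // x v w Bx v1 w1.
by have [_ _ c2] := C2_close_dd cl Bx; exact/ltW/c2.
Qed.

Lemma dot_sub_le (u v u' v' : plane R) : enorm v = 1 ->
  `|dot u v - dot u' v'| <= enorm (u - u') + enorm u' * enorm (v - v').
Proof.
move=> v1; have -> : dot u v - dot u' v' = dot (u - u') v + dot u' (v - v').
  by rewrite /dot !coordE; ring.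
rewrite (le_trans (ler_normD _ _))// lerD//; last exact: dot_normr.
by rewrite (le_trans (dot_normr _ _))// v1 mulr1.
Qed.

Lemma close_normal e : on_circle e -> enorm (n e - n' e) <= K * d.
Proof. exact: (inner_normal_close B B' cl). Qed.

(** The normal component of a chord and its squared length both vary by a
    fraction of the squared distance between the parameters; this is what
    the [C^2] topology controls, and what makes the reach continuous. *)
Lemma close_chord e e' : on_circle e -> on_circle e' ->
  `|dot (phi e' - phi e) (n e) - dot (psi e' - psi e) (n' e)| <=
  2 * (1 + M * K) * d * enorm (e' - e) ^+ 2.
Proof.
move=> e1 e'1; have Be := on_circle_disk e1; have Be' := on_circle_disk e'1.
rewrite (normal_expansion B)// (normal_expansion B')// dot_chord//.
set q := enorm (e' - e); have q0 : 0 <= q ^+ 2 by exact: sqr_ge0.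
have n1 := enorm_inner_normal B e1.
have nn := close_normal e1; rewrite /n /n' in nn.
have a1 : `|dot (dd phi e e) (inner_normal phi e) -
    dot (dd psi e e) (inner_normal psi e)| <= d + M * (K * d).
  apply: le_trans (dot_sub_le _ _ _ n1) _; apply: lerD.
    by have [_ c1 _] := C2_close_dd cl Be; exact/ltW/c1.
  have h : enorm (dd psi e e) <= M by have := dd_le B' e Be; rewrite e1 mulr1.
  by apply: ler_pM; rewrite ?enorm_ge0.
have a2 : `|normal_remainder phi e e' - normal_remainder psi e e'| <=
    d * q ^+ 2 + M * q ^+ 2 * (K * d).
  apply: le_trans (dot_sub_le _ _ _ n1) _; apply: lerD; first exact: close_taylor.
  by apply: ler_pM; rewrite ?enorm_ge0//; exact: (param_taylor B').
move: a1 a2; move: (dot (dd phi e e) _) (dot (dd psi e e) _)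
  (normal_remainder phi e e') (normal_remainder psi e e') => a a' r r'.
rewrite !ler_norml => /andP[a1 a2] /andP[a3 a4].
apply/andP; split; nra.
Qed.

Lemma close_chord_sqr e e' : on_circle e -> on_circle e' ->
  `|enorm (phi e' - phi e) ^+ 2 - enorm (psi e' - psi e) ^+ 2| <=
  2 * M * d * enorm (e' - e) ^+ 2.
Proof.
move=> e1 e'1; have Be := on_circle_disk e1; have Be' := on_circle_disk e'1.
have k1 := param_lip B Be Be'; have k2 := param_lip B' Be Be'.
have k3 := close_increment Be Be'.
have k4 := enormBl (phi e' - phi e) (psi e' - psi e).
have k5 := enormBl (psi e' - psi e) (phi e' - phi e).
rewrite (enormB (psi e' - psi e)) in k5.
have := enorm_ge0 (phi e' - phi e); have := enorm_ge0 (psi e' - psi e).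
move: k1 k2 (le_trans k4 k3) (le_trans k5 k3).
move: (enorm (phi e' - phi e)) (enorm (psi e' - psi e)) (enorm (e' - e)) => a b c.
move=> k1 k2 {}k4 {}k5 a0 b0.
have ab : `|a - b| <= d * c by rewrite ler_norml; apply/andP; split; lra.
rewrite subr_sqr normrM [`|a + b|]ger0_norm ?addr_ge0//.
have -> : 2 * M * d * c ^+ 2 = (d * c) * (2 * M * c) by ring.
by apply: ler_pM; rewrite ?addr_ge0//; lra.
Qed.

(** Both sides of a tangent disk inequality for [phi] change by at most a
    multiple of [d] times the squared chord, which is absorbed by shrinking the
    radius by the factor [1 + C * d]. *)
Lemma reach_close_le : rho <= rho' + reach_modulus m M * d.
Proof.
pose C := (2 * M + 4 * M * (1 + M * K)) / m ^+ 2.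
have C0 : 0 < C.
  by rewrite /C divr_gt0 ?exprn_gt0// addr_gt0 ?mulr_gt0// addr_gt0// mulr_gt0.
have r0 := reach_gt0 B; have rM := reach_le B; have r'M := reach_le B'.
have Cd : 0 < 1 + C * d by rewrite addr_gt0// mulr_gt0// d0.
suff h : rho / (1 + C * d) <= rho'.
  move: h; rewrite ler_pdivrMr// => h.
  have : C * d * rho' <= C * d * M by rewrite ler_pM2l// mulr_gt0// d0.
  by rewrite /reach_modulus -/K -/C; lra.
apply: (reach_ub B'); apply/(reach_setP B'); split; first by rewrite divr_gt0.
move=> e e1 e' e'1; have Be := on_circle_disk e1; have Be' := on_circle_disk e'1.
have t1 := reach_tangent B e1 e'1; rewrite -/(image_disk phi) -/rho -/(n e) in t1.
have := close_chord e1 e'1; rewrite ler_norml => /andP[t2 _].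
have := close_chord_sqr e1 e'1; rewrite ler_norml => /andP[_ t3].
have t4 := enorm_param_ge B' Be' Be.
rewrite ler_pdivlMr ?exprn_gt0// in t4.
rewrite -/(n' e); move: t1 t2 t3 t4.
move: (dot (phi e' - phi e) _) (dot (psi e' - psi e) _) => N N'.
move: (enorm (phi e' - phi e) ^+ 2) (enorm (psi e' - psi e) ^+ 2) => a b.
have : 0 <= enorm (e' - e) ^+ 2 by exact: sqr_ge0.
move: (enorm (e' - e) ^+ 2) => q q0 t1 t2 t3 t4.
have -> : 2 * (rho / (1 + C * d)) * N' = rho * (2 * N') / (1 + C * d) by ring.
rewrite ler_pdivrMr//.
have u1 : rho * (2 * N') <= a + 4 * M * (1 + M * K) * d * q.
  have : 2 * rho * (N' - N) <= 2 * M * (2 * (1 + M * K) * d * q).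
    apply: (@le_trans _ _ (2 * rho * (2 * (1 + M * K) * d * q))).
      by rewrite ler_wpM2l ?mulr_ge0 ?(ltW r0)//; lra.
    by rewrite ler_wpM2r ?mulr_ge0 ?addr_ge0 ?mulr_ge0 ?(ltW d0) ?(ltW K0) ?(ltW M0)// ler_wpM2l.
  lra.
have u2 : (2 * M + 4 * M * (1 + M * K)) * d * q <= b * (C * d).
  have -> : b * (C * d) = (2 * M + 4 * M * (1 + M * K)) * d * (b / m ^+ 2).
    by rewrite /C; field; rewrite gt_eqF.
  rewrite ler_wpM2l//; first by rewrite mulr_ge0 ?(ltW d0)// addr_ge0 ?mulr_ge0 ?addr_ge0 ?mulr_ge0 ?(ltW K0) ?(ltW M0).
  by rewrite ler_pdivlMr ?exprn_gt0.
lra.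
Qed.

Lemma bdist_close_le x x' :
  boundary_dist (image_disk phi) x <= boundary_dist (image_disk psi) x' + (enorm (x - x') + d).
Proof.
have [e e1 ->] := bdist_attained B' x'.
apply: le_trans (bdist_le B x e1) _.
have [c0 _ _] := cl (on_circle_disk e1); rewrite enormB in c0.
have := enorm_triB x x' (phi e); have := enorm_triB x' (psi e) (phi e); lra.
Qed.

End pair.

Section push_continuity.
Variables (m M : R).

(** The shift is Lipschitz in the reach and in the depth. Where it does not
    vanish the depth is at most [3 rho / 4], so there the foot, and with it the
    normal, is Lipschitz as well. That the constants only depend on the bounds
    gives both the continuity of one push and the continuous dependence of the
    half domain on the domain. *)
Lemma push_close : 0 < m -> 0 < M -> exists C h : R, [/\ 0 < C, 0 < h &
  forall phi psi d x x', param_bounds m M phi -> param_bounds m M psi ->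
    C2_close d phi psi -> image_disk phi x -> image_disk psi x' ->
    enorm (x - x') + d <= h ->
    enorm (push phi x - push psi x') <= C * (enorm (x - x') + d)].
Proof.
move=> m0 M0; pose K := normal_modulus m M; pose Cr := reach_modulus m M.
have K0 : 0 < K := normal_modulus_gt0 m0 M0.
have Cr0 : 0 < Cr.
  rewrite /Cr /reach_modulus mulr_gt0// divr_gt0 ?exprn_gt0//.
  by rewrite addr_gt0 ?mulr_gt0// addr_gt0// mulr_gt0.
(* [Cq] bounds the distance between the boundary points, [Cn] that between the
   normals *)
pose Cq := 8 * (1 + M * K).
pose Cn := K * (2 * M * (Cq / m)) + K.
have Cq0 : 0 < Cq by rewrite mulr_gt0// addr_gt0// mulr_gt0.
have Cqm : 0 < Cq / m by rewrite divr_gt0.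
have Cn0 : 0 < Cn.
  by rewrite /Cn addr_gt0// mulr_gt0// (mulr_gt0 (mulr_gt0 _ M0) Cqm).
pose h := m ^+ 2 / (3 * M) / 4.
exists (1 + (Cr + 1) + M * Cn), h; split.
- by rewrite !addr_gt0// mulr_gt0.
- by rewrite /h !divr_gt0 ?exprn_gt0 ?mulr_gt0.
move=> phi psi d x x' B B' cl Dx Dx' hh.
have d0 := C2_close_gt0 cl; have cl' := C2_close_sym cl.
set H := enorm (x - x') + d in hh *.
have xx0 := enorm_ge0 (x - x').
have dH : d <= H by rewrite /H; lra.
have H0 : 0 < H by rewrite /H; lra.
pose rho := reach (image_disk phi); pose rho' := reach (image_disk psi).
pose t := boundary_dist (image_disk phi) x.
pose t' := boundary_dist (image_disk psi) x'.
have r1 : rho <= rho' + Cr * d := reach_close_le B B' cl.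
have r2 : rho' <= rho + Cr * d := reach_close_le B' B cl'.
have t1 : t <= t' + H := bdist_close_le B B' cl x x'.
have t2 : t' <= t + H.
  by have := bdist_close_le B' B cl' x' x; rewrite (enormB x').
have rM : rho <= M := reach_le B.
have rm : m ^+ 2 / (3 * M) <= rho := reach_ge B.
have rM' : rho' <= M := reach_le B'.
have r0 : 0 < rho := reach_gt0 B.
have t0 : 0 <= t := bdist_ge0 B x.
have t'0 : 0 <= t' := bdist_ge0 B' x'.
have hr : H <= rho / 4 by rewrite /h in hh; lra.
have CrdH : Cr * d <= Cr * H by rewrite ler_pM2l.
have ss : `|offset rho t - offset rho' t'| <= (Cr + 1) * H.
  have CrH : 0 <= Cr * H by rewrite mulr_ge0 ?(ltW H0) ?(ltW Cr0).
  rewrite /offset ler_norml.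
  by have [?|?] := leP (rho / 2 - 2 / 3 * t) 0;
     have [?|?] := leP (rho' / 2 - 2 / 3 * t') 0; apply/andP; split; lra.
have [e1 xE] := footP B Dx; have [e'1 xE'] := footP B' Dx'.
rewrite -/t in xE; rewrite -/t' in xE'.
set e := foot phi x in e1 xE; set e' := foot psi x' in e'1 xE'.
have Be := on_circle_disk e1; have Be' := on_circle_disk e'1.
rewrite /push -/e -/e' -/rho -/rho' -/t -/t'.
have n1' := enorm_inner_normal B' e'1.
have s0 : 0 <= offset rho t by rewrite le_max lexx.
have key : offset rho t * enorm (inner_normal phi e - inner_normal psi e') <= M * (Cn * H).
  have [far|near] := leP (3 / 4 * rho) t.
    rewrite /offset max_l ?mul0r; last by lra.
    by rewrite !mulr_ge0 ?(ltW M0) ?(ltW Cn0) ?(ltW H0).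
  apply: ler_pM; rewrite ?enorm_ge0//.
    by rewrite ge_max (ltW M0)/=; lra.
  have nn' := close_normal B B' cl e'1.
  have c0 : enorm (phi e' - psi e') <= d.
    by have [c _ _] := cl _ Be'; exact: ltW.
  (* [foot_lipschitz] compares two points of the same domain: [x''] is the
     point with the coordinates of [x'], in the domain of [phi] *)
  pose x'' := phi e' + t' *: inner_normal phi e'.
  have x''x' : enorm (x' - x'') <= d + M * (K * d).
    have -> : x' - x'' = (psi e' - phi e') + t' *: (inner_normal psi e' - inner_normal phi e').
      by rewrite {1}xE' /x''; apply: plane_eq; rewrite !coordE; ring.
    apply: le_trans (enormD _ _) _; rewrite enormZp//.
    rewrite enormB (enormB (inner_normal psi e')); apply: lerD => //.
    apply: ler_pM; rewrite ?enorm_ge0//; lra.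
  have xx'' : enorm (x - x'') <= (1 + M * K) * H.
    have := enorm_triB x x' x''.
    have : M * K * d <= M * K * H by rewrite ler_pM2l// mulr_gt0.
    by rewrite /H; lra.
  have ft := foot_lipschitz B e1 e'1 t0 t'0.
  rewrite -xE -/x'' -/(image_disk phi) -/rho in ft.
  have {}ft : enorm (phi e' - phi e) <= Cq * H.
    have k : 8^-1 <= 1 - (t + t') / (2 * rho).
      rewrite lerBrDr -lerBrDl ler_pdivrMr ?mulr_gt0//; lra.
    have := enorm_ge0 (phi e' - phi e); rewrite /Cq; nra.
  have ee : enorm (e - e') <= Cq / m * H.
    rewrite mulrAC ler_pdivlMr// mulrC enormB.
    by apply: le_trans ft; exact: (pb_inj B).
  have k1 := inner_normal_lip B e1 e'1; rewrite -/(normal_modulus m M) -/K in k1.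
  have k2 := enorm_triB (inner_normal phi e) (inner_normal phi e') (inner_normal psi e').
  have k3 : K * (2 * M * enorm (e - e')) <= K * (2 * M * (Cq / m * H)).
    by rewrite ler_pM2l// ler_pM2l// mulr_gt0.
  have k4 : K * d <= K * H by rewrite ler_pM2l.
  have -> : Cn * H = K * (2 * M * (Cq / m * H)) + K * H by rewrite /Cn; ring.
  by rewrite -/K in nn'; move: k2 k1 k3 nn' k4; clear; lra.
rewrite (_ : _ - _ = (x - x') + (offset rho t *: (inner_normal phi e - inner_normal psi e') +
   (offset rho t - offset rho' t') *: inner_normal psi e')); last first.
  by apply: plane_eq; rewrite !coordE; ring.
apply: le_trans (enormD _ _) _.
have := enormD (offset rho t *: (inner_normal phi e - inner_normal psi e'))
  ((offset rho t - offset rho' t') *: inner_normal psi e').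
rewrite enormZp// [enorm (_ *: inner_normal psi e')]enormZ n1' mulr1.
by move: H0; rewrite /H in key ss *; lra.
Qed.

End push_continuity.

End perturbation.

(** * The half domain as a map between spaces of domains *)

Section half_jordan.
Context {R : realType}.
Implicit Types (D : C2_domain R) (phi psi : plane R -> plane R) (x y : plane R).

Lemma C2_domain_bounds D : exists phi m M,
  [/\ C2_embedding phi, C2_set D = image_disk phi & param_bounds m M phi].
Proof.
have [phi Ephi DE] := C2_setP D; have [m [M B]] := embedding_bounds Ephi.
by exists phi, m, M.
Qed.

Lemma C2_close_refl phi d : 0 < d -> C2_close d phi phi.
Proof.
move=> d0 x _; split; first by rewrite subrr enorm0.
  by move=> v _; rewrite subrr enorm0.
by move=> v w _ _; rewrite subrr enorm0.
Qed.

Lemma push_jordan m M phi : param_bounds m M phi -> jordan_param (push phi \o phi).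
Proof.
move=> B; have [C [h [C0 h0 pc]]] := push_close (pb_m B) (pb_M B).
have mem y : unit_disk y -> image_disk phi (phi y) by move=> By; exists y.
split; last first.
  move=> x y; rewrite !inE => Bx By /= E.
  have : phi x = phi y.
    have mem' z : unit_disk z -> phi z \in image_disk phi by rewrite inE; exact: mem.
    exact: (push_inj B (mem' x Bx) (mem' y By) E).
  move=> /eqP; rewrite -subr_eq0 => /eqP E'.
  have := pb_inj B Bx By; rewrite E' enorm0 pmulr_rle0; last exact: (pb_m B).
  move=> k; apply/eqP; rewrite -subr_eq0; apply/eqP/enorm0_eq0/eqP.
  by rewrite eq_le k enorm_ge0.
apply/subspace_continuousP => x Bx; apply/cvg_enormP => e e0.
pose d := Num.min h (e / (2 * C)) / 2.
have d0 : 0 < d by rewrite divr_gt0// lt_min h0 divr_gt0// mulr_gt0.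
have dh : 2 * d <= h by rewrite /d mulrC divfK// ge_min lexx.
have de : C * (2 * d) <= e / 2.
  have : 2 * d <= e / (2 * C) by rewrite /d mulrC divfK// ge_min lexx orbT.
  rewrite ler_pdivlMr ?mulr_gt0//; lra.
have := (@cvg_enormP R _ (nbhs x) (nbhs_filter x) phi (phi x)).1 (param_continuous B Bx) d d0.
rewrite /within /=; apply: filterS => y xy By.
have := pc phi phi d (phi y) (phi x) B B (C2_close_refl _ d0) (mem y By) (mem x Bx).
have hd : enorm (phi y - phi x) + d <= 2 * d by lra.
move=> /(_ (le_trans hd dh)) k; apply: le_lt_trans k _.
have : C * (enorm (phi y - phi x) + d) <= C * (2 * d) by rewrite ler_pM2l.
lra.
Qed.

Lemma push_param_image m M phi : param_bounds m M phi ->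
  half_domain (image_disk phi) = (push phi \o phi) @` @unit_disk R.
Proof. by move=> B; rewrite -(push_image B) /image_disk image_comp. Qed.

Lemma half_jordanP D : exists2 psi, jordan_param psi &
  half_domain D = psi @` @unit_disk R.
Proof.
have [phi [m [M [_ DE B]]]] := C2_domain_bounds D.
by exists (push phi \o phi); [exact: push_jordan B|rewrite DE; exact: push_param_image B].
Qed.

Definition half_jordan D : jordan_domain R := JordanDomain (half_jordanP D).

(** The pushed parametrization of the half domain is [C^0] close when the
    parametrization of the domain is [C^2] close. *)
Lemma half_jordan_continuous : continuous half_jordan.
Proof.
apply/continuousP => U oU; rewrite [open _]/(C2_open _) => D phi UD Ephi DE.
have [m [M B]] := embedding_bounds Ephi.
have m0 := pb_m B; have M0 := pb_M B.
have D0 : half_domain D = (push phi \o phi) @` @unit_disk R.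
  by rewrite DE; exact: push_param_image B.
have oU' : jordan_open U by [].
have [e e0 eU] := oU' (half_jordan D) _ UD (push_jordan B) D0.
have m20 : 0 < m / 2 by rewrite divr_gt0.
have M20 : 0 < 2 * M by rewrite mulr_gt0.
have [C [h [C0 h0 pc]]] := push_close m20 M20.
pose d := Num.min (Num.min (m / 2) M) (Num.min h (e / (2 * C)) / 2).
have d0 : 0 < d by rewrite !lt_min m20 M0 divr_gt0// lt_min h0 divr_gt0// mulr_gt0.
have dm : d <= m / 2 by rewrite /d !ge_min lexx.
have dM : d <= M by rewrite /d !ge_min lexx !orbT.
have dd2 : 2 * d <= Num.min h (e / (2 * C)).
  by rewrite mulrC -ler_pdivlMr// /d ge_min lexx orbT.
have dh : 2 * d <= h by rewrite (le_trans dd2)// ge_min lexx.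
have de : C * (2 * d) <= e / 2.
  have : 2 * d <= e / (2 * C) by rewrite (le_trans dd2)// ge_min lexx orbT.
  rewrite ler_pdivlMr ?mulr_gt0//; lra.
exists d => // D' psi Epsi D'E cl.
have Bphi := param_bounds_close B (pb_C2 B) dm dM (C2_close_refl phi d0).
have [Cpsi _ _] := Epsi.
have Bpsi := param_bounds_close B Cpsi dm dM cl.
apply: (eU (half_jordan D') (push psi \o psi) (push_jordan Bpsi)).
  by rewrite /= D'E; exact: push_param_image Bpsi.
move=> y By; rewrite /=.
have [c0 _ _] := cl y By.
have := pc phi psi d (phi y) (psi y) Bphi Bpsi cl.
have hd : enorm (phi y - psi y) + d <= 2 * d by lra.
move=> k; apply: le_lt_trans (k _ _ (le_trans hd dh)) _; [by exists y|by exists y|].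
have : C * (enorm (phi y - psi y) + d) <= C * (2 * d) by rewrite ler_pM2l.
lra.
Qed.

Lemma half_domain_interior D : half_domain D `<=` interior D.
Proof.
have [phi [m [M [_ -> B]]]] := C2_domain_bounds D => x [[y By <-] /= dx].
apply: (param_interior B); rewrite ltNge; apply/negP => y1.
have {}y1 : on_circle y.
  by apply/eqP; rewrite eq_le y1; move: By; rewrite /unit_disk /disk /= subr0 => ->.
have := bdist_le B (phi y) y1; rewrite subrr enorm0.
have := reach_gt0 B; lra.
Qed.

End half_jordan.

(** * Conformal equivariance of the half domain *)

Section conformal_maps.
Context {R : realType}.
Implicit Types (D : set (plane R)) (x y p c : plane R) (s t : R).

Lemma sup_scale (A : set R) s : 0 < s -> has_sup A ->
  sup [set s * a | a in A] = s * sup A.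
Proof.
move=> s0 [A0 Aub]; apply/eqP; rewrite eq_le; apply/andP; split.
  apply: ge_sup; first exact: image_nonempty.
  by move=> _ [a Aa <-]; rewrite ler_pM2l//; exact: ub_le_sup.
rewrite -ler_pdivlMl//; apply: ge_sup => // a Aa.
rewrite ler_pdivlMl//; apply: ub_le_sup; last by exists a.
have [k Ak] := Aub; exists (s * k) => _ [b Ab <-]; rewrite ler_pM2l//; exact: Ak.
Qed.

Lemma inf_scale (A : set R) s : 0 < s -> has_inf A ->
  inf [set s * a | a in A] = s * inf A.
Proof.
move=> s0 [A0 Alb]; apply/eqP; rewrite eq_le; apply/andP; split; last first.
  apply: lb_le_inf; first exact: image_nonempty.
  by move=> _ [a Aa <-]; rewrite ler_pM2l//; exact: ge_inf.
rewrite -ler_pdivrMl//; apply: lb_le_inf => // a Aa.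
rewrite ler_pdivrMl//; apply: ge_inf; last by exists a.
have [k Ak] := Alb; exists (s * k) => _ [b Ab <-]; rewrite ler_pM2l//; exact: Ak.
Qed.

Lemma boundaryE D p : boundary D p <-> forall e : R, 0 < e ->
  (exists2 x, D x & enorm (x - p) < e) /\ (exists2 x, ~ D x & enorm (x - p) < e).
Proof.
split => [[cp ip] e e0|h].
  have nb : nbhs p [set x | enorm (x - p) < e] by apply/nbhs_enormP; exists e.
  split; first by have [x [Dx xp]] := cp _ nb; exists x.
  apply: contrapT => nx; apply: ip; apply/nbhs_enormP; exists e => // y yp.
  by apply: contrapT => nDy; apply: nx; exists y.
split => [A /nbhs_enormP[e e0 eA]|/nbhs_enormP[e e0 eD]].
  by have [[x Dx xp] _] := h e e0; exists x; split => //; exact: eA.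
by have [_ [x nDx xp]] := h e e0; apply: nDx; exact: eD.
Qed.

Definition similarity (s : R) (g : plane R -> plane R) :=
  [/\ 0 < s, forall x y, enorm (g x - g y) = s * enorm (x - y) &
      forall y, exists x, g x = y].

Lemma conformal_similarity (g : plane R -> plane R) : conformal g ->
  exists s, similarity s g.
Proof.
move=> [s [A [b [s0 AA gE]]]]; exists s.
have entry i j : \sum_k A k i * A k j = (i == j)%:R.
  have := congr1 (fun X : 'M[R]_2 => X i j) AA; rewrite !mxE => <-.
  by apply: eq_bigr => k _; rewrite mxE.
have e00 := entry 0 0; have e01 := entry 0 1; have e11 := entry 1 1.
rewrite !big_ord_recl !big_ord0 /= !addr0 in e00 e01 e11.
rewrite (_ : lift ord0 ord0 = 1 :> 'I_2) in e00 e01 e11; last exact/val_inj.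
have AB x y : mx_act A x - mx_act A y = mx_act A (x - y).
  by apply: plane_eq; rewrite /mx_act !coordE /= ; ring.
have iso x : enorm (mx_act A x) = enorm x.
  rewrite /enorm /dot /mx_act /=; congr Num.sqrt.
  transitivity ((A 0 0 * A 0 0 + A 1 0 * A 1 0) * (x.1 * x.1) +
    2 * (A 0 0 * A 0 1 + A 1 0 * A 1 1) * (x.1 * x.2) +
    (A 0 1 * A 0 1 + A 1 1 * A 1 1) * (x.2 * x.2)); first ring.
  by rewrite e00 e01 e11 /=; ring.
have A'A : A *m A^T = 1%:M by exact: mulmx1C.
have entry' i j : \sum_k A i k * A j k = (i == j)%:R.
  have := congr1 (fun X : 'M[R]_2 => X i j) A'A; rewrite !mxE => <-.
  by apply: eq_bigr => k _; rewrite mxE.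
have f00 := entry' 0 0; have f01 := entry' 0 1; have f11 := entry' 1 1.
rewrite !big_ord_recl !big_ord0 /= !addr0 in f00 f01 f11.
rewrite (_ : lift ord0 ord0 = 1 :> 'I_2) in f00 f01 f11; last exact/val_inj.
split => // [x y|y].
  rewrite !gE (_ : _ - _ = s *: mx_act A (x - y)); last first.
    by rewrite -AB; apply: plane_eq; rewrite !coordE; ring.
  by rewrite enormZp ?(ltW s0)// iso.
have zE (z : plane R) : mx_act A (A 0 0 * z.1 + A 1 0 * z.2, A 0 1 * z.1 + A 1 1 * z.2) = z.
  apply: plane_eq; rewrite /mx_act /=.
    transitivity ((A 0 0 * A 0 0 + A 0 1 * A 0 1) * z.1 +
      (A 0 0 * A 1 0 + A 0 1 * A 1 1) * z.2); first ring.
    by rewrite f00 f01 /=; ring.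
  transitivity ((A 0 0 * A 1 0 + A 0 1 * A 1 1) * z.1 +
    (A 1 0 * A 1 0 + A 1 1 * A 1 1) * z.2); first ring.
  by rewrite f01 f11 /=; ring.
pose z := s^-1 *: (y - b).
exists (A 0 0 * z.1 + A 1 0 * z.2, A 0 1 * z.1 + A 1 1 * z.2).
by rewrite gE zE /z scalerA divff ?gt_eqF// scale1r subrK.
Qed.

Section similarity.
Variables (s : R) (g : plane R -> plane R).
Hypothesis sg : similarity s g.

Let s0 : 0 < s. Proof. by case: sg. Qed.
Let gd x y : enorm (g x - g y) = s * enorm (x - y). Proof. by case: sg. Qed.
Let gsurj y : exists x, g x = y. Proof. by case: sg. Qed.

Lemma similarity_inj : injective g.
Proof.
move=> x y E; have := gd x y; rewrite E subrr enorm0 => /esym/eqP.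
rewrite mulf_eq0 gt_eqF//= => /eqP/enorm0_eq0/eqP.
by rewrite subr_eq0 => /eqP.
Qed.

Lemma similarity_mem D x : (g @` D) (g x) <-> D x.
Proof. by split => [[y Dy /similarity_inj <-]|Dx]; [|exists x]. Qed.

Lemma similarity_boundary D p : boundary (g @` D) (g p) <-> boundary D p.
Proof.
rewrite !boundaryE; split => h e e0.
  have [[_ [x Dx <-] xp] [y nDy yp]] := h (s * e) (mulr_gt0 s0 e0).
  rewrite gd ltr_pM2l// in xp; split; first by exists x.
  have [z zE] := gsurj y; rewrite -zE gd ltr_pM2l// in yp; exists z => // Dz.
  by apply: nDy; rewrite -zE; exists z.
have se0 : 0 < e / s by rewrite divr_gt0.
have [[x Dx xp] [y nDy yp]] := h (e / s) se0.
rewrite ltr_pdivlMr// mulrC in xp; rewrite ltr_pdivlMr// mulrC in yp.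
by split; [exists (g x); [exists x|rewrite gd]|exists (g y); [move=> /similarity_mem|rewrite gd]].
Qed.

Lemma similarity_boundary_image D : boundary (g @` D) = g @` boundary D.
Proof.
apply/seteqP; split => [y|_ [x bx <-]]; last exact/similarity_boundary.
by have [x <-] := gsurj y => /similarity_boundary bx; exists x.
Qed.

Lemma similarity_circle c t x : circle (g c) (s * t) (g x) <-> circle c t x.
Proof.
rewrite /circle /= gd; split => [|->//]; apply: mulfI; exact: lt0r_neq0.
Qed.

Lemma similarity_reach_set D :
  [set t | 0 < t /\ forall p, boundary (g @` D) p ->
    exists2 c, circle c t p & circle c t `<=` g @` D] =
  [set s * t | t in [set t | 0 < t /\ forall p, boundary D p ->
    exists2 c, circle c t p & circle c t `<=` D]].
Proof.
apply/seteqP; split => [t [t0 h]|_ [t [t0 h] <-]].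
  have tE : s * (t / s) = t by rewrite mulrC divfK// gt_eqF.
  exists (t / s) => //; split; first by rewrite divr_gt0.
  move=> p bp; have [c' cp cD] := h (g p) ((similarity_boundary _ _).2 bp).
  have [c cE] := gsurj c'; rewrite -cE -tE in cp cD; exists c.
    exact/similarity_circle.
  by move=> x /similarity_circle /cD /similarity_mem.
split; first exact: mulr_gt0.
rewrite similarity_boundary_image => _ [p bp <-].
have [c cp cD] := h p bp; exists (g c); first exact/similarity_circle.
move=> y; have [x <-] := gsurj y => /similarity_circle /cD Dx.
by exists x.
Qed.

Lemma similarity_reach D : has_sup [set t | 0 < t /\ forall p, boundary D p ->
    exists2 c, circle c t p & circle c t `<=` D] ->
  reach (g @` D) = s * reach D.
Proof. by move=> h; rewrite /reach similarity_reach_set sup_scale. Qed.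

Lemma similarity_boundary_dist D x : boundary D !=set0 ->
  boundary_dist (g @` D) (g x) = s * boundary_dist D x.
Proof.
move=> [p bp]; rewrite /boundary_dist -inf_scale//; last first.
  split; first by exists (enorm (x - p)), p.
  by exists 0 => _ [y _ <-]; exact: enorm_ge0.
congr inf; rewrite similarity_boundary_image; apply/seteqP; split.
  by move=> _ [_ [y by_ <-] <-]; exists (enorm (x - y)); [exists y|rewrite gd].
by move=> _ [_ [y by_ <-] <-]; exists (g y); [exists y|rewrite gd].
Qed.

Lemma similarity_half_domain (D : C2_domain R) :
  half_domain (g @` D) = g @` half_domain D.
Proof.
have [phi [m [M [_ -> B]]]] := C2_domain_bounds D.
have rE : reach (g @` image_disk phi) = s * reach (image_disk phi).
  by apply: similarity_reach; exact: (reach_set_has_sup B).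
have dE x : boundary_dist (g @` image_disk phi) (g x) =
    s * boundary_dist (image_disk phi) x.
  apply: similarity_boundary_dist; exists (phi (1, 0)).
  exact: (boundaryP B (@on_circle10 R)).
apply/seteqP; split => [_ [[x Dx <-] /= h]|_ [x [Dx /= h] <-]].
  exists x => //; split => //=; move: h.
  by rewrite rE dE -mulrA ler_pM2l.
by split; [exists x|rewrite /= rE dE -mulrA ler_pM2l].
Qed.

End similarity.

End conformal_maps.

(** * Continuity and equivariance of the induced center *)

Section induced.
Context {R : realType}.
Variable r : set (plane R) -> plane R * R -> plane R.
Hypothesis rP : retraction_family r.

Lemma retraction_half_mem (D : C2_domain R) x : half_domain D (r (half_domain D) (x, 1)).
Proof. by have [h _ _] := rP; have [_ _ hD _] := h (half_jordan D); exact: hD. Qed.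

Lemma retraction_half_fixed (D : C2_domain R) x : half_domain D x ->
  r (half_domain D) (x, 1) = x.
Proof.
have [h _ _] := rP; have [_ _ _ hf] := h (half_jordan D) => Dx.
by apply: hf => //; rewrite in_itv /= lexx ler01.
Qed.

Lemma induced_center_interior f (D : C2_domain R) : interior D (induced_center r f D).
Proof. exact/half_domain_interior/retraction_half_mem. Qed.

(** Near [D], the retraction onto the half domain is uniformly close to that
    of [D] on a compact neighbourhood of [f D], and the latter is continuous. *)
Lemma induced_center_continuous f : continuous f -> continuous (induced_center r f).
Proof.
move=> cf D; have [rD cr _] := rP.
have [ch _ _ _] := rD (half_jordan D).
set x0 := f D.
pose K : set (plane R * R) := disk x0 1 `*` [set 1].
have KS : strip_compacts K.
  split; first by apply: compact_setX; [exact: disk_compact|exact: compact_set1].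
  by move=> [x t] [_ /= ->]; split => //=; rewrite in_itv /= lexx ler01.
have h0 : (fun x => r (half_jordan D) (x, 1)) @ nbhs x0 --> r (half_jordan D) (x0, 1).
  have S1 (x : plane R) : @strip R (x, 1) by split => //=; rewrite in_itv /= lexx ler01.
  have := (subspace_continuousP _ _).1 ch (x0, 1) (S1 x0).
  move=> k; apply/cvg_enormP => e e0.
  have := (@cvg_enormP R _ _ (within_filter _ (nbhs_filter _)) _ _).1 k e e0.
  rewrite /within /= => kA.
  have : (fun x : plane R => (x, 1 : R)) @ nbhs x0 --> (x0, 1 : R).
    exact: (cvg_pair cvg_id (cvg_cst _)).
  by move=> /(_ _ kA) /=; apply: (@filterS _ _ (nbhs_filter x0)) => x; apply.
apply: (@cvg_enormP R _ (nbhs D) (nbhs_filter D) _ _).2 => e e0.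
have e20 : 0 < e / 2 by rewrite divr_gt0.
have e40 : 0 < e / 4 by rewrite divr_gt0.
pose E : set (plane R * plane R) := [set uv | ball uv.1 (e / 4) uv.2].
have entE : entourage E by exact: entourage_ball (PosNum e40).
have crD : (fun D' : C2_domain R => r (half_jordan D') : {family @strip_compacts R, plane R * R -> plane R})
    @ nbhs D --> (r (half_jordan D) : {family @strip_compacts R, plane R * R -> plane R}).
  exact: (continuous_comp (@half_jordan_continuous R D) (cr (half_jordan D))).
have near1 : \forall D' \near D, forall y, K y -> E (r (half_jordan D) y, r (half_jordan D') y).
  exact: (crD _ (fam_nbhs _ entE KS)).
have cfe := (@cvg_enormP R _ (nbhs D) (nbhs_filter D) f x0).1 (cf D).
have near2 := cfe 1 ltr01.
have near3 : \forall D' \near D,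
    enorm (r (half_jordan D) (f D', 1) - r (half_jordan D) (x0, 1)) < e / 2.
  exact: (cf D _ ((@cvg_enormP R _ _ (nbhs_filter x0) _ _).1 h0 _ e20)).
apply: (@filterS3 _ _ (nbhs_filter D) _ _ _ _ _ near1 near2 near3) => D' h1 h2 k3.
rewrite /induced_center -/x0.
have k1 : K (f D', 1) by split => //=; rewrite /disk /=; exact: ltW.
have k2 := h1 _ k1.
have k4 : enorm (r (half_jordan D') (f D', 1) - r (half_jordan D) (f D', 1)) <= e / 2.
  rewrite enormB; apply: le_trans (enorm_norm _) _.
  by move: k2; rewrite /E /= -ball_normE /= => k2; lra.
have := enorm_triB (r (half_jordan D') (f D', 1)) (r (half_jordan D) (f D', 1))
  (r (half_jordan D) (x0, 1)).
by rewrite /=; move: k3 k4; rewrite /=; lra.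
Qed.

(** The retraction family is equivariant, and the half domain of [g @` D] is the
    image of that of [D]. *)
Lemma induced_center_equivariant f : con_equivariant f ->
  con_equivariant (induced_center r f).
Proof.
move=> ef g cg D D' D'E; have [s sg] := conformal_similarity cg.
have [_ _ req] := rP.
rewrite /induced_center (ef g cg D D' D'E) D'E (similarity_half_domain sg).
by rewrite -(req g cg (half_jordan D))// in_itv /= lexx ler01.
Qed.

End induced.

(** * The half domain of a convex domain *)

Section convex_domain.
Context {R : realType}.
Variable D : C2_domain R.
Hypothesis cD : convex_set (D : set (plane R)).
Implicit Types (x y z k p c u : plane R) (s t : R).

Let K : set (plane R) := half_domain D.

Definition half_reach : R := reach D / 2.

Lemma convex_comb x y s : 0 <= s <= 1 -> C2_set D x -> C2_set D y ->
  C2_set D ((1 - s) *: x + s *: y).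
Proof.
move=> /andP[s0 s1] Dx Dy.
have := @cD y x (Itv01 s0 s1); rewrite !inE => /(_ Dy Dx).
by rewrite addrC.
Qed.

Lemma half_reach_gt0 : 0 < half_reach.
Proof.
have [phi [m [M [_ E B]]]] := C2_domain_bounds D.
by rewrite /half_reach E divr_gt0// (reach_gt0 B).
Qed.

(** In this form the half domain inherits convexity from the domain. *)
Lemma half_domainP x : K x <-> disk x half_reach `<=` D.
Proof.
have [phi [m [M [_ DE B]]]] := C2_domain_bounds D.
have h0 := half_reach_gt0; split => [[Dx /= dx] y yx|sub].
  rewrite DE in Dx dx *; apply: (bdist_disk B Dx).
  by apply: le_trans yx _; rewrite /half_reach DE.
have Dx : C2_set D x by apply: sub; rewrite /disk /= subrr enorm0 ltW.
split => //=; rewrite -/half_reach DE; apply: (bdist_ge B) => e e1.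
rewrite leNgt; apply/negP => lt.
have [_] := boundaryP B e1; apply; apply/nbhs_enormP.
exists (half_reach - enorm (x - phi e)); first by rewrite subr_gt0.
move=> y ye; rewrite -/(image_disk phi) -DE; apply: sub; rewrite /disk /=.
by have := enorm_triB y (phi e) x; rewrite (enormB (phi e)); lra.
Qed.

Lemma half_domain_convex x y s : 0 <= s <= 1 -> K x -> K y ->
  K ((1 - s) *: x + s *: y).
Proof.
move=> s01 /half_domainP Kx /half_domainP Ky; apply/half_domainP => z.
set k := _ + _ => zk.
rewrite (_ : z = (1 - s) *: (x + (z - k)) + s *: (y + (z - k))); last first.
  by rewrite /k; apply: plane_eq; rewrite !coordE; ring.
apply: convex_comb => //; [apply: Kx|apply: Ky].
  by rewrite /disk /= addrAC subrr add0r.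
by rewrite /disk /= addrAC subrr add0r.
Qed.

Lemma half_domain_compact : compact K.
Proof.
have [psi [cpsi _] KE] := half_jordanP D.
rewrite /K KE; apply: continuous_compact; [exact: cpsi|exact: unit_disk_compact].
Qed.

(** A point of the collar is moved along its normal to depth [half_reach], by a
    distance of at most [half_reach]. *)
Lemma half_domain_near x : C2_set D x -> exists2 k, K k & enorm (x - k) <= half_reach.
Proof.
have [phi [m [M [_ DE B]]]] := C2_domain_bounds D.
have h0 := half_reach_gt0; rewrite DE => Dx.
have [h|h] := leP half_reach (boundary_dist D x).
  by exists x; [split => //; rewrite DE|rewrite subrr enorm0 ltW].
have [e e1 xE] := normal_coordinates B Dx; rewrite -DE in xE.
have hr : 0 <= half_reach <= reach (image_disk phi).
  by rewrite -DE; rewrite /half_reach in h0 *; apply/andP; split; lra.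
exists (phi e + half_reach *: inner_normal phi e).
  split; first by rewrite DE; exact: (normal_mem B).
  by rewrite /= DE (bdist_normal B)// -DE.
rewrite {1}xE (_ : _ - _ = (boundary_dist D x - half_reach) *: inner_normal phi e); last first.
  by apply: plane_eq; rewrite !coordE; ring.
rewrite enormZ (enorm_inner_normal B)// mulr1 ler0_norm ?subr_le0 ?(ltW h)//.
have : 0 <= boundary_dist D x by rewrite DE; exact: (bdist_ge0 B).
lra.
Qed.

Lemma C2_domain_nonempty : exists x, C2_set D x.
Proof.
have [phi [m [M [_ DE B]]]] := C2_domain_bounds D.
by rewrite DE; exact: domain_nonempty.
Qed.

Lemma C2_domain_compact : compact (C2_set D).
Proof.
have [phi [m [M [_ DE B]]]] := C2_domain_bounds D.
by rewrite DE; exact: (domain_compact B).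
Qed.

Lemma dot_sqrB x y : dot (x - y) (x - y) = dot x x + dot y y - 2 * dot x y.
Proof. by rewrite !dotB (dotC y x); ring. Qed.

Lemma C2_domain_closed : closed (C2_set D).
Proof. by apply: compact_closed C2_domain_compact; exact: norm_hausdorff. Qed.

Lemma C2_domain_bounded : exists2 S, 0 < S & forall x, C2_set D x -> enorm x <= S.
Proof.
apply: (compact_bounded_above C2_domain_compact) => x _.
by apply: cvg_enorm; exact: cvg_id.
Qed.

(** [p] is the point of the convex set [K] nearest to [c]: moving from it towards
    a point [k] with positive product would decrease the distance to [c]. *)
Lemma half_domain_separation c : ~ K c ->
  exists p, [/\ K p, c - p <> 0 & forall k, K k -> dot (k - p) (c - p) <= 0].
Proof.
move=> nKc.
have K0 : K !=set0.
  by have [x /half_domain_near[k Kk _]] := C2_domain_nonempty; exists k.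
have [|p] := @compact_EVT_min _ R (fun p => enorm (c - p)) K K0 half_domain_compact.
  apply: continuous_subspaceT => q; apply: cvg_enorm; apply: cvgB.
    exact: cvg_cst.
  exact: cvg_id.
rewrite inE => Kp pmin; exists p; split => //.
  by move=> /eqP; rewrite subr_eq0 => /eqP E; apply: nKc; rewrite E.
move=> k Kk; rewrite leNgt; apply/negP => lt.
set a := dot (k - p) (c - p) in lt.
have b0 : 0 <= dot (k - p) (k - p) by exact: dot_ge0.
set b := dot (k - p) (k - p) in b0.
(* short enough for the linear gain [2 * s * a] to exceed [s ^+ 2 * b] *)
pose s := a / (a + b).
have ab0 : 0 < a + b by rewrite ltr_pwDl.
have s0 : 0 < s by rewrite divr_gt0.
have s1 : s <= 1 by rewrite ler_pdivrMr// mul1r lerDl.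
have sE : s * (a + b) = a by rewrite /s divfK// gt_eqF.
have s01 : 0 <= s <= 1 by rewrite (ltW s0).
have := pmin ((1 - s) *: p + s *: k).
rewrite inE => /(_ (half_domain_convex s01 Kp Kk)).
rewrite (_ : c - ((1 - s) *: p + s *: k) = (c - p) - s *: (k - p)); last first.
  by apply: plane_eq; rewrite !coordE; ring.
rewrite -(@ler_pXn2r _ 2) ?nnegrE ?enorm_ge0// !enorm2.
rewrite [dot (_ - _ *: _) _]dot_sqrB dotZl dotZr dotZr (dotC (c - p) (k - p)) -/a -/b.
have : 0 < s * (2 * a - s * b).
  rewrite mulr_gt0// subr_gt0.
  have : s * a > 0 by rewrite mulr_gt0.
  lra.
lra.
Qed.

(** * The circumcenter *)

(** The pairs [(c, s)] of a center and a radius whose disk contains the domain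
    form a closed set, and bounding the radius confines the center to a compact
    set. *)
Lemma circumcenter_exists : exists c s, (C2_set D `<=` disk c s) /\
  forall c' s', C2_set D `<=` disk c' s' -> s <= s'.
Proof.
have [x0 Dx0] := C2_domain_nonempty.
have [S S0 SP] := C2_domain_bounded.
pose A := [set q : plane R * R | forall x, C2_set D x -> enorm (x - q.1) <= q.2].
have clA : closed A.
  rewrite (_ : A = \bigcap_(x in C2_set D) [set q : plane R * R | enorm (x - q.1) - q.2 <= 0]).
    apply: closed_bigI => x _; apply: (@closed_comp _ _ (fun q : plane R * R => enorm (x - q.1) - q.2) [set t | t <= 0]).
      move=> q _; apply: cvgB; last exact: cvg_snd.
      by apply: cvg_enorm; apply: cvgB; [exact: cvg_cst|exact: cvg_fst].
    exact: closed_le.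
  by apply/seteqP; split => q h x Dx; have := h x Dx; rewrite /= subr_le0.
have cA : compact (A `&` (disk 0 (2 * S) `*` `[0, S])).
  rewrite setIC; apply: compact_closedI clA.
  by apply: compact_setX; [exact: disk_compact|exact: segment_compact].
have [||[c s]] := @compact_EVT_min _ R snd (A `&` (disk 0 (2 * S) `*` `[0, S])) _ cA.
- exists (0, S); split => [x Dx|]; first by rewrite subr0; exact: SP.
  split; first by rewrite /disk /= subr0 enorm0 mulr_ge0// ltW.
  by rewrite /= in_itv /= lexx ltW.
- by apply: continuous_subspaceT => q; exact: cvg_snd.
rewrite inE => -[As _] smin; exists c, s; split; first by move=> x /As.
move=> c' s' sub.
have [sS|/ltW sS] := leP s' S; last first.
  apply: le_trans sS.
  have := smin (0, S); rewrite inE; apply; split => [x Dx|].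
    by rewrite subr0; exact: SP.
  split; first by rewrite /disk /= subr0 enorm0 mulr_ge0// ltW.
  by rewrite /= in_itv /= lexx ltW.
have := smin (c', s'); rewrite inE; apply; split; first by move=> x /sub.
have s'0 : 0 <= s' := le_trans (enorm_ge0 _) (sub x0 Dx0).
split; last by rewrite /= in_itv /= s'0.
rewrite /disk /= subr0.
have := SP x0 Dx0; have := sub x0 Dx0; rewrite /disk /=.
have := enormBl c' x0; rewrite (enormB c'); lra.
Qed.

(** A disk around [c] containing the domain leaves a margin [half_reach] around
    the half domain; projecting [c] onto the half domain brings it closer to
    all of its points, so a smaller disk would do. *)
Lemma circumcenter_half : K (circumcenter D).
Proof.
rewrite /circumcenter; case: xgetP => [c _ [s [sub smin]]|no]; last first.
  by exfalso; have [c [s h]] := circumcenter_exists; apply: (no c); exists s.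
apply: contrapT => nKc.
have h0 := half_reach_gt0.
have [p [Kp cp sep]] := half_domain_separation nKc.
have cp0 := enorm_gt0 cp; set u := enorm (c - p) in cp0.
have ks k : K k -> enorm (k - c) + half_reach <= s.
  move=> Kk; have kc : k - c <> 0.
    by move=> /eqP; rewrite subr_eq0 => /eqP E; apply: nKc; rewrite -E.
  have /sub : C2_set D (k + half_reach *: normalize (k - c)).
    move/half_domainP: Kk; apply; rewrite /disk /= addrAC subrr add0r.
    by rewrite enormZp ?(ltW h0)// enorm_normalize// mulr1.
  rewrite /disk /= addrAC (_ : _ + _ = (enorm (k - c) + half_reach) *: normalize (k - c)).
    rewrite enormZp ?addr_ge0 ?enorm_ge0 ?(ltW h0)// enorm_normalize// mulr1//.
  by rewrite scalerDl normalizeK.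
have sh : 0 <= s - half_reach.
  by have := ks p Kp; have := enorm_ge0 (p - c); lra.
have kp k : K k -> enorm (k - p) ^+ 2 <= (s - half_reach) ^+ 2 - u ^+ 2.
  move=> Kk; have k1 : enorm (k - c) ^+ 2 <= (s - half_reach) ^+ 2.
    by rewrite ler_pXn2r ?nnegrE ?enorm_ge0//; have := ks k Kk; lra.
  have k2 := sep k Kk.
  have : enorm (k - c) ^+ 2 = enorm (k - p) ^+ 2 + u ^+ 2 - 2 * dot (k - p) (c - p).
    rewrite /u !enorm2 (_ : k - c = (k - p) - (c - p)).
      exact: dot_sqrB.
    by rewrite opprB addrA subrK.
  lra.
have v0 : 0 <= (s - half_reach) ^+ 2 - u ^+ 2.
  by apply: le_trans (kp p Kp); exact: sqr_ge0.
pose v := Num.sqrt ((s - half_reach) ^+ 2 - u ^+ 2).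
have vE : v ^+ 2 = (s - half_reach) ^+ 2 - u ^+ 2 by rewrite sqr_sqrtr.
have v00 : 0 <= v by exact: sqrtr_ge0.
have vs : v < s - half_reach.
  by rewrite -(@ltr_pXn2r _ 2) ?nnegrE// vE gtrBl exprn_gt0.
suff /smin : C2_set D `<=` disk p (v + half_reach) by lra.
move=> x /half_domain_near[k Kk xk]; rewrite /disk /=.
have : enorm (k - p) <= v.
  by rewrite -(@ler_pXn2r _ 2) ?nnegrE ?enorm_ge0// vE; exact: kp.
by have := enorm_triB x k p; lra.
Qed.

End convex_domain.

(** * Area is invariant under reflections *)

Section area.
Context {R : realType}.
Local Notation lambda := (@lebesgue_measure R).
Local Notation mplane := (measurableTypeR R * measurableTypeR R)%type.

Definition area : {measure set mplane -> \bar R} := (lambda \x lambda)%E.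

(** The complement is a countable union of rectangles with rational corners. *)
Lemma measurable_closed (D : set (plane R)) : closed D -> measurable (D : set mplane).
Proof.
move=> cD; rewrite -(setCK D); apply: measurableC.
have oU : open (~` D) by exact: closed_openC.
set U := ~` D in oU *.
pose rect (a b c d : rat) : set mplane :=
  `](ratr a : R), ratr b[ `*` `](ratr c : R), ratr d[.
pose F a b c d : set mplane := if `[< rect a b c d `<=` U >] then rect a b c d else set0.
rewrite (_ : U = \bigcup_a \bigcup_b \bigcup_c \bigcup_d F a b c d).
  do 4 (apply: bigcupT_measurable_rat => ?).
  by rewrite /F; case: ifP => // _; apply: measurableX; exact: measurable_itv.
apply/seteqP; split => [x Ux|x [a _ [b _ [c _ [d _]]]]]; last first.
  by rewrite /F; case: asboolP => // + /=; apply.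
have /nbhs_ballP[e /= e0 eU] : nbhs x U by exact: open_nbhs_nbhs.
have [a] := @rat_in_itvoo R (x.1 - e) x.1 (ltac:(lra)).
rewrite in_itv /= => /andP[a1 a2].
have [b] := @rat_in_itvoo R x.1 (x.1 + e) (ltac:(lra)).
rewrite in_itv /= => /andP[b1 b2].
have [c] := @rat_in_itvoo R (x.2 - e) x.2 (ltac:(lra)).
rewrite in_itv /= => /andP[c1 c2].
have [d] := @rat_in_itvoo R x.2 (x.2 + e) (ltac:(lra)).
rewrite in_itv /= => /andP[d1 d2].
exists a => //; exists b => //; exists c => //; exists d => //.
rewrite /F; case: asboolP => [_|[]].
  by split; rewrite /= in_itv /= ?a2 ?b1 ?c2 ?d1.
move=> y [] /=; rewrite !in_itv /= => /andP[y1 y2] /andP[y3 y4].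
apply: eU; split; rewrite -ball_normE /= ltr_norml; apply/andP; split; lra.
Qed.

Lemma lebesgue_measure_shift (k : R) (A : set (measurableTypeR R)) : measurable A ->
  lambda ((fun y => y + k) @^-1` A) = lambda A.
Proof.
move=> mA.
have mf : measurable_fun setT (fun y : measurableTypeR R => y + k : measurableTypeR R).
  by apply: measurable_funD => //; exact: measurable_id.
rewrite -[LHS]/(pushforward lambda (fun y : measurableTypeR R => (y + k : measurableTypeR R)) A).
apply/esym/lebesgue_measure_unique => //= _ [[a b]] _ <-.
rewrite /pushforward /=.
rewrite (_ : _ @^-1` _ = `]a - k, b - k]%classic); last first.
  by apply/seteqP; split => y /=; rewrite !in_itv /= => /andP[h1 h2];
     apply/andP; split; lra.
rewrite !lebesgue_measure_itv /= !lte_fin ltrD2r -!EFinB.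
by congr (if _ then _%:E else _); lra.
Qed.

Definition area_preserving (T : plane R -> plane R) :=
  measurable_fun setT (T : mplane -> mplane) /\
  forall A : set mplane, measurable A -> area (T @^-1` A) = area A.

Lemma area_preserving_comp T S : area_preserving T -> area_preserving S ->
  area_preserving (T \o S).
Proof.
move=> [mT aT] [mS aS]; split; first exact: (measurableT_comp mT mS).
move=> A mA; rewrite comp_preimage aS ?aT//.
by rewrite -[_ @^-1` _]setTI; exact: mT.
Qed.

(** By Fubini, a map that acts on each vertical line by an isometry preserves
    area. *)
Lemma area_preserving_fiber (g : R -> R -> R) :
  measurable_fun setT (fun x : mplane => g x.1 x.2 : measurableTypeR R) ->
  (forall a (A : set (measurableTypeR R)), measurable A ->
    lambda (g a @^-1` A) = lambda A) ->
  area_preserving (fun x => (x.1, g x.1 x.2)).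
Proof.
move=> mg ag; split.
  by apply: measurable_fun_pair; [exact: measurable_fst|exact: mg].
move=> A mA; rewrite /area /= /product_measure1; apply: eq_integral => x _ /=.
rewrite -[RHS](ag x); last exact: measurable_xsection.
congr (lambda _); apply/seteqP; split => y; rewrite /xsection /= !inE //=.
Qed.

Lemma area_preserving_shear (k t : R) : area_preserving (fun x => (x.1, x.2 + (k * x.1 + t))).
Proof.
apply: (@area_preserving_fiber (fun a b => b + (k * a + t))).
  apply: measurable_funD; first exact: measurable_snd.
  apply: measurable_funD; last exact: measurable_cst.
  by apply: measurable_funM; [exact: measurable_cst|exact: measurable_fst].
by move=> a A mA; exact: lebesgue_measure_shift.
Qed.

Lemma area_preserving_flip : area_preserving (fun x => (x.1, - x.2)).
Proof.
apply: (@area_preserving_fiber (fun a b => - b)).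
  by apply: measurableT_comp => //; exact: measurable_snd.
by move=> a A mA; exact: lebesgue_measureN.
Qed.

Lemma area_preserving_swap : area_preserving (fun x => (x.2, x.1)).
Proof.
have ms : measurable_fun setT (fun x : mplane => (x.2, x.1) : mplane).
  by apply: measurable_fun_pair; [exact: measurable_snd|exact: measurable_fst].
split => // A mA.
rewrite -[LHS]/(pushforward area (fun x : mplane => (x.2, x.1) : mplane) A) /area.
apply/esym/product_measure_unique => //= B C mB mC.
rewrite /pushforward /= (_ : _ @^-1` _ = C `*` B); last first.
  by apply/seteqP; split => x [].
by rewrite /area product_measure1E// muleC.
Qed.

Lemma area_preserving_integral (T : plane R -> plane R) (A : set mplane)
    (f : mplane -> R) : area_preserving T -> measurable A ->
  measurable_fun setT f -> area.-integrable (T @^-1` A) (EFin \o (f \o T)) ->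
  \int[area]_(x in A) f x = \int[area]_(x in T @^-1` A) f (T x).
Proof.
move=> [mT aT] mA mf fT; rewrite /Rintegral; congr fine.
have mf' : measurable_fun setT (EFin \o f : mplane -> \bar R) by exact/measurable_EFinP.
rewrite -[RHS](@integral_pushforward _ _ _ _ _ (T : mplane -> mplane) mT area A (EFin \o f) mf' fT mA).
by apply: eq_measure_integral => B mB _; exact/esym/aT.
Qed.

Definition reflection (p u x : plane R) : plane R :=
  x - (2 * dot (x - p) u) *: u.

(** The reflection in the line through [p] orthogonal to [u] is a coordinate flip
    followed by three shears and a translation; the shears exist when the line
    is not vertical, a case reached by exchanging the coordinates. *)
Lemma area_preserving_reflection p u : enorm u = 1 -> area_preserving (reflection p u).
Proof.
move=> u1; have uu : u.1 ^+ 2 + u.2 ^+ 2 = 1.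
  by have := enorm2 u; rewrite u1 expr1n /dot !expr2.
have S := area_preserving_swap.
have H k t : area_preserving (fun x => (x.1 + (k * x.2 + t), x.2)).
  by have := area_preserving_comp S (area_preserving_comp (area_preserving_shear k t) S).
have nonvert p' u' : u'.1 ^+ 2 + u'.2 ^+ 2 = 1 -> u'.2 != 0 ->
    area_preserving (reflection p' u').
  move=> uu' b0; pose l := - (u'.1 / u'.2); pose h := 2 * (u'.1 * u'.2).
  pose t := 2 * dot p' u'.
  have := area_preserving_comp (H 0 (t * u'.1)) (area_preserving_comp
    (area_preserving_shear 0 (t * u'.2)) (area_preserving_comp
    (area_preserving_shear l 0) (area_preserving_comp (H h 0) (area_preserving_comp
    (area_preserving_shear l 0) area_preserving_flip)))).
  have lb : l * u'.2 = - u'.1 by rewrite /l mulNr divfK.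
  have lh : l * h = - 2 * u'.1 ^+ 2.
    by transitivity (2 * u'.1 * (l * u'.2)); [rewrite /h; ring|rewrite lb; ring].
  have lh' : l * h = 2 * u'.2 ^+ 2 - 2 by rewrite lh; move: uu'; lra.
  congr area_preserving; apply/funext => x; apply: plane_eq.
    rewrite [in RHS]/reflection !coordE /=.
    transitivity (x.1 + (l * h) * x.1 - h * x.2 + t * u'.1); first ring.
    by rewrite lh /h /t /dot !coordE; ring.
  rewrite [in RHS]/reflection !coordE /=.
  transitivity (- x.2 + (2 * l + (l * h) * l) * x.1 - (l * h) * x.2 + t * u'.2); first ring.
  transitivity (- x.2 + 2 * u'.2 * (l * u'.2) * x.1 - (l * h) * x.2 + t * u'.2).
    by rewrite lh'; ring.
  by rewrite lb lh' /t /dot !coordE; ring.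
have [b0|b0] := eqVneq u.2 0; last exact: nonvert.
have a0 : u.1 != 0.
  apply/eqP => a0; move: uu; rewrite a0 b0 expr0n /= addr0 => /eqP.
  by rewrite eq_sym oner_eq0.
have := area_preserving_comp S (area_preserving_comp
  (@nonvert (p.2, p.1) (u.2, u.1) _ a0) S).
rewrite /= addrC => /(_ uu); congr area_preserving; apply/funext => x.
by apply: plane_eq; rewrite /comp /reflection ?coordE /= /dot !coordE /=; ring.
Qed.


(** * The center of mass *)

Section center_of_mass.
Variable D : C2_domain R.
Hypothesis cD : convex_set (D : set (plane R)).

Let K : set (plane R) := half_domain D.
Let mD : measurable (C2_set D : set mplane).
Proof. by apply: measurable_closed; exact: C2_domain_closed. Qed.

Lemma area_square (a b s : R) : 0 <= s ->
  area (`[a - s, a + s] `*` `[b - s, b + s]) = ((2 * s) ^+ 2)%:E.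
Proof.
move=> s0; transitivity (lambda `[(a - s)%R, (a + s)%R] * lambda `[(b - s)%R, (b + s)%R])%E.
  by apply: product_measure1E; exact: measurable_itv.
rewrite !lebesgue_measure_itv /= !lte_fin.
have E (t : R) : t + s - (t - s) = 2 * s by ring.
have [->|s1] := eqVneq s 0; first by rewrite subr0 addr0 ltxx mul0e mulr0 expr0n.
have st (t : R) : t - s < t + s by rewrite ltrD2l gtrN// lt_neqAle eq_sym s1.
by rewrite !st -!EFinB !E -EFinM expr2.
Qed.

Lemma area_domain_fin : (area (C2_set D) < +oo)%E.
Proof.
have [S S0 SP] := C2_domain_bounded D.
have mS : measurable (`[0 - S, 0 + S] `*` `[0 - S, 0 + S] : set mplane).
  by apply: measurableX; exact: measurable_itv.
apply: (@le_lt_trans _ _ (area (`[0 - S, 0 + S] `*` `[0 - S, 0 + S]))).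
  apply: le_measure; rewrite ?inE; [exact: mD|exact: mS|].
  move=> x Dx; have := le_trans (norm_enorm x) (SP x Dx).
  rewrite [`|x|]prod_normE ge_max !ler_norml => /andP[x1 x2].
  by split; rewrite /= in_itv /= sub0r add0r.
by rewrite area_square ?ltry// ltW.
Qed.

Lemma area_domain_gt0 : 0 < fine (area (C2_set D)).
Proof.
have [x Dx] := C2_domain_nonempty D.
have [k /(half_domainP D) kD _] := half_domain_near Dx.
have h0 := half_reach_gt0 D; pose s := half_reach D / 2.
have s0 : 0 < s by rewrite divr_gt0.
have mS : measurable (`[k.1 - s, k.1 + s] `*` `[k.2 - s, k.2 + s] : set mplane).
  by apply: measurableX; exact: measurable_itv.
rewrite fine_gt0// area_domain_fin andbT.
apply: (@lt_le_trans _ _ (area (`[k.1 - s, k.1 + s] `*` `[k.2 - s, k.2 + s]))).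
  by rewrite area_square ?(ltW s0)// lte_fin exprn_gt0// mulr_gt0.
apply: le_measure; rewrite ?inE; [exact: mS|exact: mD|].
move=> y [/=]; rewrite !in_itv /= => /andP[y1 y2] /andP[y3 y4].
apply: kD; apply: le_trans (enorm_norm _) _.
rewrite -ler_pdivlMl// mulrC -/s [leLHS]prod_normE ge_max !ler_norml /=.
by apply/andP; split; apply/andP; split; lra.
Qed.

Lemma bounded_integrable (A : set mplane) (f : plane R -> R) (S : R) :
  measurable A -> (area A < +oo)%E -> measurable_fun setT (f : mplane -> R) ->
  (forall x, A x -> `|f x| <= S) -> area.-integrable A (EFin \o f).
Proof.
move=> mA fA mf fS; apply: measurable_bounded_integrable => //.
  exact: measurable_funTS.
exists S; split; first exact: num_real.
by move=> s Ss x Ax; apply: le_trans (fS x Ax) (ltW Ss).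
Qed.

Lemma measurable_affine (p u : plane R) :
  measurable_fun setT ((fun x => dot (x - p) u) : mplane -> R).
Proof.
rewrite /dot; apply: measurable_funD; apply: measurable_funM;
  try exact: measurable_cst; apply: measurable_funD; try exact: measurable_cst.
- exact: measurable_fst.
- exact: measurable_snd.
Qed.

Lemma dot_reflection p u x : enorm u = 1 ->
  dot (reflection p u x - p) u = - dot (x - p) u.
Proof.
move=> u1; have uu : dot u u = 1 by rewrite -enorm2 u1 expr1n.
rewrite /reflection; set a := dot (x - p) u.
have -> : x - (2 * a) *: u - p = (x - p) - (2 * a) *: u by rewrite addrAC.
by rewrite dotDl dotNl dotZl uu -/a; ring.
Qed.

(** The part of the domain beyond a line that bounds the half domain is
    reflected into the domain: the reflection brings its points closer to every
    point of the half domain. *)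
Lemma reflection_mem p u x : enorm u = 1 ->
  (forall k, K k -> dot (k - p) u <= 0) -> 0 <= dot (x - p) u ->
  C2_set D x -> C2_set D (reflection p u x).
Proof.
move=> u1 Ku xu /(@half_domain_near _ D)[k Kk xk].
move/(half_domainP D): (Kk); apply; rewrite /disk /=; apply: le_trans xk.
have uu : dot u u = 1 by rewrite -enorm2 u1 expr1n.
rewrite -(@ler_pXn2r _ 2) ?nnegrE ?enorm_ge0// !enorm2 /reflection.
set a := dot (x - p) u in xu *.
have -> : x - (2 * a) *: u - k = (x - k) - (2 * a) *: u by rewrite addrAC.
rewrite [dot (x - k - _) _]dot_sqrB dotZl dotZr dotZr uu.
have -> : dot (x - k) u = a - dot (k - p) u.
  by rewrite /a -dotNl -dotDl opprB addrA subrK.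
by have := Ku k Kk; nra.
Qed.

(** Beyond the line through [p] the domain has the smaller part, up to
    reflection: the integrand is nonpositive on the points of [D] whose mirror
    image is outside [D], and the other points cancel in pairs. *)
Lemma integral_reflection (p u : plane R) : enorm u = 1 ->
  (forall k, K k -> dot (k - p) u <= 0) ->
  \int[area]_(x in C2_set D) dot (x - p) u <= 0.
Proof.
move=> u1 Ku; pose l x := dot (x - p) u.
have [mT aT] := area_preserving_reflection p u1.
pose T := reflection p u.
pose D' : set mplane := T @^-1` C2_set D.
have mD' : measurable D'.
  by rewrite -[D']setTI; exact: (mT measurableT _ mD).
have lT x : l (T x) = - l x := dot_reflection p x u1.
have TT x : T (T x) = x.
  rewrite [LHS](_ : _ = T x - (2 * l (T x)) *: u) // lT.
  rewrite [T x](_ : _ = x - (2 * l x) *: u) //.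
  by apply: plane_eq; rewrite !coordE; ring.
have ml : measurable_fun setT (l : mplane -> R) := measurable_affine p u.
have [S S0 SP] := C2_domain_bounded D.
have lS x : C2_set D x -> `|l x| <= S + enorm p.
  move=> Dx; apply: le_trans (dot_normr _ _) _; rewrite u1 mulr1.
  by apply: le_trans (enormB_le _ _) _; rewrite lerD2r; exact: SP.
have lD : area.-integrable (C2_set D) (EFin \o l).
  exact: (@bounded_integrable _ _ (S + enorm p) mD area_domain_fin ml lS).
have aD' : (area D' < +oo)%E by rewrite [area D'](aT _ mD) area_domain_fin.
have lD' : area.-integrable D' (EFin \o l).
  apply: (@bounded_integrable _ _ (S + enorm p)) => // x Dx.
  by rewrite -normrN -lT; exact: lS.
have lTD' : area.-integrable D' (EFin \o (l \o T)).
  apply: (@bounded_integrable _ _ (S + enorm p)) => //.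
    exact: (measurableT_comp ml mT).
  by move=> x Dx; exact: lS.
have E : \int[area]_(x in C2_set D) l x = \int[area]_(x in D') (l \o T) x.
  exact: (area_preserving_integral (area_preserving_reflection p u1) mD ml lTD').
have E' : \int[area]_(x in D') (l \o T) x = - \int[area]_(x in D') l x.
  rewrite -mulN1r -RintegralZl//.
  by apply: eq_Rintegral => x _; rewrite /= lT mulN1r.
suff : \int[area]_(x in C2_set D) l x <= \int[area]_(x in D') l x.
  by rewrite /l in E E' *; move: E; rewrite E' /=; lra.
rewrite Rintegral_mkcond [leRHS]Rintegral_mkcond.
apply: le_Rintegral => //.
- by have /(integrable_mkcond _ mD) := lD; rewrite restrict_EFin.
- by have /(integrable_mkcond _ mD') := lD'; rewrite restrict_EFin.
move=> x _; rewrite !patchE; case: ifPn; rewrite ?inE ?notin_setE => Dx;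
  case: ifPn; rewrite ?inE ?notin_setE => D'x //.
- have [//|l0] := leP (l x) 0; exfalso; apply: D'x.
  exact: (reflection_mem u1 Ku (ltW l0) Dx).
- have [//|l0] := leP 0 (l x); exfalso; apply: Dx; rewrite -(TT x).
  apply: (reflection_mem u1 Ku _ D'x).
  by have := lT x; rewrite /l => ->; rewrite oppr_ge0 ltW.
Qed.

(** If [c] were beyond the separating line, the integral of the signed distance
    to the line would be the area times the positive distance of [c]. *)
Lemma center_of_mass_half : K (center_of_mass D).
Proof.
apply: contrapT => nK; set c := center_of_mass D in nK.
have [p [Kp cp sep]] := half_domain_separation cD nK.
pose u := normalize (c - p).
have u1 : enorm u = 1 by exact: enorm_normalize.
have Ku k : K k -> dot (k - p) u <= 0.
  by move=> /sep h; rewrite /u /normalize dotZr mulr_ge0_le0// invr_ge0 enorm_ge0.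
have := integral_reflection u1 Ku; apply/negP; rewrite -ltNge.
have [S S0 SP] := C2_domain_bounded D.
have i1 : area.-integrable (C2_set D) (EFin \o (fst : plane R -> R)).
  apply: (@bounded_integrable _ _ S mD area_domain_fin); first exact: measurable_fst.
  move=> x Dx; apply: le_trans (SP x Dx); apply: le_trans (norm_enorm _).
  by rewrite [leRHS]prod_normE le_max lexx.
have i2 : area.-integrable (C2_set D) (EFin \o (snd : plane R -> R)).
  apply: (@bounded_integrable _ _ S mD area_domain_fin); first exact: measurable_snd.
  move=> x Dx; apply: le_trans (SP x Dx); apply: le_trans (norm_enorm _).
  by rewrite [leRHS]prod_normE le_max lexx orbT.
have ic t : area.-integrable (C2_set D) (EFin \o (fun _ : plane R => t)).
  by apply: (@bounded_integrable _ _ `|t| mD area_domain_fin).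
have iM (f : plane R -> R) t : area.-integrable (C2_set D) (EFin \o f) ->
    area.-integrable (C2_set D) (EFin \o (fun x => f x * t)).
  move=> fi; have := @integrableZr _ _ _ area (C2_set D) mD t _ fi.
  by [].
have iD (f g : plane R -> R) : area.-integrable (C2_set D) (EFin \o f) ->
    area.-integrable (C2_set D) (EFin \o g) ->
    area.-integrable (C2_set D) (EFin \o (fun x => f x + g x)).
  by move=> fi gi; exact: (integrableD mD fi gi).
have A0 := area_domain_gt0.
set A := fine _ in A0.
have -> : \int[area]_(x in C2_set D) dot (x - p) u = A * dot (c - p) u.
  transitivity (\int[area]_(x in C2_set D) ((x.1 * u.1 + x.2 * u.2) + - dot p u)).
    by apply: eq_Rintegral => x _; rewrite dotDl dotNl.
  rewrite RintegralD//; last exact/iD/iM/i2/iM/i1.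
  rewrite RintegralD//; try exact: iM.
  rewrite (RintegralZr u.1 mD i1) (RintegralZr u.2 mD i2) Rintegral_cst//.
  rewrite -/A dotDl dotNl {2}/dot /c /center_of_mass -/area -/A /=.
  by field; rewrite gt_eqF.
rewrite mulr_gt0// /u /normalize dotZr mulr_gt0// ?invr_gt0 ?enorm_gt0//.
by rewrite -enorm2 exprn_gt0// enorm_gt0.
Qed.

End center_of_mass.

End area.

(** * Derivatives of the boundary curve *)

Section curve_calculus.
Context {R : realType}.
Implicit Types (f : plane R -> plane R) (h : R -> plane R) (t : R).

Lemma is_derive_plane (a b : R -> R) t (a' b' : R) : is_derive t 1 a a' ->
  is_derive t 1 b b' -> is_derive t 1 (fun s => (a s, b s)) (a', b').
Proof.
move=> /is_derive_cvg da /is_derive_cvg db; apply: cvg_is_derive.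
exact: (cvg_pair da db).
Qed.

Lemma cvg_increment h t : {for t, continuous h} ->
  (h \o shift t) (s *: (1 : R)) @[s --> (0 : R)^'] --> h t.
Proof.
move=> ch; have ct : (s *: (1 : R) + t) @[s --> (0 : R)^'] --> t.
  rewrite -[X in _ --> X]add0r -[X in X + _](scale0r (1 : R)).
  apply: cvg_within_filter; apply: cvgD; last exact: cvg_cst.
  by apply: cvgZl; exact: cvg_id.
exact: (cvg_comp _ _ ct ch).
Qed.

Lemma is_derive_scale (a : R -> R) h t (a' : R) (h' : plane R) :
  is_derive t 1 a a' -> is_derive t 1 h h' ->
  is_derive t 1 (fun s => a s *: h s) (a' *: h t + a t *: h').
Proof.
move=> da dh; have cs := cvg_increment (is_derive_continuous dh).
move/is_derive_cvg: da => qa; move/is_derive_cvg: dh => qh; apply: cvg_is_derive.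
apply: cvg_trans (cvgD (cvgZ qa cs) (cvgZ (cvg_cst (a t)) qh)).
apply: near_eq_cvg; near=> s => /=.
rewrite [LHS](_ : _ = s^-1 *: ((a (s *: 1 + t) - a t) *: h (s *: 1 + t) +
  a t *: (h (s *: 1 + t) - h t))); last first.
  by apply: plane_eq; rewrite !coordE /GRing.scale /=; ring.
congr (_ *: _).
by rewrite scalerBl scalerBr addrA subrK.
Unshelve. all: by end_near. Qed.

Lemma is_derive_dot_self h t (h' : plane R) : is_derive t 1 h h' ->
  is_derive t 1 (fun s => dot (h s) (h s)) (2 * dot h' (h t)).
Proof.
move=> dh; have cs := cvg_increment (is_derive_continuous dh).
move/is_derive_cvg: dh => qh; apply: cvg_is_derive.
have -> : 2 * dot h' (h t) = dot h' (h t + h t) by rewrite dotDr; ring.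
apply: cvg_trans (cvg_dot qh (cvgD cs (cvg_cst (h t)))).
apply: near_eq_cvg; near=> s => /=.
rewrite dotZl; congr (_ * _).
by rewrite dotDl !dotDr !dotNl (dotC (h t) (h _)); ring.
Unshelve. all: by end_near. Qed.

Lemma is_derive_enorm h t (h' : plane R) : h t <> 0 -> is_derive t 1 h h' ->
  is_derive t 1 (fun s => enorm (h s)) (dot h' (h t) / enorm (h t)).
Proof.
move=> h0 /is_derive_dot_self dq.
have q0 : 0 < dot (h t) (h t) by rewrite -enorm2 exprn_gt0// enorm_gt0.
apply: (is_derive_eq (@is_derive1_comp _ Num.sqrt (fun s => dot (h s) (h s)) t _ _
  (is_derive1_sqrt q0) dq)); rewrite -/(enorm (h t)).
by field; rewrite gt_eqF// enorm_gt0.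
Qed.

Lemma is_derive_chain f h t (h' : plane R) : differentiable f (h t) ->
  is_derive t 1 h h' -> is_derive t 1 (f \o h) (dd f h' (h t)).
Proof.
move=> df [dh <-].
have dh' : differentiable h t by apply/derivable1_diffP.
have dfh : differentiable (f \o h) t by exact: differentiable_comp.
apply: DeriveDef; first exact/derivable1_diffP.
rewrite ddE (deriveE _ dfh) (deriveE _ df) (deriveE _ dh').
exact: (congr1 (fun k : R -> plane R => k 1) (diff_comp dh' df)).
Qed.

Lemma is_derive_circle_point t : is_derive t 1 (@circle_point R) (turn (circle_point t)).
Proof. exact: is_derive_plane. Qed.

(** The derivative of [f] along the circle, in a fixed basis so that it can be
    differentiated again. *)
Definition circle_derivative f t : plane R :=
  (- sin t) *: dd f (1, 0) (circle_point t) + cos t *: dd f (0, 1) (circle_point t).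

Lemma circle_derivativeE f t : differentiable f (circle_point t) ->
  circle_derivative f t = dd f (turn (circle_point t)) (circle_point t).
Proof. by move=> df; rewrite [RHS]derive_basis. Qed.

Lemma is_derive_circle f t : differentiable f (circle_point t) ->
  is_derive t 1 (f \o @circle_point R) (circle_derivative f t).
Proof.
move=> df; rewrite circle_derivativeE//; apply: is_derive_chain => //.
exact: is_derive_circle_point.
Qed.

Lemma continuous_on_circle f : (forall x, unit_disk x -> {for x, continuous f}) ->
  continuous (f \o @circle_point R).
Proof.
move=> cf t; apply: continuous_comp; first exact: continuous_circle_point.
by apply: cf; apply: on_circle_disk; exact: circle_pointP.
Qed.

Lemma continuous_circle_derivative f :
  (forall v x, unit_disk x -> {for x, continuous (dd f v)}) ->
  continuous (circle_derivative f).
Proof.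
move=> cf t; apply: cvgD.
  apply: cvgZ; first by apply: cvgN; exact: continuous_sin.
  by apply: continuous_on_circle; exact: cf.
apply: cvgZ; first exact: continuous_cos.
by apply: continuous_on_circle; exact: cf.
Qed.

Section curve.
Variables (f : plane R -> plane R) (Cf : C2_near_disk f).

Let Bc t : unit_disk (circle_point t).
Proof. by apply: on_circle_disk; exact: circle_pointP. Qed.

Definition circle_derivative2 t : plane R :=
  ((- cos t) *: dd f (1, 0) (circle_point t) +
   (- sin t) *: circle_derivative (dd f (1, 0)) t) +
  ((- sin t) *: dd f (0, 1) (circle_point t) +
   cos t *: circle_derivative (dd f (0, 1)) t).

Lemma is_derive_circle2 t :
  is_derive t 1 (circle_derivative f) (circle_derivative2 t).
Proof.
have db v := is_derive_circle (C2_near_differentiable_derive Cf v (Bc t)).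
apply: is_deriveD; apply: is_derive_scale; exact: db.
Qed.

Lemma continuous_circle_derivative2 : continuous circle_derivative2.
Proof.
have cb v : continuous (dd f v \o @circle_point R).
  by apply: continuous_on_circle => x; exact: C2_near_continuous_derive.
have cd v : continuous (circle_derivative (dd f v)).
  by apply: continuous_circle_derivative => w x; exact: C2_near_continuous_derive2.
move=> t; apply: cvgD; apply: cvgD; apply: cvgZ; try exact: cb; try exact: cd;
  try exact: continuous_cos; apply: cvgN; try exact: continuous_cos;
  exact: continuous_sin.
Qed.

Lemma derive1_circle : derive1 (f \o @circle_point R) = circle_derivative f.
Proof.
apply/funext => t; rewrite derive1E.
by have [_ ->] := is_derive_circle (C2_near_differentiable Cf (Bc t)).
Qed.

Lemma derive1_circle2 : derive1 (circle_derivative f) = circle_derivative2.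
Proof. by apply/funext => t; rewrite derive1E; have [_ ->] := is_derive_circle2 t. Qed.

End curve.

End curve_calculus.

(** * Second order minima and integrals of derivatives *)

Section real_functions.
Context {R : realType}.
Implicit Types (F f : R -> R) (a b t : R).

(** Were [f'] negative, so would be [f] just after [t], and [F] would decrease
    there. *)
Lemma second_order_minimum F f (f' : R) t : (forall s : R, is_derive s 1 F (f s)) ->
  is_derive t 1 f f' -> (forall s, F t <= F s) -> f t = 0 -> 0 <= f'.
Proof.
move=> dF /is_derive_cvg df tmin f0; rewrite leNgt; apply/negP => f'0.
have : \forall h \near (0 : R)^', h^-1 *: ((f \o shift t) (h *: 1) - f t) < 0.
  by apply: (cvgr_lt _ df).
rewrite near_withinE => /nbhs_ballP[e /= e0 he].
have hF s : 0 < s -> s < e -> f (t + s) < 0.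
  move=> s0 se; have := he s; rewrite -ball_normE /= sub0r normrN gtr0_norm//.
  move=> /(_ se); rewrite gt_eqF// => /(_ isT).
  rewrite f0 subr0 [s *: 1]mulr1 addrC => h.
  have : s^-1 * f (t + s) < 0 by [].
  by rewrite pmulr_rlt0// invr_gt0.
have t12 : t < t + e / 2 by rewrite ltrDl divr_gt0.
have [|c ct E] := MVT t12 (fun x _ => dF x).
  by apply: continuous_subspaceT => x; exact: is_derive_continuous (dF x).
move: ct; rewrite in_itv /= => /andP[c1 c2].
have := hF (c - t); rewrite subr_gt0 addrCA subrr addr0 => /(_ c1) h.
have {}h : f c < 0 by apply: h; lra.
have := tmin (t + e / 2); rewrite -subr_ge0 E addrAC subrr add0r.
by rewrite pmulr_lge0 ?divr_gt0// leNgt h.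
Qed.

Lemma integrable_itv (f : R -> R) a b : continuous f ->
  (@lebesgue_measure R).-integrable `[a, b] (EFin \o f).
Proof.
move=> cf; apply: continuous_compact_integrable; first exact: segment_compact.
exact: continuous_subspaceT.
Qed.

Lemma integral_derivative F f a b : a < b -> continuous f ->
  (forall s : R, is_derive s 1 F (f s)) ->
  \int[@lebesgue_measure R]_(s in `[a, b]) f s = F b - F a.
Proof.
move=> ab cf dF.
have cF : continuous F by move=> s; exact: is_derive_continuous (dF s).
rewrite /Rintegral (@continuous_FTC2 _ f F)//.
- exact: continuous_subspaceT.
- split; first by move=> x _; have [] := dF x.
    exact/cvg_at_right_filter/cF.
  exact/cvg_at_left_filter/cF.
- by move=> x _; rewrite derive1E; have [_ ->] := dF x.
Qed.

End real_functions.

(** * The Steiner point *)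

Section turning.
Context {R : realType}.
Variables (m M : R) (phi : plane R -> plane R).
Hypothesis B : param_bounds m M phi.
Implicit Types (t : R) (w : plane R).

Let c : R -> plane R := @circle_point R.
Let g1 := circle_derivative phi.
Let g2 := circle_derivative2 phi.
Let N t := inner_normal phi (c t).

Let c1 t : on_circle (c t). Proof. exact: circle_pointP. Qed.

Lemma velocityE t : g1 t = dd phi (turn (c t)) (c t).
Proof.
apply: circle_derivativeE; apply: (C2_near_differentiable (pb_C2 B)).
exact/on_circle_disk/c1.
Qed.

Lemma velocity_gt0 t : 0 < enorm (g1 t).
Proof. by rewrite velocityE; apply: lt_le_trans (enorm_dd_turn B (c1 t)); exact: pb_m B. Qed.

Lemma velocity_normal t : dot (g1 t) (N t) = 0.
Proof. by rewrite velocityE; exact: inner_normal_tangent B _ (c1 t). Qed.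

Lemma continuous_velocity : continuous g1.
Proof. by move=> t; exact: is_derive_continuous (is_derive_circle2 (pb_C2 B) t). Qed.

(** [turning_rate t] is the curvature times the speed, the angular velocity of
    the unit tangent. *)
Definition turning_rate t := dot (g2 t) (N t) / enorm (g1 t).

Lemma continuous_turning_rate : continuous turning_rate.
Proof.
move=> t; apply: cvgM.
  apply: cvg_dot; first exact: (continuous_circle_derivative2 (pb_C2 B)).
  exact: (continuous_inner_normal B).
apply: cvgV; first by rewrite gt_eqF// velocity_gt0.
by apply: cvg_enorm; exact: continuous_velocity.
Qed.

Definition unit_velocity t := normalize (g1 t).

(** Expansion of the scalar product in the orthogonal basis [a], [n], without
    dividing by the length of [a]. *)
Lemma dot_frame (a n x y : plane R) : enorm n = 1 -> dot a n = 0 ->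
  dot a a * dot x y = dot a a * (dot x n * dot y n) + dot x a * dot y a.
Proof.
move=> n1 an; have nn : n.1 ^+ 2 + n.2 ^+ 2 = 1.
  by have := enorm2 n; rewrite n1 expr1n /dot !expr2.
have aE : a = dot a (turn n) *: turn n.
  by rewrite {1}(frame_decomp a n1) an scale0r add0r.
rewrite aE; move: (dot a (turn n)) => k.
have E : dot x y * (n.1 ^+ 2 + n.2 ^+ 2) =
    dot x n * dot y n + dot x (turn n) * dot y (turn n).
  by rewrite /dot /=; ring.
have JJ : dot (turn n) (turn n) = 1 by rewrite -enorm2 enorm_turn n1 expr1n.
rewrite nn mulr1 in E; rewrite !(dotZl, dotZr) E JJ.
by ring.
Qed.

(** A unit vector moves orthogonally to itself, so only the normal component of
    the acceleration contributes. *)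
Lemma is_derive_unit_velocity w t :
  is_derive t 1 (fun s => dot (unit_velocity s) w) (turning_rate t * dot (N t) w).
Proof.
have v0 := velocity_gt0 t; have d2 := is_derive_circle2 (pb_C2 B) t.
have g0 : g1 t <> 0 by move=> E; move: v0; rewrite E enorm0 ltxx.
have dv : is_derive t 1 (fun s => (enorm (g1 s))^-1)
    (- (enorm (g1 t)) ^- 2 *: (dot (g2 t) (g1 t) / enorm (g1 t))).
  by apply: is_deriveV; [rewrite gt_eqF|exact: is_derive_enorm].
apply: (is_derive_eq (is_derive_dot w (is_derive_scale dv d2))).
have := dot_frame (g2 t) w (enorm_inner_normal B (c1 t)) (velocity_normal t).
move: v0; rewrite -/(N t) -/g1 -/(g2 t) -enorm2 /turning_rate.
move: (g1 t) (g2 t) (N t) => a b n v0 E.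
have {}E : dot b w = dot b n * dot n w + dot b a * dot a w / enorm a ^+ 2.
  apply: (@mulfI _ (enorm a ^+ 2)); first by rewrite expf_neq0// gt_eqF.
  rewrite E (dotC w n) (dotC w a) [RHS]mulrDr; congr (_ + _).
  by field; rewrite gt_eqF.
rewrite dotDl !dotZl E /GRing.scale /=.
by field; rewrite gt_eqF.
Qed.

Lemma unit_velocity_periodic : unit_velocity (2 * pi) = unit_velocity 0.
Proof.
rewrite /unit_velocity !velocityE /c /circle_point.
by rewrite mulr_natl cos2pi sin2pi cos0 sin0.
Qed.

Let pi2 : 0 < 2 * pi :> R. Proof. by rewrite mulr_gt0// pi_gt0. Qed.

Let cNw w : continuous (fun t => turning_rate t * dot (N t) w).
Proof.
move=> t; apply: cvgM; first exact: continuous_turning_rate.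
by apply: cvg_dot; [exact: continuous_inner_normal B _|exact: cvg_cst].
Qed.

(** The unit tangent of a closed curve returns to its initial value. *)
Lemma integral_normal w :
  \int[@lebesgue_measure R]_(t in `[0, 2 * pi]) (turning_rate t * dot (N t) w) = 0.
Proof.
rewrite (integral_derivative pi2 (@cNw w) (is_derive_unit_velocity w)).
by rewrite unit_velocity_periodic subrr.
Qed.

Variable D : C2_domain R.
Hypotheses (DE : C2_set D = image_disk phi) (cD : convex_set (D : set (plane R))).

(** Scaling a convex domain towards the boundary point makes the quadratic term
    of [exterior_ineq] negligible. *)
Lemma tangent_half_plane t x : C2_set D x -> 0 <= dot (x - phi (c t)) (N t).
Proof.
move=> Dx; set p := phi (c t); set a := dot (x - p) (N t).
have Dp : C2_set D p by rewrite DE; exact: (domain_mem phi (c1 t)).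
pose K := M / m ^+ 2 * enorm (x - p) ^+ 2.
have h s : 0 < s -> s <= 1 -> - (s * K) <= a.
  move=> s0 s1; have s01 : 0 <= s <= 1 by rewrite (ltW s0).
  have := convex_comb cD s01 Dp Dx; rewrite DE => -[y By yE].
  have := exterior_ineq B (c1 t) By; rewrite -/p -/(N t) yE.
  have -> : (1 - s) *: p + s *: x - p = s *: (x - p).
    by apply: plane_eq; rewrite !coordE; ring.
  rewrite dotZl -/a enormZp ?(ltW s0)// exprMn.
  have -> : - (M / m ^+ 2 * (s ^+ 2 * enorm (x - p) ^+ 2)) = s * (- (s * K)).
    by rewrite /K; ring.
  by rewrite ler_pM2l.
rewrite leNgt; apply/negP => a0.
have K0 : 0 <= K.
  by rewrite mulr_ge0 ?sqr_ge0// divr_ge0 ?sqr_ge0// ltW// (pb_M B).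
pose s := Num.min 1 (- a / (2 * (K + 1))).
have s0 : 0 < s by rewrite lt_min ltr01 divr_gt0 ?oppr_gt0// mulr_gt0// ltr_wpDl.
have s1 : s <= 1 by rewrite ge_min lexx.
have sK : s * (2 * (K + 1)) <= - a.
  by rewrite -ler_pdivlMr ?ge_min ?lexx ?orbT// mulr_gt0// ltr_wpDl.
by have := h s s0 s1; move: sK; lra.
Qed.

(** The distance from the tangent line at [t] is minimal at [t] itself, and its
    second derivative there is the normal component of the acceleration. *)
Lemma turning_rate_ge0 t : 0 <= turning_rate t.
Proof.
rewrite /turning_rate divr_ge0 ?enorm_ge0//.
have dg s := is_derive_circle (C2_near_differentiable (pb_C2 B) (on_circle_disk (c1 s))).
have d2 := is_derive_circle2 (pb_C2 B) t.
apply: (second_order_minimum (fun s => is_derive_dot (N t) (dg s)) (is_derive_dot (N t) d2)).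
  move=> s; have Ds : C2_set D (phi (c s)) by rewrite DE; exact: (domain_mem phi (c1 s)).
  by have := tangent_half_plane t Ds; rewrite dotDl dotNl subr_ge0.
exact: velocity_normal.
Qed.

(** By Rolle the boundary curve has a tangent orthogonal to the initial one, so
    the unit tangent travels at least a unit distance. *)
Lemma integral_turning_rate_ge1 :
  1 <= \int[@lebesgue_measure R]_(t in `[0, 2 * pi]) turning_rate t.
Proof.
pose w := unit_velocity 0.
have w1 : enorm w = 1.
  by apply: enorm_normalize => E; have := velocity_gt0 0; rewrite E enorm0 ltxx.
have dg s := is_derive_dot w (is_derive_circle
  (C2_near_differentiable (pb_C2 B) (on_circle_disk (c1 s)))).
have [|||t1 t1I [_ t1E]] := @Rolle R (fun s => dot (phi (c s)) w) _ _ pi2.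
- by move=> s _; have [] := dg s.
- by apply: continuous_subspaceT => s; exact: is_derive_continuous (dg s).
- by rewrite /c /circle_point mulr_natl cos2pi sin2pi cos0 sin0.
have {}t1E : dot (unit_velocity t1) w = 0.
  by have [_ E] := dg t1; rewrite /unit_velocity dotZl -E t1E mulr0.
move: t1I; rewrite in_itv /= => /andP[t10 t12].
have ct := continuous_turning_rate.
have sub : \int[@lebesgue_measure R]_(t in `[0, t1]) turning_rate t <=
    \int[@lebesgue_measure R]_(t in `[0, 2 * pi]) turning_rate t.
  rewrite /Rintegral fine_le//.
  - exact: (integrable_fin_num _ (integrable_itv 0 t1 ct)).
  - exact: (integrable_fin_num _ (integrable_itv 0 (2 * pi) ct)).
  apply: ge0_subset_integral => //.
  - by have /integrableP[] := integrable_itv 0 (2 * pi) ct.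
  - by move=> t _; rewrite lee_fin turning_rate_ge0.
  - by move=> t /=; rewrite !in_itv /= => /andP[-> /le_trans]; apply; exact: ltW.
apply: le_trans sub.
have := integral_derivative t10 (@cNw w) (is_derive_unit_velocity w).
rewrite t1E sub0r -[dot _ w in X in _ = X]enorm2 w1 expr1n => E.
rewrite -[leLHS]opprK -E -mulN1r -RintegralZl//; last exact: integrable_itv.
apply: le_Rintegral => //; [|exact: integrable_itv|].
  by apply: (@integrable_itv _ (fun t => -1 * (turning_rate t * dot (N t) w)));
     move=> t; apply: cvgM; [exact: cvg_cst|exact: cNw].
move=> t _; rewrite mulN1r -mulrN ler_piMr ?turning_rate_ge0//.
rewrite -lerN2 opprK; apply: le_trans (dot_geN _ _).
by rewrite (enorm_inner_normal B (c1 t)) w1 mulr1.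
Qed.

End turning.

Section steiner.
Context {R : realType}.
Variable D : C2_domain R.

Let phi : plane R -> plane R := s2val (cid2 (C2_setP D)).
Let Ephi : C2_embedding phi := s2valP (cid2 (C2_setP D)).
Let DE : C2_set D = image_disk phi := s2valP' (cid2 (C2_setP D)).

(** Only two unit vectors are orthogonal to the curve, and the opposite of the
    inner normal points into the exterior disk. *)
Lemma inward_normalE t : inward_normal D t = inner_normal phi (circle_point t).
Proof.
have [m [M B]] := embedding_bounds Ephi.
have e1 := circle_pointP t; set e := circle_point t in e1 *.
have g1E : derive1 (boundary_curve D) t = dd phi (turn e) e.
  rewrite (_ : boundary_curve D = phi \o @circle_point R)// derive1_circle; last exact: pb_C2 B.
  exact: velocityE B t.
set n := inner_normal phi e.
have n1 : enorm n = 1 := enorm_inner_normal B e1.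
have gn := inner_normal_tangent B e1; rewrite -/n in gn.
have s0 : 0 < m ^+ 2 / (3 * M).
  by rewrite divr_gt0 ?exprn_gt0 ?mulr_gt0 ?(pb_m B) ?(pb_M B).
rewrite /inward_normal; case: xgetP => [n' _ [n'1 gn' n'D]|/(_ n)[]]; last first.
  split => //; first by rewrite g1E dotC.
  near=> s; rewrite -/(boundary_curve D t) DE.
  have sgt : 0 < s by near: s; exact: nbhs_right_gt.
  have slt : s < m ^+ 2 / (3 * M) by near: s; exact: nbhs_right_lt.
  apply: (tangent_disk_sub B e1 s0 (small_tangent_radius B e1)).
  rewrite /disk /= -/n (_ : boundary_curve D t = phi e)//.
  rewrite (_ : _ - _ = (s - m ^+ 2 / (3 * M)) *: n); last first.
    by apply: plane_eq; rewrite !coordE; ring.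
  by rewrite enormZ n1 mulr1 ler0_norm ?subr_le0 ?(ltW slt)//; lra.
rewrite g1E dotC in gn'.
have q0 := dd_turn_neq0 B e1; have q1 := enorm_gt0 q0.
have := dot_frame n' n' n1 gn; rewrite !(dotC n' (dd _ _ _)) gn' mulr0 addr0.
rewrite -!enorm2 n'1 expr1n -expr2 => nn.
have {}nn : 1 = dot n' n ^+ 2.
  by apply: (mulfI _ nn); rewrite expf_neq0// gt_eqF.
have [h|h] := leP 0 (dot n' n).
  by apply: unit_vector_eq => //; nra.
have n'E : n' = - n.
  by apply: unit_vector_eq; rewrite ?enormN// dotNr; nra.
exfalso; near (0 : R)^'+ => s.
have sgt : 0 < s by near: s; exact: nbhs_right_gt.
have slt : s < m ^+ 2 / M.
  by near: s; apply: nbhs_right_lt; rewrite divr_gt0 ?exprn_gt0 ?(pb_m B) ?(pb_M B).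
have : C2_set D (boundary_curve D t + s *: n') by near: s.
rewrite DE n'E scalerN; exact: (exterior_point B e1 sgt slt).
Unshelve. all: by end_near. Qed.

Lemma curvature_speed t : curvature D t * speed D t = turning_rate phi t.
Proof.
have [m [M B]] := embedding_bounds Ephi.
rewrite /curvature /speed inward_normalE.
rewrite (_ : boundary_curve D = phi \o @circle_point R)//.
rewrite (derive1_circle (pb_C2 B)) (derive1_circle2 (pb_C2 B)) /turning_rate.
by field; rewrite gt_eqF// (velocity_gt0 B).
Qed.

Hypothesis cD : convex_set (D : set (plane R)).

(** The boundary point with normal [n] is [k - h n], with [k] in the half domain
    and [h] half the reach, and the normals average to zero for the curvature
    measure; so the Steiner point is an average of points [k] as well. *)
Lemma steiner_point_half : half_domain D (steiner_point D).
Proof.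
have [m [M B]] := embedding_bounds Ephi.
apply: contrapT => nK; set c := steiner_point D in nK.
have [p [Kp cp sep]] := half_domain_separation cD nK.
set u := c - p in cp sep.
set I := `[0, 2 * pi]%classic : set (measurableTypeR R).
pose q := turning_rate phi; pose g t := phi (circle_point t).
pose N t := inner_normal phi (circle_point t).
have cq : continuous q := continuous_turning_rate B.
have cg : continuous g.
  by move=> t; apply: (continuous_on_circle (param_continuous B)).
have cN : continuous N := continuous_inner_normal B.
have A1 := integral_turning_rate_ge1 B DE cD; rewrite -/q -/I in A1.
set A := Rintegral _ _ _ in A1.
have A0 : 0 < A by exact: lt_le_trans A1.
have bE (h : R -> R) : boundary_integral D (fun t => h t * curvature D t) =
    \int[@lebesgue_measure R]_(t in I) (h t * q t).
  apply: eq_Rintegral => t _.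
  by rewrite -mulrA curvature_speed.
have bA : boundary_integral D (curvature D) = A.
  by apply: eq_Rintegral => t _; rewrite curvature_speed.
have mI : measurable I by exact: measurable_itv.
have iI (f : R -> R) : continuous f ->
    (@lebesgue_measure R).-integrable I (EFin \o f) := @integrable_itv R f _ _.
have cE : A * dot u u = \int[@lebesgue_measure R]_(t in I) (dot (g t - p) u * q t).
  have c1 : continuous (fun t => (g t).1 * q t).
    by move=> t; apply: cvgM; [apply: cvg_plane1; exact: cg|exact: cq].
  have c2 : continuous (fun t => (g t).2 * q t).
    by move=> t; apply: cvgM; [apply: cvg_plane2; exact: cg|exact: cq].
  have cM (f : R -> R) k : continuous f -> continuous (fun t => f t * k).
    by move=> cf t; apply: cvgM; [exact: cf|exact: cvg_cst].
  transitivity (\int[@lebesgue_measure R]_(t in I)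
      (((g t).1 * q t * u.1 + (g t).2 * q t * u.2) + q t * - dot p u)).
    rewrite RintegralD//; last exact: iI (cM _ _ cq); last first.
      by apply: iI => t; apply: cvgD; [exact: (cM _ u.1 c1)|exact: (cM _ u.2 c2)].
    rewrite RintegralD//; [|exact: iI (cM _ _ c1)|exact: iI (cM _ _ c2)].
    rewrite (RintegralZr _ mI (iI _ c1)) (RintegralZr _ mI (iI _ c2)).
    rewrite (RintegralZr _ mI (iI _ cq)) -/A.
    have <- : A * c.1 = \int[@lebesgue_measure R]_(t in I) ((g t).1 * q t).
      by rewrite -(bE (fun t => (g t).1)) /c /steiner_point bA /= mulrC divfK// gt_eqF.
    have <- : A * c.2 = \int[@lebesgue_measure R]_(t in I) ((g t).2 * q t).
      by rewrite -(bE (fun t => (g t).2)) /c /steiner_point bA /= mulrC divfK// gt_eqF.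
    have -> : dot u u = dot c u - dot p u by rewrite -dotNl -dotDl.
    by rewrite {1}/dot; ring.
  by apply: eq_Rintegral => t _; rewrite dotDl dotNl [dot (g t) u]/dot; ring.
have h0 := half_reach_gt0 D.
suff : \int[@lebesgue_measure R]_(t in I) (dot (g t - p) u * q t) <= 0.
  rewrite -cE leNgt => /negP; apply; rewrite mulr_gt0// -enorm2 exprn_gt0//.
  exact: enorm_gt0.
have cgq : continuous (fun t => dot (g t - p) u * q t).
  move=> t; apply: cvgM; last exact: cq.
  by apply: cvg_dot; [apply: cvgB; [exact: cg|exact: cvg_cst]|exact: cvg_cst].
have cNq : continuous (fun t => q t * dot (N t) u).
  move=> t; apply: cvgM; first exact: cq.
  by apply: cvg_dot; [exact: cN|exact: cvg_cst].
have cNh : continuous (fun t => q t * dot (N t) u * half_reach D).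
  by move=> t; apply: cvgM; [exact: cNq|exact: cvg_cst].
have -> : \int[@lebesgue_measure R]_(t in I) (dot (g t - p) u * q t) =
    \int[@lebesgue_measure R]_(t in I)
      (dot (g t - p) u * q t + q t * dot (N t) u * half_reach D).
  rewrite RintegralD//; [|exact: iI|exact: iI].
  by rewrite (RintegralZr _ mI (iI _ cNq)) (integral_normal B) mul0r addr0.
have <- : \int[@lebesgue_measure R]_(t in I) (0 : R) = 0.
  by rewrite Rintegral_cst// mul0r.
apply: le_Rintegral => //; first by apply: iI => t; apply: cvgD; [exact: cgq|exact: cNh].
  by apply: iI => t; exact: cvg_cst.
move=> t _; have e1 := circle_pointP t.
have -> : dot (g t - p) u * q t + q t * dot (N t) u * half_reach D =
    q t * dot (g t + half_reach D *: N t - p) u.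
  by clearbody u; rewrite !dotB dotZl; ring.
apply: mulr_ge0_le0; first exact: (turning_rate_ge0 B DE cD).
have r01 : 0 <= half_reach D <= reach (image_disk phi).
  by rewrite (ltW h0) /= -DE; move: h0; rewrite /half_reach; lra.
apply: sep; split; first by rewrite DE; exact: (normal_mem B e1 r01).
by rewrite /= DE (bdist_normal B e1 r01) -DE.
Qed.

End steiner.

(** * Equivariant centers *)

Theorem theorem5p4 (R : realType)
    (r : set (plane R) -> plane R * R -> plane R)
    (r_family : retraction_family r) :
  (forall f : C2_domain R -> plane R,
     continuous f -> con_equivariant f ->
     is_center (induced_center r f) /\ con_equivariant (induced_center r f)) /\
  (forall f : C2_domain R -> plane R,
     [\/ f = @steiner_point R, f = @center_of_mass R | f = @circumcenter R] ->
     forall D : C2_domain R, convex_set (D : set (plane R)) ->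
       induced_center r f D = f D).
Proof.
split=> [f cf ef|f fE D cD].
  split; last exact: induced_center_equivariant r_family _ ef.
  split; first exact: induced_center_continuous r_family _ cf.
  by move=> D; exact: induced_center_interior.
rewrite /induced_center; apply: (retraction_half_fixed r_family).
case: fE => ->.
- exact: steiner_point_half.
- exact: center_of_mass_half.
- exact: circumcenter_half.
Qed.
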